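(* Let $\nu>0$ and, for $q\in\mathbb{R}$, let $\mathbf{e}^{(\nu)}_q(x):=\mathbf{e}^{(\nu)}(qx)$, $x\in\mathbb{R}$. Then: (1) $(\mathbf{e}^{(\nu)}_q)_{q\in\mathbb{R}}$ is a complete set of (generalized) eigenfunctions for $L^{(\nu)}=\frac12\frac{d}{dx}\frac{1}{|x|^\nu}\frac{d}{dx}$: $$L^{(\nu)}\mathbf{e}^{(\nu)}_q=-\tfrac12|q|^{\nu+2}\,\mathbf{e}^{(\nu)}_q .$$ (2) The functions $\mathbf{e}^{(\nu)}_q$ satisfy the orthogonality relation $$\int_{\mathbb{R}}dx\,\overline{\mathbf{e}^{(\nu)}(qx)}\,\mathbf{e}^{(\nu)}(q'x)=4u_\nu^2\,\delta(q-q')$$ in the sense that for every $g\in L^2(\mathbb{R})$ the limit $$\tilde g^{(\nu)}(q):=L^2\text{-}\lim_{R\to\infty}\int_{|x|<R}dx\,\overline{\mathbf{e}^{(\nu)}(qx)}\,g(x)$$ exists, and for all $g,h\in L^2(\mathbb{R})$ the generalized Plancherel formula $$\int_{\mathbb{R}}dx\,\overline{g(x)}\,h(x)=\frac{1}{4u_\nu^2}\int_{\mathbb{R}}dq\,\overline{\tilde g^{(\nu)}(q)}\,\tilde h^{(\nu)}(q)$$ holds. (3) The heat kernel $\phi_t^{(\nu)}(x,x')$ of $L^{(\nu)}$ can be written as $$\phi^{(\nu)}_t(x,x')=\frac{1}{4u_\nu^2}\int_{\mathbb{R}}dq\,e^{-\frac t2|q|^{\nu+2}}\,\mathbf{e}^{(\nu)}(qx)\,\overline{\mathbf{e}^{(\nu)}(qx')}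 .$$
   Context: For $\nu>0$ the function $\mathbf{e}^{(\nu)}:\mathbb{R}\to\mathbb{C}$ is $$\mathbf{e}^{(\nu)}(x):=u_\nu|x|^{\frac{\nu+1}{2}}\left[J_{-\frac{\nu+1}{\nu+2}}\Big(\frac{|x|^{\frac{\nu}{2}+1}}{\frac{\nu}{2}+1}\Big)+i\operatorname{sgn}(x)\,J_{\frac{\nu+1}{\nu+2}}\Big(\frac{|x|^{\frac{\nu}{2}+1}}{\frac{\nu}{2}+1}\Big)\right],\qquad u_\nu:=\Gamma\big(\tfrac{1}{\nu+2}\big)(\nu+2)^{-\frac{\nu+1}{\nu+2}},$$ extended continuously to $x=0$ by $\mathbf{e}^{(\nu)}(0)=1$; $J_\alpha$ is the Bessel function of the first kind of order $\alpha$. In (1), $L^{(\nu)}$ acts as a differential expression (the functions $\mathbf{e}^{(\nu)}_q$ are not in $L^2(\mathbb{R})$), and completeness is understood in the sense of the transform in (2). The heat kernel is, for $t>0$, $$\phi_t^{(\nu)}(x,x')=\frac{|xx'|^{\frac{\nu+1}{2}}}{t(\nu+2)}\,e^{-\frac{|x|^{\nu+2}+|x'|^{\nu+2}}{2t(\frac{\nu}{2}+1)^2}}\left(\mathcal{I}_{-\frac{\nu+1}{\nu+2}}\Big(\frac{|xx'|^{\frac{\nu}{2}+1}}{t(\frac{\nu}{2}+1)^2}\Big)+\operatorname{sgn}(xx')\,\mathcal{I}_{\frac{\nu+1}{\nu+2}}\Big(\frac{|xx'|^{\frac{\nu}{2}+1}}{t(\frac{\nu}{2}+1)^2}\Big)\right),$$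 with $\operatorname{sgn}(y)=y/|y|$, $\mathcal{I}_\alpha$ the modified Bessel function of the first kind of order $\alpha$, and extension by continuity when $xx'=0$; it is the transition density of the semigroup generated by $L^{(\nu)}$. *)

(* Defs.v *)
From HB Require Import structures.
From mathcomp Require Import all_boot all_order all_algebra.
From mathcomp Require Import all_classical all_reals all_analysis.
From mathcomp Require Import complex.

Set Implicit Arguments.
Unset Strict Implicit.
Unset Printing Implicit Defensive.

Import Order.TTheory GRing.Theory Num.Theory.
Import numFieldNormedType.Exports.

Local Open Scope classical_set_scope.
Local Open Scope ring_scope.
Local Open Scope complex_scope.

Section special_functions.
Context {R : realType}.
Implicit Types alpha z s : R.

(* Euler's integral, which is Gamma only for s > 0. *)
Definition Gamma s : R :=
  \int[lebesgue_measure]_(t in `]0, +oo[) (t `^ (s - 1) * expR (- t)).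

(* The two Bessel functions below are meant for alpha > -1 and z > 0, where
   the arguments of Gamma and the bases of the real powers are positive. *)
Definition besselJ alpha z : R :=
  limn (series (fun m : nat =>
    (-1) ^+ m / (m`!%:R * Gamma (m%:R + alpha + 1)) *
    (z / 2) `^ (2 * m%:R + alpha))).

Definition besselI alpha z : R :=
  limn (series (fun m : nat =>
    (m`!%:R * Gamma (m%:R + alpha + 1))^-1 *
    (z / 2) `^ (2 * m%:R + alpha))).

End special_functions.

(* Extension by continuity of the restriction of f to D. *)
Definition continuous_extension {R : realType} {T : topologicalType}
    (D : set T) (f : T -> R) (x : T) : R :=
  if x \in D then f x else lim (f y @[y --> within D (nbhs x)]).

Section eigenfunctions.
Context {R : realType} (nu : R).

Definition u_coef : R :=
  Gamma (1 / (nu + 2)) * (nu + 2) `^ (- ((nu + 1) / (nu + 2))).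

Definition ee (x : R) : R[i] :=
  if x == 0 then 1 else
  let a := (nu + 1) / (nu + 2) in
  let z := `|x| `^ (nu / 2 + 1) / (nu / 2 + 1) in
  (u_coef * `|x| `^ ((nu + 1) / 2))%:C *
  (besselJ (- a) z +i* (Num.sg x * besselJ a z)).

Definition eeq (q x : R) : R[i] := ee (q * x).

End eigenfunctions.

Section operator.
Context {R : realType} (nu : R).
Implicit Types f : R -> R.

(* The quasi-derivative |x|^-nu f'(x) is singular at 0, where it is read as a
   continuous extension; the operator thus acts on all of R and carries the
   usual transmission condition at the origin. *)
Definition quasi_derive f : R -> R :=
  continuous_extension [set x | x != 0] (fun x => f^`()%classic x / `|x| `^ nu).

Definition L_regular f : Prop :=
  [/\ forall x, derivable f x 1,
      cvg (f^`()%classic y / `|y| `^ nu @[y --> within [set y | y != 0] (nbhs 0)]) &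
      forall x, derivable (quasi_derive f) x 1].

Definition Lop f (x : R) : R := 2^-1 * (quasi_derive f)^`()%classic x.

(* The coefficients are real, so complex functions are treated componentwise. *)
Definition LopC (f : R -> R[i]) (x : R) : R[i] :=
  Lop (fun y => complex.Re (f y)) x +i* Lop (fun y => complex.Im (f y)) x.

Definition generalized_eigenfunction (lambda : R) (f : R -> R[i]) : Prop :=
  [/\ exists x, f x != 0,
      L_regular (fun y => complex.Re (f y)),
      L_regular (fun y => complex.Im (f y)) &
      forall x, LopC f x = lambda%:C * f x].

End operator.

Section complex_integration.
Context {R : realType}.
Local Notation mu := (@lebesgue_measure R).
Implicit Types (D : set R) (f g : R -> R[i]).

Definition cintegrable D f : Prop :=
  mu.-integrable D (fun x => (complex.Re (f x))%:E) /\
  mu.-integrable D (fun x => (complex.Im (f x))%:E).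

Definition cintegral D f : R[i] :=
  (\int[mu]_(x in D) complex.Re (f x)) +i* (\int[mu]_(x in D) complex.Im (f x)).

Definition L2norm f : \bar R := 'N[mu]_(2%:E)[EFin \o (fun x => ComplexField.Normc.normc (f x))]%E.

Definition L2 f : Prop :=
  [/\ measurable_fun setT (fun x => complex.Re (f x)),
      measurable_fun setT (fun x => complex.Im (f x)) &
      (L2norm f < +oo)%E].

Definition L2_limit (F : R -> R -> R[i]) f : Prop :=
  [/\ forall r, 0 < r -> L2 (F r),
      L2 f &
      L2norm (fun x => F r x - f x) @[r --> +oo] --> 0%E].

End complex_integration.

Section transform.
Context {R : realType} (nu : R).
Implicit Types g gt : R -> R[i].

Definition transform_integrand g (q x : R) : R[i] := conjc (ee nu (q * x)) * g x.

Definition truncated_transform g (r q : R) : R[i] :=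
  cintegral [set x | `|x| < r] (transform_integrand g q).

(* gt is a version of the L2-limit, which is unique up to null sets. *)
Definition is_transform g gt : Prop := L2_limit (truncated_transform g) gt.

(* No nonzero g in L2 has a vanishing transform. *)
Definition complete_system : Prop :=
  forall g gt, L2 g -> is_transform g gt ->
  (\forall q \ae @lebesgue_measure R, gt q = 0) ->
  (\forall x \ae @lebesgue_measure R, g x = 0).

End transform.

Section heat_kernel.
Context {R : realType} (nu : R).

Definition heat_kernel_formula (t : R) (p : R * R) : R :=
  let: (x, x') := p in
  let a := (nu + 1) / (nu + 2) in
  let z := `|x * x'| `^ (nu / 2 + 1) / (t * (nu / 2 + 1) ^+ 2) in
  `|x * x'| `^ ((nu + 1) / 2) / (t * (nu + 2)) *
  expR (- ((`|x| `^ (nu + 2) + `|x'| `^ (nu + 2)) /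
           (2 * t * (nu / 2 + 1) ^+ 2))) *
  (besselI (- a) z + Num.sg (x * x') * besselI a z).

Definition heat_kernel (t x x' : R) : R :=
  continuous_extension [set p : R * R | p.1 * p.2 != 0]
    (heat_kernel_formula t) (x, x').

End heat_kernel.

(* Main.v *)
From HB Require Import structures.
Require Import Defs.
From mathcomp Require Import all_boot all_order all_algebra.
From mathcomp Require Import all_classical all_reals all_analysis.
From mathcomp Require Import complex.
From mathcomp Require Import measurable_realfun ring lra.

Import Order.TTheory GRing.Theory Num.Theory.
Import numFieldNormedType.Exports.

Local Open Scope classical_set_scope.
Local Open Scope ring_scope.
Local Open Scope complex_scope.

(** Put [g = nu + 2], [beta = 1 / g] and [theta x = x |x|^nu]. The function [ee] splits
    into an even real part, a multiple of [Psi beta (- k |x|^g)], and an odd imaginary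
    part, a multiple of [theta x * Psi (2 - beta) (- k |x|^g)] ([eeE]), where [k = 1 / g^2]
    and [Psi b w] is the entire function with series [w^m / (m! Gamma (m + b))].

    Eigenfunctions. Differentiation shifts the parameter of [Psi], and the eigenvalue
    equation is the differential equation of [Psi] ([Psi_rec]). The powers of [x] combine
    so that the quasi-derivatives are regular at the origin ([eeq_eigenfunction]).

    Plancherel formula. The sum [kern] of the real and imaginary parts is a real kernel,
    related to [ee] as [cos + sin] is to the exponential; its integral transform is
    studied on real functions. Against a Gaussian [exp (- s |x|^g)], or [theta] times it,
    the series of [Psi] can be integrated term by term: the moments of the Gaussian are
    Gamma values that cancel those in the coefficients, and the result is again a Gaussian,
    of parameter [k / s] ([kern_gauss], [kern_theta_gauss]). The inner products of two
    transforms are therefore Gamma integrals too, and equal [4 u^2] times those of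
    the functions themselves ([gspan_isometry]). The span of these Gaussians is dense: in
    the variable [exp (- |x|^g)], an even function supported away from 0 and infinity is a
    continuous function on a segment, to which the Weierstrass theorem applies
    ([annular_approx]). So the closure [Gr] of the transform on the span is a multiple of an
    isometry ([Gr_isometry]). It is given by the integral for functions of bounded support
    ([cut_Gr]), and by completeness of L2 it is defined everywhere ([Gr_exists]). The
    complex transform is recovered from the even and odd parts of the real ones
    ([spectrum]); in inner products the unwanted terms cancel between [q] and [- q]
    ([spectrum_inner]). Completeness of the system is the injectivity of an isometry.

    Heat kernel. Its formula extends to a function of the plane that is entire in the powers
    [|x|^g] and [|x'|^g], up to [theta] factors ([heat_kernelE]). Against Gaussians in [x']
    narrow enough, this function and the spectral integral both reduce to the integrals
    above, and agree ([heat_closed_gspan], [heat_spectral_gspan]). Both are continuous, with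
    growth at most that of the inverse of a Gaussian, and a function of this kind that is
    orthogonal to all narrow Gaussians vanishes ([gspan_uniqueness]). *)

Set Implicit Arguments.
Unset Strict Implicit.

(** * Integration of real functions over the line *)

Section real_integrals.
Context {R : realType}.
Local Notation mu := (@lebesgue_measure R).
Implicit Types f g h : R -> R.

Lemma measurable_EFin d (T : measurableType d) (f : T -> R) :
  measurable_fun setT f -> measurable_fun setT (fun x => (f x)%:E).
Proof. by move/measurable_EFinP. Qed.

Lemma measurable_EFinS (D : set R) f : measurable_fun setT f -> measurable_fun D (fun x => (f x)%:E).
Proof. by move=> mf; apply: measurable_funTS; exact: measurable_EFin. Qed.

Definition summable f : Prop := mu.-integrable setT (EFin \o f).

Lemma summable_measurable f : summable f -> measurable_fun setT f.
Proof. by move=> /measurable_int/measurable_EFinP. Qed.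

Lemma le_summable f g : measurable_fun setT f -> (forall x, `|f x| <= g x) ->
  summable g -> summable f.
Proof.
move=> mf fg; apply: le_integrable => //; first exact/measurable_EFinP.
by move=> x _ /=; rewrite lee_fin (le_trans (fg x))// ler_norm.
Qed.

Lemma summableD f g : summable f -> summable g -> summable (fun x => f x + g x).
Proof.
move=> sf sg; rewrite /summable (_ : _ \o _ = (EFin \o f) \+ (EFin \o g))%E //.
exact: integrableD.
Qed.

Lemma summableZ k f : summable f -> summable (fun x => k * f x).
Proof.
move=> sf; rewrite /summable (_ : _ \o _ = (fun x => k%:E * (EFin \o f) x))%E //.
exact: integrableZl.
Qed.

Lemma summableN f : summable f -> summable (fun x => - f x).
Proof.
move=> /(summableZ (-1)); congr summable; apply/funext => x; by rewrite mulN1r.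
Qed.

Lemma summableB f g : summable f -> summable g -> summable (fun x => f x - g x).
Proof. by move=> sf /summableN; exact: summableD. Qed.

Lemma summable_norm f : summable f -> summable (fun x => `|f x|).
Proof. exact: integrable_norm. Qed.

Lemma summable_ge0 f : measurable_fun setT f -> (forall x, 0 <= f x) ->
  (\int[mu]_x (f x)%:E < +oo)%E -> summable f.
Proof.
move=> mf f0 fy; apply/integrableP; split; first exact/measurable_EFinP.
apply: le_lt_trans fy; rewrite le_eqVlt; apply/orP; left; apply/eqP.
by apply: eq_integral => x _ /=; rewrite ger0_norm.
Qed.

Lemma EFin_Rint f : summable f ->
  (\int[mu]_x f x)%:E = (\int[mu]_x (f x)%:E)%E.
Proof. by move=> sf; rewrite fineK//; exact: integrable_fin_num. Qed.

Lemma eq_Rint f g : f =1 g -> \int[mu]_x f x = \int[mu]_x g x.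
Proof. by move=> fg; apply: eq_Rintegral => x _; exact: fg. Qed.

Lemma RintD f g : summable f -> summable g ->
  \int[mu]_x (f x + g x) = \int[mu]_x f x + \int[mu]_x g x.
Proof. by move=> sf sg; rewrite RintegralD. Qed.

Lemma RintB f g : summable f -> summable g ->
  \int[mu]_x (f x - g x) = \int[mu]_x f x - \int[mu]_x g x.
Proof. by move=> sf sg; rewrite RintegralB. Qed.

Lemma RintZ k f : summable f -> \int[mu]_x (k * f x) = k * \int[mu]_x f x.
Proof. by move=> sf; rewrite RintegralZl. Qed.

Lemma ler_Rint f g : summable f -> summable g -> (forall x, f x <= g x) ->
  \int[mu]_x f x <= \int[mu]_x g x.
Proof. by move=> sf sg fg; apply: le_Rintegral. Qed.

Lemma ler_norm_Rint f g : measurable_fun setT f -> summable g ->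
  (forall x, `|f x| <= g x) -> `|\int[mu]_x f x| <= \int[mu]_x g x.
Proof.
move=> mf sg fg; have sf := le_summable mf fg sg.
apply: le_trans (le_normr_Rintegral _ sf) _ => //.
by apply: ler_Rint => //; exact: summable_norm.
Qed.

Lemma Rint_dominated_cvg (f_ : nat -> R -> R) f g :
  (forall n, measurable_fun setT (f_ n)) -> summable g ->
  (forall n x, `|f_ n x| <= g x) -> (forall x, f_ n x @[n --> \oo] --> f x) ->
  summable f /\ \int[mu]_x f_ n x @[n --> \oo] --> \int[mu]_x f x.
Proof.
move=> mf sg fg ff.
have mlim : measurable_fun setT f by apply: (measurable_fun_cvg mf) => x _.
have [] := @dominated_convergence _ _ _ mu setT measurableT
  (fun n x => (f_ n x)%:E) (EFin \o f) (EFin \o g).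
- by move=> n; apply/measurable_EFinP; exact: mf.
- by apply/measurable_EFinP; exact: mlim.
- by apply: aeW => x _; apply: cvg_EFin; [exact: nearW | exact: ff].
- exact: sg.
- by apply: aeW => x n _; rewrite /= lee_fin.
move=> sf _ cf; split => //.
have sfn n : summable (f_ n) by apply: le_summable sg => // x.
apply: fine_cvg; rewrite fineK; last exact: integrable_fin_num.
exact: cf.
Qed.

Lemma fatou_le (f_ : nat -> R -> R) f (c : \bar R) :
  (forall n, measurable_fun setT (f_ n)) -> (forall n x, 0 <= f_ n x) ->
  (forall x, f_ n x @[n --> \oo] --> f x) ->
  (\forall n \near \oo, (\int[mu]_x (f_ n x)%:E <= c)%E) ->
  (\int[mu]_x (f x)%:E <= c)%E.
Proof.
move=> mf f0 ff fc.
rewrite (_ : (\int[mu]_x (f x)%:E = \int[mu]_x limn_einf (fun n => (f_ n x)%:E))%E); last first.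
  apply: eq_integral => x _; have cf : (f_ n x)%:E @[n --> \oo] --> (f x)%:E.
    by apply: cvg_EFin; [exact: nearW | exact: ff].
  by have [-> _] := cvg_limn_einf_sup cf.
apply: le_trans (fatou _ _ _ _) _ => //.
- by move=> n; apply: measurable_EFin; exact: mf.
- by move=> n x _; rewrite lee_fin.
rewrite limn_einf_lim; apply: lime_le; first exact: is_cvg_einfs.
apply: nearW => n; have [N _ HN] := fc.
apply: (@le_trans _ _ (\int[mu]_x (f_ (maxn n N) x)%:E)%E).
  by apply: ereal_inf_lbound; exists (maxn n N) => //=; rewrite leq_maxl.
by apply: HN => /=; rewrite leq_maxr.
Qed.

Lemma integral_oppr (f : R -> \bar R) : measurable_fun setT f ->
  (\int[mu]_x f (- x)%R = \int[mu]_x f x)%E.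
Proof.
move=> mf.
have ge0P (g : R -> \bar R) : measurable_fun setT g -> (forall x, 0 <= g x)%E ->
    (\int[mu]_x g (- x)%R = \int[mu]_x g x)%E.
  move=> mg g0.
  transitivity (\int[pushforward mu (-%R : _ -> measurableTypeR R)]_x g x)%E.
    by rewrite ge0_integral_pushforward.
  by apply: eq_measure_integral => //= A mA AS; exact: lebesgue_measureN.
rewrite integralE [RHS]integralE -(ge0P f^\+%E)//; last exact: measurable_funepos.
rewrite -(ge0P f^\-%E)//; last exact: measurable_funeneg.
by congr (_ - _)%E; apply: eq_integral => x _; rewrite ?funeposE ?funenegE.
Qed.

Lemma Rint_oppr f : measurable_fun setT f ->
  \int[mu]_x f (- x) = \int[mu]_x f x.
Proof.
by move=> mf; rewrite /Rintegral (integral_oppr (f := EFin \o f))//; exact/measurable_EFinP.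
Qed.

Lemma measurable_oppr f : measurable_fun setT f ->
  measurable_fun setT (fun x : R => f (- x)).
Proof. by move=> mf; apply: measurableT_comp => //; exact: oppr_measurable. Qed.

Lemma summable_oppr f : summable f -> summable (fun x => f (- x)).
Proof.
move=> sf; have mf := summable_measurable sf.
apply/integrableP; split; first by apply: measurable_EFin; exact: measurable_oppr.
move: sf => /integrableP[_]; apply: le_lt_trans.
rewrite (integral_oppr (f := fun x => `|(f x)%:E|%E))//.
by apply: measurableT_comp => //; exact: measurable_EFin.
Qed.

Lemma Rint_odd f : measurable_fun setT f -> (forall x, f (- x) = - f x) ->
  summable f -> \int[mu]_x f x = 0.
Proof.
move=> mf oddf sf.
have h : \int[mu]_x f x = - \int[mu]_x f x.
  rewrite -{1}(Rint_oppr mf) (@eq_Rint _ (fun x => -1 * f x)); last first.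
    by move=> x; rewrite oddf mulN1r.
  by rewrite RintZ// mulN1r.
lra.
Qed.

(** A majorant in product form makes both the sections and the double integral
    converge absolutely, so it is all that the exchange needs. *)
Lemma Rint_fubini (F : R -> R -> R) (a b : R -> R) :
  measurable_fun setT (fun p : R * R => F p.1 p.2) ->
  summable a -> summable b -> (forall x y, `|F x y| <= a x * b y) ->
  [/\ summable (fun x => \int[mu]_y F x y),
      summable (fun y => \int[mu]_x F x y) &
      \int[mu]_x (\int[mu]_y F x y) = \int[mu]_y (\int[mu]_x F x y)].
Proof.
move=> mF sa sb Fab.
have sFx x : summable (F x).
  apply: le_summable (Fab x) (summableZ (a x) sb).
  exact: (measurable_comp (F := setT) _ _ mF (pair1_measurable _)).
have sFy y : summable (F^~ y).
  have := summableZ (b y) sa; apply: le_summable.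
    exact: (measurable_comp (F := setT) _ _ mF (pair2_measurable _)).
  by move=> x; rewrite mulrC.
pose G := fun p : R * R => (F p.1 p.2)%:E.
have mG : measurable_fun setT G by exact/measurable_EFinP.
have iG : (mu \x mu)%E.-integrable setT G.
  apply: (proj2 (@integrable12ltyP _ _ _ _ R mu mu G mG)).
  have mF1 x : measurable_fun setT (fun y => `|F x y|).
    by apply: measurableT_comp => //; exact: summable_measurable.
  have ma := summable_measurable (summable_norm sa).
  have mb := summable_measurable (summable_norm sb).
  apply: (@le_lt_trans _ _ (\int[mu]_x ((\int[mu]_y `|b y|)%R * `|a x|)%:E)%E).
    apply: ge0_le_integral => //.
    - by move=> x _; exact: integral_ge0.
    - apply: (measurable_fun_fubini_tonelli_F (m2 := mu) (fun p => `|G p|%E)) => //.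
      by apply: measurableT_comp => //.
    - by apply: measurable_EFin; apply: measurable_funM.
    move=> x _; rewrite EFinM (EFin_Rint (summable_norm sb)).
    rewrite muleC -ge0_integralZl//; last exact: measurable_EFin.
    apply: ge0_le_integral => //.
    - by apply: measurable_EFin; exact: mF1.
    - by apply: measurable_EFin; apply: measurable_funM.
    by move=> y _; rewrite /G /= lee_fin -normrM (le_trans (Fab x y))// ler_norm.
  have : summable (fun x => (\int[mu]_y `|b y|) * `|a x|).
    by apply: summableZ; exact: summable_norm.
  move=> s; rewrite -EFin_Rint//; exact: ltry.
split.
- have := integrable_fubini_F iG; congr (_.-integrable _ _).
  by apply/funext => x; rewrite /= EFin_Rint.
- pose G' := fun p : R * R => (F p.2 p.1)%:E.
  have mG' : measurable_fun setT G'.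
    apply: measurable_EFin.
    exact: (measurableT_comp mF (measurable_fun_pair measurable_snd measurable_fst)).
  have iG' : (mu \x mu)%E.-integrable setT G'.
    apply: (proj2 (@integrable12ltyP _ _ _ _ R mu mu _ mG')).
    exact: (proj1 (@integrable21ltyP _ _ _ _ R mu mu _ mG) iG).
  have := integrable_fubini_F iG'; congr (_.-integrable _ _).
  by apply/funext => x; rewrite /= EFin_Rint.
- have := Fubini iG; rewrite /G/=.
  under eq_integral do rewrite -EFin_Rint//.
  under [in X in _ = X -> _]eq_integral do rewrite -EFin_Rint//.
  by rewrite /Rintegral => ->.
Qed.

Lemma ge0_le_int (D : set R) f g : measurable D ->
  measurable_fun setT f -> measurable_fun setT g ->
  (forall x, D x -> 0 <= f x) -> (forall x, D x -> f x <= g x) ->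
  (\int[mu]_(x in D) (f x)%:E <= \int[mu]_(x in D) (g x)%:E)%E.
Proof.
move=> mD mf mg f0 fg; apply: ge0_le_integral; first exact: mD.
- by move=> x Dx; rewrite lee_fin f0.
- exact: measurable_EFinS.
- exact: measurable_EFinS.
- by move=> x Dx; rewrite lee_fin fg.
Qed.

Lemma ge0_subset_int (A B : set R) f : measurable A -> measurable B ->
  measurable_fun setT f -> (forall x, B x -> 0 <= f x) -> A `<=` B ->
  (\int[mu]_(x in A) (f x)%:E <= \int[mu]_(x in B) (f x)%:E)%E.
Proof.
move=> mA mB mf f0 AB; apply: ge0_subset_integral => //; exact: measurable_EFinS.
Qed.

End real_integrals.

(** * Euler's Gamma integral *)

Section gamma_function.
Context {R : realType}.
Local Notation mu := (@lebesgue_measure R).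
Implicit Types s t : R.

Lemma is_derive_continuous (f : R -> R) x l :
  is_derive x (1 : R) f l -> {for x, continuous f}.
Proof.
by move=> [fx _]; apply: differentiable_continuous; exact/derivable1_diffP.
Qed.

Lemma is_derive1M (f g : R -> R) x a b :
  is_derive x (1 : R) f a -> is_derive x (1 : R) g b ->
  is_derive x (1 : R) (fun x => f x * g x) (a * g x + f x * b).
Proof.
move=> df dg; have := is_deriveM df dg; rewrite /GRing.scale/=.
by rewrite addrC (mulrC (g x)).
Qed.

Lemma is_derive1Z (k : R) (f : R -> R) x a :
  is_derive x (1 : R) f a -> is_derive x (1 : R) (fun x => k * f x) (k * a).
Proof. by move=> df; have := is_deriveZ k df. Qed.

Lemma is_derive1_expRN (x : R) :
  is_derive x (1 : R) (fun t => expR (- t)) (- expR (- x)).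
Proof.
have := is_derive1_comp (is_derive_expR (- x)) (is_deriveN (is_derive_id x (1 : R))).
by rewrite mulrN1.
Qed.

Lemma powR_continuous_at s x : 0 < x -> {for x, continuous (fun t : R => t `^ s)}.
Proof. by move=> x0; exact: (is_derive_continuous (is_derive1_powR s x0)). Qed.

Definition gamma_integrand s t : R := t `^ (s - 1) * expR (- t).

Lemma gamma_integrand_ge0 s t : 0 <= gamma_integrand s t.
Proof. by rewrite mulr_ge0 ?powR_ge0 ?expR_ge0. Qed.

Lemma measurable_gamma_integrand s (D : set R) : measurable_fun D (gamma_integrand s).
Proof.
apply: measurable_funTS; apply: measurable_funM; first exact: measurable_powR.
by apply: measurableT_comp => //; exact: oppr_measurable.
Qed.

Lemma is_derive_powR_expRN s t : 0 < t ->
  is_derive t (1 : R) (fun t => t `^ s * expR (- t))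
    (s * gamma_integrand s t - gamma_integrand (s + 1) t).
Proof.
move=> t0.
have := is_derive1M (is_derive1_powR s t0) (is_derive1_expRN t).
move=> h; apply: (is_derive_eq h).
by rewrite /gamma_integrand addrK; ring.
Qed.

(** Splitting [ln t] as [ln (t / 2s) + ln 2s] and using [ln x < x]. *)
Lemma powR_le_expR s t : 0 < s -> 0 < t ->
  t `^ s <= (2 * s) `^ s * expR (t / 2).
Proof.
move=> s0 t0; have s20 : 0 < 2 * s by rewrite mulr_gt0.
rewrite {1 2}/powR !gt_eqF//= -expRD ler_expR.
have /ln_sublinear : 0 < t / (2 * s) by rewrite divr_gt0.
rewrite ln_div ?posrE// => /ltW h.
have := ler_wpM2l (ltW s0) h.
have -> : s * (t / (2 * s)) = t / 2 by field; rewrite gt_eqF.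
lra.
Qed.

Let E (n : nat) : set R := `[n.+1%:R^-1, n.+2%:R]%classic.

Let E_bigcup : \bigcup_n E n = `]0, +oo[%classic.
Proof.
apply/seteqP; split => [x [n _]|x]; rewrite /E/= !in_itv/= ?andbT.
  by move=> /andP[h _]; apply: lt_le_trans h; rewrite invr_gt0.
move=> x0.
have [n1 h1] : exists n, x^-1 <= n.+1%:R.
  exists (Num.trunc x^-1); exact/ltW/truncnS_gt.
have [n2 h2] : exists n, x <= n.+1%:R.
  exists (Num.trunc x); exact/ltW/truncnS_gt.
exists (maxn n1 n2) => //=; rewrite in_itv/=; apply/andP; split.
  rewrite invf_ple ?posrE//; apply: le_trans h1 _.
  by rewrite ler_nat ltnS leq_maxl.
by apply: le_trans h2 _; rewrite ler_nat ltnS leqW// leq_maxr.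
Qed.

Lemma cvg_integral_exhaust (f : R -> R) : measurable_fun setT f ->
  (forall x, 0 <= f x) ->
  (\int[mu]_(x in E n) (f x)%:E @[n --> \oo] -->
   \int[mu]_(x in `]0%R, +oo[%classic) (f x)%:E)%E.
Proof.
move=> mf f0; rewrite -E_bigcup.
apply: ge0_nondecreasing_set_cvg_integral => //.
- move=> m n mn; apply/subsetPset => x; rewrite /E/= !in_itv/= => /andP[h1 h2].
  apply/andP; split.
    by apply: le_trans h1; rewrite lef_pV2 ?posrE// ler_nat.
  by apply: le_trans h2 _; rewrite ler_nat.
- by move=> n; exact: measurable_itv.
- by move=> n; exact: measurable_EFinS.
- by move=> n x _; rewrite lee_fin.
Qed.

Definition gamma_integral s : \bar R :=
  (\int[mu]_(t in `]0%R, +oo[%classic) (gamma_integrand s t)%:E)%E.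

(* The boundary terms of the integration by parts on [E n]. *)
Let bdry s (n : nat) : R :=
  n.+1%:R^-1 `^ s * expR (- n.+1%:R^-1) - n.+2%:R `^ s * expR (- n.+2%:R).

Let bdry_cvg0 s : 0 < s -> bdry s n @[n --> \oo] --> (0 : R).
Proof.
move=> s0; rewrite -(subr0 0); apply: cvgB.
  apply: (@squeeze_cvgr _ _ _ _ (fun=> 0) (fun n : nat => (n.+1%:R^-1 : R) `^ s)).
  - apply: nearW => n; rewrite mulr_ge0 ?powR_ge0 ?expR_ge0//=.
    by rewrite ler_piMr ?powR_ge0// expR_le1 oppr_le0 invr_ge0.
  - exact: cvg_cst.
  - apply: (@cvg_comp _ _ _ (fun n : nat => (n.+1%:R^-1 : R)) (fun x : R => x `^ s) _ (0^'+)).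
      move=> P nP.
      have := @cvg_harmonic R (fun x : R => 0 < x -> P x) nP.
      move=> /= hP; change (\forall n \near \oo, P (n.+1%:R^-1)).
      apply: (@filterS nat \oo _ (fun n => 0 < (n.+1%:R^-1 : R) -> P n.+1%:R^-1) _ _ hP) => n.
      have p : 0 < n.+1%:R^-1 :> R by rewrite invr_gt0.
      by move=> h; exact: (h p).
    exact: powR_cvg0.
apply: (@squeeze_cvgr _ _ _ _ (fun=> 0)
  (fun n : nat => (2 * s) `^ s * expR (- (n.+2%:R / 2)))).
- apply: nearW => n; rewrite mulr_ge0 ?powR_ge0 ?expR_ge0//=.
  apply: le_trans (ler_wpM2r (expR_ge0 _) (powR_le_expR s0 (ltr0Sn _ _))) _.
  rewrite -mulrA -expRD; rewrite le_eqVlt; apply/orP; left; apply/eqP.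
  by congr (_ * expR _); lra.
- exact: cvg_cst.
- rewrite -(mulr0 ((2 * s) `^ s)); apply: cvgMr.
  apply: (@cvg_comp _ _ _ (fun n : nat => (n.+2%:R : R)) (fun x => expR (- (x / 2))) _ +oo).
    apply/cvgryPge => A; exists (Num.trunc A) => //= n An.
    apply: le_trans (ltW (truncnS_gt A)) _.
    by rewrite ler_nat ltnS (leq_trans An).
  apply: (@cvg_comp _ _ _ (fun x : R => x / 2) (fun x => expR (- x)) _ +oo); last exact: cvgr_expR.
  by apply: gt0_cvgMly => //; rewrite invr_gt0.
Qed.

(** Integration by parts, on an exhaustion of the half-line as the integrand
    of [Gamma] may be singular at 0; it holds before finiteness is known. *)
Lemma gamma_integralS s : 0 < s ->
  gamma_integral (s + 1) = (s%:E * gamma_integral s)%E.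
Proof.
move=> s0.
have c1 r := cvg_integral_exhaust (@measurable_gamma_integrand r setT)
  (gamma_integrand_ge0 r).
have En0 n t : E n t -> 0 < t.
  by rewrite /E/= in_itv/= => /andP[h _]; apply: lt_le_trans h; rewrite invr_gt0.
have En n : (n.+1%:R^-1 : R) < n.+2%:R.
  apply: (@le_lt_trans _ _ 1); last by rewrite ltr1n.
  by rewrite invf_le1 ?ler1n.
have cgi r x : 0 < x -> {for x, continuous (gamma_integrand r)}.
  move=> x0; apply: continuousM; first exact: powR_continuous_at.
  by apply: continuous_comp; [exact: opp_continuous | exact: continuous_expR].
have iE r n : mu.-integrable (E n) (fun t => (gamma_integrand r t)%:E).
  apply: continuous_compact_integrable; first exact: segment_compact.
  by apply: continuous_in_subspaceT => x /set_mem/En0; exact: cgi.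
have key n : (\int[mu]_(t in E n) (gamma_integrand (s + 1) t)%:E =
    s%:E * \int[mu]_(t in E n) (gamma_integrand s t)%:E + (bdry s n)%:E)%E.
  have FTC := @continuous_FTC2 R
    (fun t => s * gamma_integrand s t - gamma_integrand (s + 1) t)
    (fun t => t `^ s * expR (- t)) _ _ (En n).
  have En0' t : t \in `](n.+1%:R^-1 : R), n.+2%:R[ -> 0 < t.
    by rewrite in_itv/= => /andP[h _]; apply: lt_trans h; rewrite invr_gt0.
  have dF t : 0 < t -> is_derive t (1 : R) (fun t : R => t `^ s * expR (- t))
    (s * gamma_integrand s t - gamma_integrand (s + 1) t).
    exact: is_derive_powR_expRN.
  have cF t : 0 < t -> {for t, continuous (fun t : R => t `^ s * expR (- t))}.
    by move=> t0; exact: is_derive_continuous (dF t t0).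
  have h1 : {within `[(n.+1%:R^-1 : R), n.+2%:R],
      continuous (fun t => s * gamma_integrand s t - gamma_integrand (s + 1) t)}.
    apply: continuous_in_subspaceT => x /set_mem/En0 x0.
    apply: cvgB; last exact: cgi.
    by apply: cvgMr; exact: cgi.
  have h2 : derivable_oo_LRcontinuous (fun t => t `^ s * expR (- t))
      (n.+1%:R^-1 : R) n.+2%:R.
    split.
    - by move=> x /En0' x0; apply: ex_derive; exact: dF.
    - by apply: cvg_at_right_filter; apply: cF; rewrite invr_gt0.
    - by apply: cvg_at_left_filter; exact: cF.
  have h3 : {in `](n.+1%:R^-1 : R), n.+2%:R[, (fun t : R => t `^ s * expR (- t))^`()%classic
      =1 (fun t => s * gamma_integrand s t - gamma_integrand (s + 1) t)}.
    by move=> x /En0' x0; rewrite derive1E; have [_ ->] := dF _ x0.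
  have {FTC} := FTC h1 h2 h3.
  rewrite -/(E n); under eq_integral do rewrite EFinB.
  rewrite integralB; [| exact: measurable_itv | | exact: iE]; last first.
    by under eq_fun do rewrite EFinM; apply: integrableZl; [exact: measurable_itv | exact: iE].
  under eq_integral do rewrite EFinM.
  rewrite integralZl; [| exact: measurable_itv | exact: iE].
  have fE r : (\int[mu]_(t in E n) (gamma_integrand r t)%:E)%E \is a fin_num.
    by apply: integrable_fin_num; [exact: measurable_itv | exact: iE].
  rewrite /bdry -(fineK (fE s)) -(fineK (fE (s + 1))).
  rewrite -!EFinM -!EFinB -EFinD => -[h]; congr EFin; lra.
have c2 : (\int[mu]_(t in E n) (gamma_integrand (s + 1) t)%:E @[n --> \oo] -->
    s%:E * gamma_integral s)%E.
  rewrite (_ : (fun n => _) = (fun n =>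
    s%:E * \int[mu]_(t in E n) (gamma_integrand s t)%:E + (bdry s n)%:E)%E); last first.
    by apply/funext => n; exact: key.
  rewrite -[X in _ --> X]adde0; apply: cvgeD.
  - by rewrite fin_num_adde_defl.
  - by apply: cvgeZl => //; exact: c1.
  - by apply: cvg_EFin; [exact: nearW | exact: bdry_cvg0].
exact: (cvg_unique _ (c1 (s + 1)) c2).
Qed.

(** Above 1 the integrand is dominated by an exponential density; the recursion,
    valid for infinite values too, carries finiteness down to all [s > 0]. *)
Lemma gamma_integral_lty s : 0 < s -> (gamma_integral s < +oo)%E.
Proof.
move=> s0.
have large r : 0 < r -> (gamma_integral (r + 1) < +oo)%E.
  move=> r0; pose C := (2 * r) `^ r * 2.
  have pos2 : 0 < 2^-1 :> R by rewrite invr_gt0.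
  apply: (@le_lt_trans _ _ (\int[mu]_t (C * exponential_pdf 2^-1 t)%:E)%E); last first.
    under eq_integral do rewrite EFinM.
    rewrite integralZl//; last exact: integrable_exponential_pdf.
    by rewrite integral_exponential_pdf// mule1 ltry.
  have mpdf : measurable_fun setT (exponential_pdf (2^-1 : R)).
    exact: measurable_exponential_pdf.
  have C0 : 0 <= C by rewrite mulr_ge0 ?powR_ge0.
  apply: (@le_trans _ _ (\int[mu]_(t in `]0%R, +oo[%classic) (C * exponential_pdf 2^-1 t)%:E)%E).
    apply: ge0_le_integral => //.
    - by move=> t _; rewrite lee_fin gamma_integrand_ge0.
    - by apply: measurable_EFinS; exact: measurable_gamma_integrand.
    - by apply: measurable_EFinS; apply: measurable_funM.
    move=> t /=; rewrite in_itv/= andbT => t0; rewrite lee_fin.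
    rewrite /exponential_pdf patchE mem_set/=; last by rewrite in_itv/= andbT ltW.
    rewrite /gamma_integrand addrK /C mulrA mulfK//.
    apply: le_trans (ler_wpM2r (expR_ge0 _) (powR_le_expR r0 t0)) _.
    rewrite -mulrA -expRD le_eqVlt; apply/orP; left; apply/eqP.
    by congr (_ * expR _); lra.
  apply: ge0_subset_integral => //.
    by apply: measurable_EFin; apply: measurable_funM.
  by move=> t _; rewrite lee_fin mulr_ge0// exponential_pdf_ge0// ltW.
have := large _ s0; rewrite gamma_integralS//.
have g0 : (0 <= gamma_integral s)%E.
  by apply: integral_ge0 => t _; rewrite lee_fin gamma_integrand_ge0.
move: g0; case: (gamma_integral s) => [r _ _|_|//]; first by rewrite ltry.
by rewrite gt0_muley ?lte_fin.
Qed.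

Lemma EFin_Gamma s : 0 < s -> (Gamma s)%:E = gamma_integral s.
Proof.
move=> s0; rewrite /Gamma /Rintegral fineK// ge0_fin_numE.
  exact: gamma_integral_lty.
by apply: integral_ge0 => t _; rewrite lee_fin gamma_integrand_ge0.
Qed.

Lemma GammaS s : 0 < s -> Gamma (s + 1) = s * Gamma s.
Proof.
move=> s0; apply/eqP; rewrite -eqe EFinM !EFin_Gamma ?addr_gt0//.
by rewrite gamma_integralS.
Qed.

Lemma Gamma_gt0 s : 0 < s -> 0 < Gamma s.
Proof.
move=> s0; rewrite -(pmulr_rgt0 _ s0) -GammaS// -lte_fin EFin_Gamma ?addr_gt0//.
apply: (@lt_le_trans _ _ (\int[mu]_(t in `[1%R, 2%R]%classic) (expR (- 2))%:E)%E).
  rewrite integral_cst//= lebesgue_measure_itv/= lte_fin ltr1n/=.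
  by rewrite -EFinB mule_gt0// lte_fin ?expR_gt0//; lra.
apply: (@le_trans _ _ (\int[mu]_(t in `[1%R, 2%R]%classic) (gamma_integrand (s + 1) t)%:E)%E).
  apply: ge0_le_int => //.
  - exact: measurable_gamma_integrand.
  - move=> t /=; rewrite in_itv/= => /andP[t1 t2].
    rewrite /gamma_integrand addrK -[leLHS]mul1r ler_pM ?expR_ge0//.
      by rewrite -(powRr0 t) ler_powR// ltW.
    by rewrite ler_expR lerN2.
apply: ge0_subset_int => //.
- exact: measurable_gamma_integrand.
- by move=> t _; rewrite gamma_integrand_ge0.
- by move=> t /=; rewrite !in_itv/= andbT => /andP[t1 _]; exact: lt_le_trans t1.
Qed.

End gamma_function.

(** * The Bessel-Clifford function *)
Definition Psi_coef {R : realType} (b : R) (m : nat) : R :=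
  (m`!%:R * Gamma (m%:R + b))^-1.

(** The Bessel-Clifford function: both [J] and [I] of order [b - 1] are a power
    times a value of it, and unlike them it is entire. *)
HB.lock Definition Psi {R : realType} (b w : R) : R := limn (pseries (Psi_coef b) w).

Section bessel_clifford.
Context {R : realType}.
Implicit Types (b w x : R) (m n : nat).

Lemma addnb_gt0 b m : 0 < b -> 0 < m%:R + b.
Proof. by move=> b0; rewrite ltr_wpDl. Qed.

Lemma Psi_coef_gt0 b m : 0 < b -> 0 < Psi_coef b m.
Proof.
move=> b0; rewrite invr_gt0 mulr_gt0 ?ltr0n ?fact_gt0//.
by apply: Gamma_gt0; exact: addnb_gt0.
Qed.

Lemma Psi_coefS b m : 0 < b ->
  (m%:R + b) * m.+1%:R * Psi_coef b m.+1 = Psi_coef b m.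
Proof.
move=> b0; have mb := addnb_gt0 m b0.
have h : Gamma (m.+1%:R + b) = (m%:R + b) * Gamma (m%:R + b).
  by rewrite -GammaS// -natr1; congr Gamma; ring.
rewrite /Psi_coef h factS natrM; have g0 := Gamma_gt0 mb.
by field; rewrite nat1r !pnatr_eq0 -lt0n fact_gt0 !gt_eqF.
Qed.

Lemma Psi_coef_diffs b : 0 < b -> pseries_diffs (Psi_coef b) = Psi_coef (b + 1).
Proof.
move=> b0; apply/funext => m; rewrite /pseries_diffs /Psi_coef factS natrM.
have -> : m.+1%:R + b = m%:R + (b + 1) by rewrite -natr1; ring.
have g0 : 0 < Gamma (m%:R + (b + 1)) by apply/Gamma_gt0/addnb_gt0; rewrite addr_gt0.
by field; rewrite nat1r !pnatr_eq0 -lt0n fact_gt0 !gt_eqF.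
Qed.

(** A constant [K] for which the recursion of the coefficients makes
    [Psi_coef b m] decrease at least as fast as [K ^ m / (2 m)!]: it must satisfy
    [2 (2 m + 1) <= K (m + b)] for all [m]. Comparison with the series of the
    exponential then bounds [Psi b w] by that of [sqrt (K |w|)]. *)
Definition Psi_rate b : R := 4 + 2 / b.

Lemma Psi_rate_gt0 b : 0 < b -> 0 < Psi_rate b.
Proof. by move=> b0; rewrite /Psi_rate addr_gt0// divr_gt0. Qed.

Lemma Psi_coef_le b m : 0 < b ->
  Psi_coef b m <= (Gamma b)^-1 * (Psi_rate b ^+ m / (m.*2)`!%:R).
Proof.
move=> b0; elim: m => [|m IH].
  by rewrite /Psi_coef double0 add0r expr0 fact0 !mul1r invr1 ?mulr1.
have mb := addnb_gt0 m b0.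
have p1 : 0 < (m%:R + b) * m.+1%:R by rewrite mulr_gt0.
rewrite -(ler_pM2l p1) Psi_coefS//; apply: le_trans IH _.
have g0 : 0 < (Gamma b)^-1 by rewrite invr_gt0 Gamma_gt0.
rewrite [leRHS]mulrCA ler_pM2l// doubleS !factS !natrM exprS.
have f0 : 0 < (m.*2)`!%:R :> R by rewrite ltr0n fact_gt0.
rewrite !invfM.
have -> : (m%:R + b) * m.+1%:R * (Psi_rate b * Psi_rate b ^+ m *
    ((m.*2.+2)%:R^-1 * ((m.*2.+1)%:R^-1 * ((m.*2)`!%:R)^-1))) =
    (Psi_rate b ^+ m / (m.*2)`!%:R) *
    ((m%:R + b) * Psi_rate b * (m.+1%:R / (m.*2.+2)%:R) / (m.*2.+1)%:R) :> R.
  by ring.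
rewrite ler_peMr//.
  by rewrite mulr_ge0 ?exprn_ge0 ?invr_ge0 ?ltW// Psi_rate_gt0.
have -> : m.+1%:R / (m.*2.+2)%:R = 2^-1 :> R.
  by rewrite -doubleS -muln2 natrM invfM mulrA mulfV ?mul1r ?pnatr_eq0.
rewrite ler_pdivlMr ?mul1r; last by rewrite ltr0n.
have -> : (m.*2.+1)%:R = 2 * m%:R + 1 :> R.
  by rewrite -natr1 -muln2 natrM mulrC.
rewrite /Psi_rate.
have -> : (m%:R + b) * (4 + 2 / b) * 2^-1 = 2 * m%:R + 2 * b + m%:R / b + 1 :> R.
  by field; rewrite gt_eqF.
have : 0 <= m%:R / b :> R by rewrite divr_ge0// ltW.
by lra.
Qed.

Lemma sum_even_le_expR (v : R) n : 0 <= v ->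
  \sum_(0 <= m < n) v ^+ m.*2 / (m.*2)`!%:R <= expR v.
Proof.
move=> v0.
have pos k : 0 <= v ^+ k / k`!%:R by rewrite divr_ge0 ?exprn_ge0.
apply: (@le_trans _ _ (series (exp_coeff v) n.*2)).
  rewrite /series/= /exp_coeff; elim: n => [|n IH].
    by rewrite !big_geq.
  rewrite doubleS !big_nat_recr//=.
  by apply: ler_wpDr; [exact: pos | rewrite lerD2r].
rewrite /expR; apply: nondecreasing_cvgn_le; last exact: is_cvg_series_exp_coeff.
by apply: nondecreasing_series => k _ _; exact: pos.
Qed.

Lemma Psi_partial_le b w n : 0 < b ->
  \sum_(0 <= m < n) `|Psi_coef b m * w ^+ m| <=
  (Gamma b)^-1 * expR (Num.sqrt (Psi_rate b * `|w|)).
Proof.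
move=> b0; have r0 := Psi_rate_gt0 b0.
have g0 : 0 < (Gamma b)^-1 by rewrite invr_gt0 Gamma_gt0.
set v := Num.sqrt _.
apply: (@le_trans _ _ ((Gamma b)^-1 * \sum_(0 <= m < n) v ^+ m.*2 / (m.*2)`!%:R)).
  rewrite big_distrr/=; apply: ler_sum => m _.
  rewrite normrM normrX (gtr0_norm (Psi_coef_gt0 m b0)).
  apply: le_trans (ler_wpM2r _ (Psi_coef_le m b0)) _; first by rewrite exprn_ge0.
  rewrite le_eqVlt; apply/orP; left; apply/eqP.
  rewrite -mul2n exprM sqr_sqrtr ?mulr_ge0 ?(ltW r0)// exprMn; ring.
by rewrite ler_pM2l// sum_even_le_expR// sqrtr_ge0.
Qed.

Lemma Psi_cvg b w : 0 < b -> cvgn (pseries (Psi_coef b) w).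
Proof.
move=> b0; apply: normed_cvg; apply: nondecreasing_is_cvgn.
  by apply: nondecreasing_series => n _ _; rewrite /= normr_ge0.
exists ((Gamma b)^-1 * expR (Num.sqrt (Psi_rate b * `|w|))) => _ [n _ <-].
exact: Psi_partial_le.
Qed.

Lemma Psi_partial_cvg b w : 0 < b ->
  \sum_(0 <= m < n) Psi_coef b m * w ^+ m @[n --> \oo] --> Psi b w.
Proof. by move=> b0; rewrite Psi.unlock; exact: Psi_cvg. Qed.

Lemma Psi_norm_le b w : 0 < b ->
  `|Psi b w| <= (Gamma b)^-1 * expR (Num.sqrt (Psi_rate b * `|w|)).
Proof.
move=> b0; have c := cvg_norm (@Psi_partial_cvg b w b0).
apply: (cvgr_to_le (c _)).
apply: nearW => n; apply: le_trans (ler_norm_sum _ _ _) _.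
exact: Psi_partial_le.
Qed.

Lemma Psi0 b : 0 < b -> Psi b 0 = (Gamma b)^-1.
Proof.
move=> b0; rewrite Psi.unlock; apply/cvg_lim => //; apply: cvg_near_cst; exists 1%N => //= n n0.
rewrite /pseries /series/= -(prednK n0) big_nat_recl//= big1 ?addr0.
  by rewrite /Psi_coef fact0 mul1r add0r expr0 mulr1.
by move=> i _; rewrite exprS mul0r mulr0.
Qed.

Lemma is_derive_Psi b w : 0 < b -> is_derive w (1 : R) (Psi b) (Psi (b + 1) w).
Proof.
move=> b0; have b1 : 0 < b + 1 by rewrite addr_gt0.
have b2 : 0 < b + 1 + 1 by rewrite addr_gt0.
rewrite Psi.unlock -(Psi_coef_diffs b0).
apply: (@pseries_snd_diffs _ _ (`|w| + 1)).
- exact: Psi_cvg.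
- by rewrite Psi_coef_diffs//; exact: Psi_cvg.
- by rewrite !Psi_coef_diffs//; exact: Psi_cvg.
- by rewrite [ltRHS]ger0_norm ?ltrDl// addr_ge0.
Qed.

Lemma Psi_continuous b : 0 < b -> continuous (Psi b).
Proof. by move=> b0 w; exact: is_derive_continuous (is_derive_Psi w b0). Qed.

(** The differential equation [w f'' + b f' = f] of [f = Psi b], on which the
    eigenvalue equation rests, as differentiation shifts the parameter. *)
Lemma Psi_rec b w : 0 < b -> w * Psi (b + 1 + 1) w + b * Psi (b + 1) w = Psi b w.
Proof.
move=> b0; have b1 : 0 < b + 1 by rewrite addr_gt0.
have b2 : 0 < b + 1 + 1 by rewrite addr_gt0.
have c0 := @Psi_partial_cvg b w b0; have c1 := @Psi_partial_cvg (b + 1) w b1.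
have c2 := @Psi_partial_cvg (b + 1 + 1) w b2.
have c : (w * \sum_(0 <= m < n) Psi_coef (b + 1 + 1) m * w ^+ m +
    b * \sum_(0 <= m < n.+1) Psi_coef (b + 1) m * w ^+ m) @[n --> \oo] -->
    w * Psi (b + 1 + 1) w + b * Psi (b + 1) w.
  apply: cvgD; first exact: cvgMr.
  by apply: cvgMr; move: c1; rewrite -(cvg_shiftn 1); under eq_fun do rewrite addn1.
have {}c0 : \sum_(0 <= m < n.+1) Psi_coef b m * w ^+ m @[n --> \oo] --> Psi b w.
  by move: c0; rewrite -(cvg_shiftn 1); under eq_fun do rewrite addn1.
suff e n : \sum_(0 <= m < n.+1) Psi_coef b m * w ^+ m =
    w * \sum_(0 <= m < n) Psi_coef (b + 1 + 1) m * w ^+ m +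
    b * \sum_(0 <= m < n.+1) Psi_coef (b + 1) m * w ^+ m.
  move: c0; rewrite (funext e) => c0; exact: (cvg_unique _ c c0).
rewrite big_nat_recl// [in RHS]big_nat_recl//= !expr0 !mulr1 mulrDr.
rewrite addrCA !big_distrr/= -big_split/=; congr (_ + _).
  have := Psi_coef_diffs b0 => /(congr1 (fun f => f 0%N)).
  rewrite /pseries_diffs mul1r => h.
  have := Psi_coefS 0 b0; rewrite add0r mulr1 => <-.
  by rewrite h.
apply: eq_bigr => m _.
have e1 := Psi_coef_diffs b0; have e2 := Psi_coef_diffs b1.
have := congr1 (fun f => f m.+1) e1; have := congr1 (fun f => f m) e2.
rewrite /pseries_diffs => <- <-.
rewrite -(Psi_coefS m.+1 b0) exprS -natr1; ring.
Qed.

End bessel_clifford.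

(** * Moments of Gaussians *)

(** The Gaussian of the operator: with [g = nu + 2], its heat kernel at the origin
    is of this form. *)
HB.lock Definition gauss {R : realType} (g s x : R) : R := expR (- (s * `|x| `^ g)).

Lemma gaussE (R : realType) (g s x : R) : gauss g s x = expR (- (s * `|x| `^ g)).
Proof. by rewrite gauss.unlock. Qed.

Section radial_integrals.
Context {R : realType}.
Local Notation mu := (@lebesgue_measure R).
Implicit Types (p s t w x : R) (m n : nat).

Lemma cvg_powRy r : 0 < r -> (t : R) `^ r @[t --> +oo] --> +oo.
Proof.
move=> r0; apply/cvgryPge => A; near=> t.
have tA : (Num.max A 1) `^ (r^-1) <= t.
  by near: t; apply: nbhs_pinfty_ge; exact: num_real.
apply: (@le_trans _ _ (Num.max A 1)); first by rewrite le_max lexx.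
have A0 : 0 <= Num.max A 1 by rewrite le_max ler01 orbT.
rewrite -[leLHS](powRr1 A0) -(mulVf (lt0r_neq0 r0)) powRrM.
apply: ge0_ler_powR; rewrite ?nnegrE ?powR_ge0 ?(ltW r0)//.
Unshelve. all: by end_near. Qed.

Lemma cvg_powRNy r : 0 < r -> (t : R) `^ (- r) @[t --> +oo] --> (0 : R).
Proof.
move=> r0; apply/cvgrVy.
  near=> t; rewrite powR_gt0//; near: t; apply: nbhs_pinfty_gt; exact: num_real.
apply: cvg_trans (cvg_powRy r0); apply: near_eq_cvg; near=> t.
by rewrite /= powRN invrK.
Unshelve. all: by end_near. Qed.

Lemma continuous_powR_norm p : 0 <= p -> continuous (fun x : R => `|x| `^ p).
Proof.
rewrite le_eqVlt => /predU1P[<- x|p0 x].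
  by under eq_fun do rewrite powRr0; exact: cvg_cst.
have [->|x0] := eqVneq x 0; last first.
  apply: (@continuous_comp _ _ _ (fun x : R => `|x|) (fun x => x `^ p)).
    exact: norm_continuous.
  by apply: powR_continuous_at; rewrite normr_gt0.
apply/cvgrPdist_lt => e e0; rewrite normr0 powR0 ?gt_eqF//.
have : \forall x \near (0 : R), `|x| < e `^ p^-1.
  apply/nbhs_ballP; exists (e `^ p^-1); rewrite /= ?powR_gt0//.
  by move=> y; rewrite /ball/= sub0r normrN.
apply: filterS => y ye; rewrite sub0r normrN ger0_norm ?powR_ge0//.
rewrite -[ltRHS](powRr1 (ltW e0)) -(mulVf (lt0r_neq0 p0)) powRrM.
by apply: gt0_ltr_powR; rewrite ?nnegrE ?powR_ge0.
Qed.

Context (g : R) (g_gt1 : 1 < g).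
Let g_gt0 : 0 < g. Proof. exact: lt_trans g_gt1. Qed.

Local Notation gauss := (gauss g).

Lemma gauss_ge0 s x : 0 <= gauss s x.
Proof. by rewrite gaussE expR_ge0. Qed.

Lemma gaussM s t x : gauss s x * gauss t x = gauss (s + t) x.
Proof. by rewrite !gaussE -expRD; congr expR; ring. Qed.

Lemma continuous_gauss s : continuous (gauss s).
Proof.
rewrite gauss.unlock => x; apply: continuous_comp; last exact: continuous_expR.
by apply: cvgN; apply: cvgMr; apply: continuous_powR_norm; rewrite ltW.
Qed.

Lemma continuous_powR_gauss p s : 0 <= p ->
  continuous (fun x => `|x| `^ p * gauss s x).
Proof.
move=> p0 x; apply: cvgM; first exact: continuous_powR_norm.
exact: continuous_gauss.
Qed.

(** The substitution [x = (t / s) ^ (1 / g)] turns the moments of the Gaussian into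
    Gamma integrals. Its derivative blows up at 0, hence the half-lines away from
    the origin, which then fill up the positive one. *)
Section substitution.
Context (p s : R) (p_ge0 : 0 <= p) (s_gt0 : 0 < s).
Let b := (p + 1) / g.
Let c := s `^ (- g^-1).
Let F t := c * t `^ g^-1.
Let G x := `|x| `^ p * gauss s x.
Let F' t := c * (g^-1 * t `^ (g^-1 - 1)).
Let a n : R := n.+1%:R^-1.

Let c_gt0 : 0 < c. Proof. exact: powR_gt0. Qed.
Let gV_gt0 : 0 < g^-1. Proof. by rewrite invr_gt0. Qed.
Let a_gt0 n : 0 < a n. Proof. by rewrite invr_gt0. Qed.

Let dF t : 0 < t -> is_derive t (1 : R) F (F' t).
Proof. by move=> t0; apply: is_derive1Z; exact: is_derive1_powR. Qed.

Let F_ge0 t : 0 <= F t. Proof. by rewrite mulr_ge0 ?powR_ge0 ?ltW. Qed.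

Let F_incr t t' : 0 <= t -> t < t' -> F t < F t'.
Proof.
move=> t0 tt'; rewrite ltr_pM2l//; apply: gt0_ltr_powR => //; rewrite nnegrE//.
exact: le_trans t0 (ltW tt').
Qed.

Let GF t : 0 < t -> (G \o F) t * F' t = g^-1 * s `^ (- b) * gamma_integrand b t.
Proof.
move=> t0; rewrite /G/= ger0_norm//.
have F_pow r : F t `^ r = c `^ r * t `^ (g^-1 * r).
  by rewrite powRM ?powR_ge0 ?(ltW c_gt0)// powRrM.
rewrite gaussE ger0_norm// !F_pow mulVf ?gt_eqF// powRr1 ?(ltW t0)//.
have -> : c `^ g = s^-1.
  by rewrite -powRrM mulNr mulVf ?gt_eqF// powR_inv1// ltW.
rewrite mulVKf ?gt_eqF// /F' /gamma_integrand.
have -> : s `^ (- b) = c `^ p * c.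
  rewrite -[X in _ * X](powRr1 (ltW c_gt0)) -powRD; last by rewrite (gt_eqF c_gt0) implybT.
  by rewrite -powRrM; congr (_ `^ _); rewrite /b mulNr mulrC.
have -> : t `^ (b - 1) = t `^ (g^-1 * p) * t `^ (g^-1 - 1).
  rewrite -powRD; last by rewrite (gt_eqF t0) implybT.
  by congr (_ `^ _); rewrite /b; ring.
ring.
Qed.

Let subst_n n : (\int[mu]_(x in `[F (a n), +oo[%classic) (G x)%:E =
  (g^-1 * s `^ (- b))%:E *
  \int[mu]_(t in `[a n, +oo[%classic) (gamma_integrand b t)%:E)%E.
Proof.
have a0 := a_gt0 n.
have pos x : x \in `]a n, +oo[ -> 0 < x.
  by rewrite in_itv/= andbT; exact: lt_trans.
have dFE x : 0 < x -> F^`()%classic x = F' x.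
  by move=> x0; rewrite derive1E; have [_ ->] := dF x0.
have cG : continuous G by exact: continuous_powR_gauss.
have cF' x : 0 < x -> F' y @[y --> x] --> F' x.
  by move=> x0; apply: cvgMr; apply: cvgMr; exact: powR_continuous_at.
rewrite (@increasing_ge0_integration_by_substitutiony R F G (a n)).
- rewrite -ge0_integralZl//; first last.
  + by rewrite lee_fin mulr_ge0 ?powR_ge0 ?ltW.
  + by move=> t _; rewrite lee_fin gamma_integrand_ge0.
  + by apply: measurable_EFinS; exact: measurable_gamma_integrand.
  apply: eq_integral => t /set_mem/=; rewrite in_itv/= andbT => ta.
  have t0 : 0 < t by exact: lt_le_trans ta.
  by rewrite -EFinM; congr EFin; rewrite -GF//= /GRing.mul/= dFE.
- move=> x y; rewrite !in_itv/= !andbT => ax ay xy; apply: F_incr => //.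
  exact: le_trans (ltW a0) ax.
- move=> x /pos x0; rewrite /continuous_at dFE//.
  apply: (@cvg_trans _ (F' y @[y --> x])).
    apply: near_eq_cvg; rewrite near_simpl; near=> y; rewrite dFE//.
    by near: y; exact: lt_nbhsr.
  exact: cF'.
- apply/cvg_ex; exists (F' (a n)).
  apply: (@cvg_trans _ (F' y @[y --> (a n)^'+])).
    apply: near_eq_cvg; near=> y; rewrite dFE//.
    by apply: lt_trans a0 _; near: y; exact: nbhs_right_gt.
  apply: cvg_at_right_filter.
  exact: cF'.
- apply/cvg_ex; exists (c * (g^-1 * 0)).
  apply: (@cvg_trans _ (F' y @[y --> +oo])).
    apply: near_eq_cvg; apply: filterS (nbhs_pinfty_gt (num_real (0 : R))) => y y0.
    by rewrite dFE.
  rewrite /F'; apply: cvgMr; apply: cvgMr; rewrite -(opprB 1); apply: cvg_powRNy.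
  by rewrite subr_gt0 invf_lt1.
- split; first by move=> x /pos x0; apply: ex_derive; exact: dF.
  by apply: cvg_at_right_filter; exact: is_derive_continuous (dF _).
- by apply: gt0_cvgMry => //; exact: cvg_powRy.
- exact: continuous_subspaceT.
- by move=> x _; rewrite mulr_ge0 ?powR_ge0 ?gauss_ge0.
Unshelve. all: by end_near. Qed.

Let exhaust (u : nat -> R) (f : R -> R) : (forall n, 0 < u n) ->
  {homo u : m n / (m <= n)%N >-> n <= m} -> u n @[n --> \oo] --> (0 : R) ->
  measurable_fun setT f -> (forall x, 0 <= f x) ->
  (\int[mu]_(x in `[u n, +oo[%classic) (f x)%:E @[n --> \oo] -->
   \int[mu]_(x in `]0%R, +oo[%classic) (f x)%:E)%E.
Proof.
move=> u0 ndu cu mf f0.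
have -> : `]0%R, +oo[%classic = \bigcup_n `[u n, +oo[%classic.
  apply/seteqP; split => [x|x [n _]]/=; rewrite !in_itv/= !andbT.
    move=> x0; have /cvgrPdist_lt/(_ x x0)[N _ /(_ N (leqnn N))/=] := cu.
    rewrite sub0r normrN gtr0_norm// => uN.
    by exists N => //=; rewrite in_itv/= andbT ltW.
  exact: lt_le_trans.
apply: ge0_nondecreasing_set_cvg_integral => //.
- move=> m n mn; apply/subsetPset => x; rewrite /= !in_itv/= !andbT.
  by move=> h; apply: le_trans h; exact: ndu.
- by move=> n; exact: measurable_EFinS.
- by move=> n x _; rewrite lee_fin.
Qed.

Lemma integral0y_powR_gauss :
  (\int[mu]_(x in `]0%R, +oo[%classic) (`|x| `^ p * gauss s x)%:E =
  (g^-1 * s `^ (- b) * Gamma b)%:E)%E.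
Proof.
have b0 : 0 < b by rewrite divr_gt0// ltr_wpDl.
have ca : a n @[n --> \oo] --> (0 : R) by exact: cvg_harmonic.
have nda : {homo a : m n / (m <= n)%N >-> n <= m}.
  by move=> m n mn; rewrite lef_pV2 ?posrE// ler_nat.
have cFa : F (a n) @[n --> \oo] --> (0 : R).
  rewrite -(mulr0 c); apply: cvgMr.
  have -> : (fun n => a n `^ g^-1) = (fun n => `|a n| `^ g^-1).
    by apply/funext => n; rewrite gtr0_norm.
  have h : `|x| `^ g^-1 @[x --> (0 : R)] --> `|0 : R| `^ g^-1.
    exact: (continuous_powR_norm (ltW gV_gt0)).
  move: h; rewrite normr0 powR0 ?gt_eqF// => h.
  exact: (cvg_comp _ _ ca h).
have F0 n : 0 < F (a n) by rewrite mulr_gt0 ?powR_gt0.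
have ndF : {homo (fun n => F (a n)) : m n / (m <= n)%N >-> n <= m}.
  move=> m n /nda; rewrite le_eqVlt => /predU1P[->//|h].
  by apply/ltW/F_incr => //; rewrite ltW.
have mG : measurable_fun setT G.
  by apply: continuous_measurable_fun; exact: continuous_powR_gauss.
have G0 x : 0 <= G x by rewrite mulr_ge0 ?powR_ge0 ?gauss_ge0.
have c1 := exhaust F0 ndF cFa mG G0.
have c2 := exhaust a_gt0 nda ca (@measurable_gamma_integrand _ b setT)
  (gamma_integrand_ge0 b).
have c3 := cvgeZl (isT : (g^-1 * s `^ (- b))%:E \is a fin_num) c2.
rewrite EFinM (EFin_Gamma b0); apply: (cvg_unique _ c1) => //.
by rewrite (funext subst_n).
Qed.

Lemma integral_powR_gauss :
  (\int[mu]_x (`|x| `^ p * gauss s x)%:E = (2 / g * s `^ (- b) * Gamma b)%:E)%E.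
Proof.
have cG : continuous G by exact: continuous_powR_gauss.
rewrite (@ge0_symfun_integralT _ G)//.
- have mG : measurable_fun setT G by exact: continuous_measurable_fun.
  rewrite (_ : [set x | 0 <= x] = `[0, +oo[%classic); last first.
    by apply/seteqP; split => x /=; rewrite in_itv/= andbT.
  rewrite -integral_itv_obnd_cbnd; last exact: measurable_EFinS.
  by rewrite integral0y_powR_gauss -EFinM; congr EFin; ring.
- by move=> x; rewrite mulr_ge0 ?powR_ge0 ?gauss_ge0.
- by move=> x; rewrite /G/= !gaussE normrN.
Qed.

Lemma summable_powR_gauss : summable (fun x => `|x| `^ p * gauss s x).
Proof.
apply: summable_ge0.
- by apply: continuous_measurable_fun; exact: continuous_powR_gauss.
- by move=> x; rewrite mulr_ge0 ?powR_ge0 ?gauss_ge0.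
- by rewrite integral_powR_gauss ltry.
Qed.

Lemma Rint_powR_gauss :
  \int[mu]_x (`|x| `^ p * gauss s x) = 2 / g * s `^ (- b) * Gamma b.
Proof. by rewrite /Rintegral integral_powR_gauss. Qed.

End substitution.

(** Termwise integration of the power series; the Gamma factors produced by
    the moments cancel those of the coefficients, leaving an exponential. For the
    exchange the terms are first made nonnegative, replacing [w] by its norm. *)
Section Psi_integral.
Context (p : R) (p_ge0 : 0 <= p).
Let b := (p + 1) / g.
Let b_gt0 : 0 < b. Proof. by rewrite divr_gt0// ltr_wpDl. Qed.

Let partial w s n x := `|x| `^ p *
  (\sum_(0 <= m < n) Psi_coef b m * (w * `|x| `^ g) ^+ m) * gauss s x.

Let partial_term w s m x :
  `|x| `^ p * (Psi_coef b m * (w * `|x| `^ g) ^+ m) * gauss s x =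
  Psi_coef b m * w ^+ m * (`|x| `^ (p + g * m%:R) * gauss s x).
Proof.
have -> : `|x| `^ (p + g * m%:R) = `|x| `^ p * (`|x| `^ g) ^+ m.
  case: m => [|m]; first by rewrite mulr0 addr0 expr0 mulr1.
  rewrite powRD ?powRrM ?powR_mulrn ?powR_ge0//.
  by rewrite gt_eqF// ltr_wpDl// mulr_gt0.
by rewrite exprMn; ring.
Qed.

Let partial_int w s n : 0 < s -> summable (partial w s n) /\
  \int[mu]_x partial w s n x = 2 / g * s `^ (- b) * series (exp_coeff (w / s)) n.
Proof.
move=> s0; elim: n => [|n [IHs IHi]].
  have -> : partial w s 0 = (fun x => 0 * (`|x| `^ p * gauss s x)).
    by apply/funext => x; rewrite /partial big_geq// !(mulr0, mul0r).
  split; first by apply: summableZ; exact: summable_powR_gauss.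
  rewrite RintZ ?mul0r; last exact: summable_powR_gauss.
  by rewrite /series/= big_geq// mulr0.
have pn : 0 <= p + g * n%:R by rewrite addr_ge0// mulr_ge0// ltW.
have sn := summable_powR_gauss pn s0.
have -> : partial w s n.+1 = (fun x => partial w s n x +
    Psi_coef b n * w ^+ n * (`|x| `^ (p + g * n%:R) * gauss s x)).
  apply/funext => x; rewrite /partial big_nat_recr//= mulrDr mulrDl; congr (_ + _).
  exact: partial_term.
split; first by apply: summableD => //; exact: summableZ.
rewrite RintD//; last exact: summableZ.
rewrite IHi RintZ// Rint_powR_gauss// /series/= big_nat_recr//= mulrDr; congr (_ + _).
have -> : (p + g * n%:R + 1) / g = n%:R + b.
  by rewrite /b; field; rewrite gt_eqF.
rewrite opprD powRD; last by rewrite (gt_eqF s0) implybT.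
rewrite (powRN s n%:R) powR_mulrn ?(ltW s0)// /exp_coeff /Psi_coef/= exprMn exprVn.
have g0 : 0 < Gamma (n%:R + b) by apply/Gamma_gt0/addnb_gt0.
by field; rewrite !gt_eqF ?exprn_gt0 ?ltr0n ?fact_gt0.
Qed.

Lemma Psi_gauss_integral w s : 0 < s ->
  summable (fun x => `|x| `^ p * Psi b (w * `|x| `^ g) * gauss s x) /\
  \int[mu]_x (`|x| `^ p * Psi b (w * `|x| `^ g) * gauss s x) =
  2 / g * s `^ (- b) * expR (w / s).
Proof.
move=> s0.
have mpart v n : measurable_fun setT (partial v s n).
  by apply: summable_measurable; have [] := partial_int v n s0.
have cpart v x : partial v s n x @[n --> \oo] -->
    `|x| `^ p * Psi b (v * `|x| `^ g) * gauss s x.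
  by apply: cvgMl; apply: cvgMr; exact: Psi_partial_cvg.
have pos_dom x n : `|partial w s n x| <= `|x| `^ p * Psi b (`|w| * `|x| `^ g) * gauss s x.
  rewrite !normrM (ger0_norm (powR_ge0 _ _)) (ger0_norm (gauss_ge0 _ _)).
  rewrite ler_wpM2r ?gauss_ge0// ler_wpM2l ?powR_ge0//.
  apply: le_trans (ler_norm_sum _ _ _) _.
  apply: (@le_trans _ _ (\sum_(0 <= m < n) Psi_coef b m * (`|w| * `|x| `^ g) ^+ m)).
    apply: ler_sum => m _; rewrite normrM normrX normrM (ger0_norm (powR_ge0 _ _)).
    by rewrite (gtr0_norm (Psi_coef_gt0 m b_gt0)).
  rewrite Psi.unlock; apply: (nondecreasing_cvgn_le _ _ n); last exact: Psi_cvg.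
  apply: nondecreasing_series => m _ _.
  by rewrite mulr_ge0 ?exprn_ge0 ?mulr_ge0 ?powR_ge0// ltW// Psi_coef_gt0.
have sdom : summable (fun x => `|x| `^ p * Psi b (`|w| * `|x| `^ g) * gauss s x).
  apply: summable_ge0.
  - by apply: (measurable_fun_cvg (mpart `|w|)) => x _; exact: cpart.
  - by move=> x; apply: le_trans (pos_dom x 0%N).
  apply: (@le_lt_trans _ _ (2 / g * s `^ (- b) * expR (`|w| / s))%:E); last exact: ltry.
  apply: (fatou_le (mpart `|w|)); last first.
    apply: nearW => n; rewrite -EFin_Rint; last by have [] := partial_int `|w| n s0.
    have [_ ->] := partial_int `|w| n s0.
    rewrite lee_fin ler_wpM2l ?mulr_ge0 ?powR_ge0 ?invr_ge0 ?(ltW g_gt0)//.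
    apply: (nondecreasing_cvgn_le _ _ n); last exact: is_cvg_series_exp_coeff.
    apply: nondecreasing_series => m _ _.
    by rewrite /exp_coeff/= divr_ge0 ?exprn_ge0 ?divr_ge0 ?(ltW s0).
  - by move=> x; exact: cpart.
  - move=> n x; rewrite /partial mulr_ge0 ?gauss_ge0// mulr_ge0 ?powR_ge0//.
    apply: sumr_ge0 => m _.
    by rewrite mulr_ge0 ?exprn_ge0 ?mulr_ge0 ?powR_ge0// ltW// Psi_coef_gt0.
have [sf cf] := Rint_dominated_cvg (mpart w) sdom (fun n x => pos_dom x n)
  (cpart w).
split => //; apply: (cvg_unique _ cf) => //.
have -> : (fun n => \int[mu]_x partial w s n x) =
    (fun n => 2 / g * s `^ (- b) * series (exp_coeff (w / s)) n).
  by apply/funext => n; have [] := partial_int w n s0.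
by apply: cvgMr; exact: is_cvg_series_exp_coeff.
Qed.

End Psi_integral.

End radial_integrals.

(** * The kernel and its action on Gaussians *)
Section bessel_closed_forms.
Context {R : realType}.
Implicit Types al z : R.

Let powR_split al z m : 0 < z -> z `^ (2 * m%:R + al) = z `^ al * (z ^+ 2) ^+ m.
Proof.
move=> z0; rewrite powRD; last by rewrite (gt_eqF z0) implybT.
by rewrite powRrM (powR_mulrn 2 (ltW z0)) powR_mulrn ?exprn_ge0 ?ltW// mulrC.
Qed.

Lemma besselJ_Psi al z : -1 < al -> 0 < z ->
  besselJ al z = (z / 2) `^ al * Psi (al + 1) (- (z / 2) ^+ 2).
Proof.
move=> al1 z0; have a1 : 0 < al + 1 by lra.
have z2 : 0 < z / 2 by rewrite divr_gt0.
apply/cvg_lim => //; rewrite (_ : series _ = (fun n => (z / 2) `^ al *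
  \sum_(0 <= m < n) Psi_coef (al + 1) m * (- (z / 2) ^+ 2) ^+ m)).
  by apply: cvgMr; exact: Psi_partial_cvg.
apply/funext => n; rewrite /series/= big_distrr/=; apply: eq_bigr => m _.
rewrite /Psi_coef powR_split// (exprNn (_ ^+ 2)) (addrA m%:R).
set G := Gamma _; set w := (_ ^+ 2) ^+ m; set v := _ `^ al; set u := (-1) ^+ m.
by set f := (_ * G)^-1; ring.
Qed.

Lemma besselI_Psi al z : -1 < al -> 0 < z ->
  besselI al z = (z / 2) `^ al * Psi (al + 1) ((z / 2) ^+ 2).
Proof.
move=> al1 z0; have a1 : 0 < al + 1 by lra.
have z2 : 0 < z / 2 by rewrite divr_gt0.
apply/cvg_lim => //; rewrite (_ : series _ = (fun n => (z / 2) `^ al *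
  \sum_(0 <= m < n) Psi_coef (al + 1) m * ((z / 2) ^+ 2) ^+ m)).
  by apply: cvgMr; exact: Psi_partial_cvg.
apply/funext => n; rewrite /series/= big_distrr/=; apply: eq_bigr => m _.
rewrite /Psi_coef powR_split// (addrA m%:R).
set G := Gamma _; set w := (_ ^+ 2) ^+ m; set v := _ `^ al.
by set f := (_ * G)^-1; ring.
Qed.

End bessel_closed_forms.

Lemma realC_mul (R : realType) (r a b : R) :
  r%:C * (a +i* b) = (r * a) +i* (r * b).
Proof. by apply/eqP; rewrite eq_complex/= !mul0r subr0 addr0 !eqxx. Qed.

Section kernel.
Context {R : realType} (nu : R) (nu_gt0 : 0 < nu).
Local Notation mu := (@lebesgue_measure R).
Local Notation g := (nu + 2).
Local Notation beta := (g^-1).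
Local Notation beta' := (2 - g^-1).
Local Notation al := ((nu + 1) / (nu + 2)).
Local Notation k0 := ((g ^+ 2)^-1).
Local Notation gauss := (gauss g).
Implicit Types q s t x : R.

Let g_gt0 : 0 < g. Proof. by rewrite addr_gt0. Qed.
Let g_gt1 : 1 < g. Proof. by rewrite (@lt_trans _ _ 2) ?ltr1n// ltrDr. Qed.
Let g_neq0 : g != 0. Proof. by rewrite gt_eqF. Qed.

Lemma beta_gt0 : 0 < beta. Proof. by rewrite invr_gt0. Qed.

Lemma beta'_gt0 : 0 < beta'.
Proof. by rewrite subr_gt0 (@lt_trans _ _ 1)//; [rewrite invf_lt1 | lra]. Qed.

Lemma alE : al = 1 - beta. Proof. by field. Qed.

Lemma k0_gt0 : 0 < k0. Proof. by rewrite invr_gt0 exprn_gt0. Qed.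

Lemma k0_powR r : k0 `^ r = g `^ (- (2 * r)).
Proof.
rewrite -(powR_mulrn 2 (ltW g_gt0)) -powRN -powRrM; congr (_ `^ _); ring.
Qed.

(** The odd power of exponent [nu + 1], a second solution of the homogeneous
    equation beside the constants. *)
Definition theta x : R := x * `|x| `^ nu.

(** The parameters are tied by [(nu + 1) / (nu + 2) = 1 - beta] and
    [beta' = 2 - beta], so that [Psi beta] and [Psi beta'] belong to the Bessel
    functions of the two opposite orders. *)
Definition odd_coef : R := Gamma beta * g `^ (- (2 * al)).

Definition cos_part x : R := Gamma beta * Psi beta (- (k0 * `|x| `^ g)).
Definition sin_part x : R :=
  odd_coef * theta x * Psi beta' (- (k0 * `|x| `^ g)).

Lemma thetaN x : theta (- x) = - theta x.
Proof. by rewrite /theta normrN mulNr. Qed.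

Lemma thetaM x y : theta (x * y) = theta x * theta y.
Proof. by rewrite /theta normrM powRM//; ring. Qed.

Lemma norm_theta x : `|theta x| = `|x| `^ (nu + 1).
Proof.
rewrite normrM (ger0_norm (powR_ge0 _ _)) addrC powRD ?powRr1//.
by rewrite gt_eqF// addr_gt0.
Qed.

Lemma theta_sqr x : theta x * theta x = `|x| `^ (2 * nu + 2).
Proof.
rewrite -[LHS]ger0_norm; last by rewrite -expr2 sqr_ge0.
rewrite normrM norm_theta.
rewrite -powRD; first by congr (_ `^ _); ring.
by have n0 := nu_gt0; rewrite gt_eqF//; lra.
Qed.

Lemma sgr_theta x : theta x = Num.sg x * `|x| `^ (nu + 1).
Proof. by rewrite -norm_theta normrM (ger0_norm (powR_ge0 _ _)) mulrA -numEsg. Qed.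

Lemma normM_powR x y p : `|x * y| `^ p = `|x| `^ p * `|y| `^ p.
Proof. by rewrite normrM powRM. Qed.

Lemma cos_partN x : cos_part (- x) = cos_part x.
Proof. by rewrite /cos_part normrN. Qed.

Lemma sin_partN x : sin_part (- x) = - sin_part x.
Proof. by rewrite /sin_part normrN thetaN; ring. Qed.

(** In the power series of the Bessel functions the powers of [x] cancel the factor
    [|x| ^ ((nu + 1) / 2)], up to [theta x] for the odd part. *)
Lemma eeE x : ee nu x = cos_part x +i* sin_part x.
Proof.
have n0 := nu_gt0; have b0 := beta_gt0; have gb0 := Gamma_gt0 b0.
rewrite /ee; case: ifPn => [/eqP ->|x0].
  rewrite /cos_part /sin_part /theta normr0 powR0// mulr0 oppr0 Psi0//.
  by rewrite divff ?gt_eqF// mul0r mulr0 mul0r.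
have nx0 : 0 < `|x| by rewrite normr_gt0.
set z := `|x| `^ (nu / 2 + 1) / (nu / 2 + 1).
have h0 : 0 < nu / 2 + 1 by lra.
have z0 : 0 < z by rewrite divr_gt0// powR_gt0.
have z2E : z / 2 = `|x| `^ (g / 2) * g^-1.
  rewrite /z; have -> : nu / 2 + 1 = g / 2 by field.
  by field.
have sqE : (z / 2) ^+ 2 = k0 * `|x| `^ g.
  rewrite z2E exprMn -(powR_mulrn 2 (powR_ge0 _ _)) -powRrM exprVn mulrC.
  by congr (_ * _ `^ _); field.
have al1 : al < 1 by rewrite alE; lra.
have alp : 0 < al by rewrite divr_gt0//; lra.
rewrite besselJ_Psi//; last by lra.
rewrite besselJ_Psi//; last by lra.
have -> : - al + 1 = beta by rewrite alE; ring.
have -> : al + 1 = beta' by rewrite alE; ring.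
rewrite sqE.
have powz r : (z / 2) `^ r = `|x| `^ (g / 2 * r) * g `^ (- r).
  rewrite z2E powRM ?powR_ge0 ?invr_ge0 ?(ltW g_gt0)// -powRrM; congr (_ * _).
  by rewrite -(powR_inv1 (ltW g_gt0)) -powRrM mulN1r.
rewrite !powz mulrN opprK.
have e1 : `|x| `^ (- (g / 2 * al)) * `|x| `^ ((nu + 1) / 2) = 1.
  rewrite -powRD; last by rewrite (gt_eqF nx0) implybT.
  by rewrite (_ : _ + _ = 0) ?powRr0//; field.
have e2 : `|x| `^ (g / 2 * al) * `|x| `^ ((nu + 1) / 2) = `|x| `^ (nu + 1).
  rewrite -powRD; last by rewrite (gt_eqF nx0) implybT.
  by congr (_ `^ _); field.
have e3 : g `^ (- al) * g `^ al = 1.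
  rewrite -powRD; last by rewrite (gt_eqF g_gt0) implybT.
  by rewrite addNr powRr0.
have e4 : g `^ (- al) * g `^ (- al) = g `^ (- (2 * al)).
  rewrite -powRD; last by rewrite (gt_eqF g_gt0) implybT.
  by congr (_ `^ _); ring.
rewrite /u_coef /cos_part /sin_part /odd_coef sgr_theta -e4 -e2 div1r.
rewrite realC_mul; congr (_ +i* _).
  transitivity (Gamma beta * (g `^ (- al) * g `^ al) *
    (`|x| `^ (- (g / 2 * al)) * `|x| `^ ((nu + 1) / 2)) * Psi beta (- (k0 * `|x| `^ g))).
    by move: (Gamma _) (Psi _ _) (_ `^ _) (_ `^ _) (_ `^ _) (_ `^ _) => *; ring.
  by rewrite e1 e3 !mulr1.
by move: (Gamma _) (Psi _ _) (_ `^ _) (_ `^ _) (_ `^ _) (Num.sg _) => *; ring.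
Qed.

Lemma continuous_theta : continuous theta.
Proof.
by move=> x; apply: cvgM; [exact: cvg_id | exact: (continuous_powR_norm (ltW nu_gt0))].
Qed.

Lemma continuous_Psi_radial b w : 0 < b -> continuous (fun x => Psi b (w * `|x| `^ g)).
Proof.
move=> b0 x; apply: (@continuous_comp _ _ _ (fun x => w * `|x| `^ g) (Psi b)).
  by apply: cvgMr; exact: (continuous_powR_norm (ltW g_gt0)).
exact: Psi_continuous.
Qed.

Let Psi_argE b : (fun x => Psi b (- (k0 * `|x| `^ g))) = (fun x => Psi b (- k0 * `|x| `^ g)).
Proof. by apply/funext => x; rewrite mulNr. Qed.

Lemma continuous_cos_part : continuous cos_part.
Proof.
rewrite /cos_part => x; apply: cvgMr.
by have := continuous_Psi_radial (w := - k0) beta_gt0; rewrite -Psi_argE; exact.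
Qed.

Lemma continuous_sin_part : continuous sin_part.
Proof.
move=> x; apply: cvgM; last first.
  by have := continuous_Psi_radial (w := - k0) beta'_gt0; rewrite -Psi_argE; exact.
by apply: cvgMr; exact: continuous_theta.
Qed.

(** The order of growth of the kernel is half that of the Gaussians, which
    dominate it whatever the dilation. *)
Definition half_order (f : R -> R) := exists M c,
  [/\ 0 <= M, 0 < c & forall x, `|f x| <= M * expR (c * `|x| `^ (g / 2))].

Lemma half_orderD f h : half_order f -> half_order h ->
  half_order (fun x => f x + h x).
Proof.
move=> [M [c [M0 c0 Hf]]] [M' [c' [M'0 c'0 Hh]]]; exists (M + M'), (c + c').
split; [exact: addr_ge0 | exact: addr_gt0|] => x.
apply: le_trans (ler_normD _ _) _; rewrite mulrDl; apply: lerD.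
  apply: le_trans (Hf x) _; apply: ler_wpM2l => //; rewrite ler_expR.
  by rewrite ler_wpM2r ?powR_ge0// lerDl ltW.
apply: le_trans (Hh x) _; apply: ler_wpM2l => //; rewrite ler_expR.
by rewrite ler_wpM2r ?powR_ge0// lerDr ltW.
Qed.

Lemma half_orderM f h : half_order f -> half_order h ->
  half_order (fun x => f x * h x).
Proof.
move=> [M [c [M0 c0 Hf]]] [M' [c' [M'0 c'0 Hh]]]; exists (M * M'), (c + c').
split; [exact: mulr_ge0 | exact: addr_gt0|] => x.
by rewrite normrM mulrDl expRD mulrACA ler_pM.
Qed.

Lemma half_order_cst a : half_order (fun=> a).
Proof.
exists `|a|, 1; split => // x; rewrite ler_peMr// mul1r.
by rewrite -[leLHS]expR0 ler_expR powR_ge0.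
Qed.

Lemma half_order_theta : half_order theta.
Proof.
have n0 := nu_gt0; exists 2, 1; split => // x; rewrite norm_theta mul1r.
set v := `|x| `^ (g / 2).
have v0 : 0 <= v by rewrite powR_ge0.
have vE : v ^+ 2 = `|x| `^ g.
  by rewrite -(powR_mulrn 2 v0) -powRrM; congr (_ `^ _); field.
have h : `|x| `^ (nu + 1) <= 1 + `|x| `^ g.
  have [x1|x1] := leP `|x| 1.
    apply: (@le_trans _ _ (1 `^ (nu + 1))); last by rewrite powR1 lerDl powR_ge0.
    by rewrite ge0_ler_powR// ?nnegrE//; lra.
  apply: (@le_trans _ _ (`|x| `^ g)); last by rewrite lerDr.
  by rewrite ler_powR ?(ltW x1)// lerD2l; lra.
have h2 : 1 + `|x| `^ g / 2 <= expR v by rewrite -vE; exact: (expR_ge1Dxn 1 v0).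
by lra.
Qed.

Lemma half_order_Psi b w : 0 < b -> half_order (fun x => Psi b (w * `|x| `^ g)).
Proof.
move=> b0; pose a := Num.sqrt (Psi_rate b * `|w|).
have r0 := Psi_rate_gt0 b0.
exists (Gamma b)^-1, (a + 1); split.
- by rewrite invr_ge0 ltW// Gamma_gt0.
- by rewrite ltr_wpDl// sqrtr_ge0.
move=> x; apply: le_trans (Psi_norm_le _ b0) _; apply: ler_wpM2l.
  by rewrite invr_ge0 ltW// Gamma_gt0.
rewrite ler_expR normrM (ger0_norm (powR_ge0 _ _)) mulrA sqrtrM; last first.
  by rewrite mulr_ge0// ltW.
have -> : Num.sqrt (`|x| `^ g) = `|x| `^ (g / 2).
  by rewrite -powR12_sqrt ?powR_ge0// -powRrM.
by rewrite ler_wpM2r ?powR_ge0// lerDl.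
Qed.

Lemma half_order_cos_part : half_order cos_part.
Proof.
apply: half_orderM; first exact: half_order_cst.
by rewrite Psi_argE; apply: half_order_Psi; exact: beta_gt0.
Qed.

Lemma half_order_sin_part : half_order sin_part.
Proof.
apply: half_orderM; last by rewrite Psi_argE; apply: half_order_Psi; exact: beta'_gt0.
by apply: half_orderM; [exact: half_order_cst | exact: half_order_theta].
Qed.

(** By the arithmetic-geometric inequality, as [|q x| ^ (g / 2)] is a product. The
    exponents [A] and [B] can be traded against each other, making either of the
    two growths as slow as needed. *)
Lemma half_order_dilate f : half_order f -> exists M kap, [/\ 0 <= M, 0 < kap &
  forall A B, 0 < A -> 0 < B -> kap <= A * B -> forall q x,
  `|f (q * x)| <= M * (gauss (- A) q * gauss (- B) x)].
Proof.
move=> [M [c [M0 c0 Hf]]]; exists M, (c ^+ 2); split => //; first exact: exprn_gt0.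
move=> A B A0 B0 AB q x; apply: le_trans (Hf _) _; apply: ler_wpM2l => //.
rewrite !gaussE -expRD ler_expR !mulNr !opprK normM_powR.
set v := `|q| `^ (g / 2); set w := `|x| `^ (g / 2).
have v0 : 0 <= v by exact: powR_ge0.
have w0 : 0 <= w by exact: powR_ge0.
have sq y : `|y| `^ g = (`|y| `^ (g / 2)) ^+ 2 :> R.
  by rewrite -(powR_mulrn 2 (powR_ge0 _ _)) -powRrM; congr (_ `^ _); field.
rewrite !sq -/v -/w.
have rhs0 : 0 <= A * v ^+ 2 + B * w ^+ 2.
  by rewrite addr_ge0// mulr_ge0 ?sqr_ge0// ltW.
rewrite -ler_sqr ?nnegrE ?mulr_ge0 ?(ltW c0)//.
have h1 : (c * (v * w)) ^+ 2 <= A * B * (v * w) ^+ 2.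
  by rewrite exprMn ler_wpM2r ?sqr_ge0.
apply: le_trans h1 _; rewrite -subr_ge0.
have -> : (A * v ^+ 2 + B * w ^+ 2) ^+ 2 - A * B * (v * w) ^+ 2 =
    (A * v ^+ 2) ^+ 2 + (B * w ^+ 2) ^+ 2 + A * B * (v * w) ^+ 2 by ring.
by rewrite !addr_ge0 ?sqr_ge0 ?mulr_ge0 ?sqr_ge0 ?(ltW A0) ?(ltW B0).
Qed.

Lemma gauss0 x : gauss 0 x = 1.
Proof. by rewrite gaussE mul0r oppr0 expR0. Qed.

Lemma gaussN s x : gauss s (- x) = gauss s x.
Proof. by rewrite !gaussE normrN. Qed.

Lemma measurable_gauss s : measurable_fun setT (gauss s).
Proof. by apply: continuous_measurable_fun; exact: (continuous_gauss g_gt1). Qed.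

Lemma summable_gauss s : 0 < s -> summable (gauss s).
Proof.
move=> s0; have := summable_powR_gauss g_gt1 (lexx 0) s0.
by congr summable; apply/funext => x; rewrite powRr0 mul1r.
Qed.

Lemma half_order_gauss f : half_order f -> continuous f -> forall q s, 0 < s ->
  summable (fun x => f (q * x) * gauss s x).
Proof.
move=> hof cf q s s0; have [M [kap [M0 k00 H]]] := half_order_dilate hof.
have s2 : 0 < s / 2 by rewrite divr_gt0.
have A0 : 0 < kap / (s / 2) by rewrite divr_gt0.
have AB : kap <= kap / (s / 2) * (s / 2) by rewrite divfK ?gt_eqF.
have := summableZ (M * gauss (- (kap / (s / 2))) q) (summable_gauss s2).
apply: le_summable.
  apply: measurable_funM; last exact: measurable_gauss.
  apply: continuous_measurable_fun => x; apply: continuous_comp; last exact: cf.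
  by apply: cvgMr; exact: cvg_id.
move=> x; rewrite normrM [X in _ * X]ger0_norm ?gauss_ge0//.
apply: le_trans (ler_wpM2r (gauss_ge0 _ _ _) (H _ _ A0 s2 AB q x)) _.
have e : gauss (- (s / 2)) x * gauss s x = gauss (s / 2) x.
  by rewrite gaussM (_ : - (s / 2) + s = s / 2)//; field.
by rewrite -!mulrA e lexx.
Qed.

(** The factors by which the transform multiplies the two families of Gaussians,
    up to the change of width. *)
Definition eigen_even : R := 2 / g * Gamma beta.
Definition eigen_odd : R := 2 / g * odd_coef.

Lemma Rint_gauss s : 0 < s -> \int[mu]_x gauss s x = 2 / g * s `^ (- beta) * Gamma beta.
Proof.
move=> s0; have := Rint_powR_gauss g_gt1 (lexx 0) s0.
rewrite add0r div1r => <-; apply: eq_Rint => x; by rewrite powRr0 mul1r.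
Qed.

Lemma beta'E : (2 * nu + 2 + 1) / g = beta'.
Proof. by field. Qed.

Lemma Rint_theta2_gauss s : 0 < s -> summable (fun x => theta x * theta x * gauss s x) /\
  \int[mu]_x (theta x * theta x * gauss s x) = 2 / g * s `^ (- beta') * Gamma beta'.
Proof.
move=> s0; have p0 : 0 <= 2 * nu + 2 by rewrite addr_ge0// mulr_ge0// ltW.
have := Rint_powR_gauss g_gt1 p0 s0; have := summable_powR_gauss g_gt1 p0 s0.
have -> : (fun x => theta x * theta x * gauss s x) =
    (fun x => `|x| `^ (2 * nu + 2) * gauss s x).
  by apply/funext => x; rewrite theta_sqr.
by rewrite beta'E.
Qed.

Lemma Rint_theta_gauss s : 0 < s -> summable (fun x => theta x * gauss s x) /\
  \int[mu]_x (theta x * gauss s x) = 0.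
Proof.
move=> s0.
have h : summable (fun x => theta x * gauss s x).
  have := half_order_gauss half_order_theta continuous_theta 1 s0.
  by congr summable; apply/funext => x; rewrite mul1r.
split => //; apply: Rint_odd => //; first exact: summable_measurable.
by move=> x; rewrite thetaN gaussN mulNr.
Qed.

Lemma cos_part_gauss q s : 0 < s -> \int[mu]_x (cos_part (q * x) * gauss s x) =
  eigen_even * s `^ (- beta) * gauss (k0 / s) q.
Proof.
move=> s0; have [] := Psi_gauss_integral g_gt1 (lexx 0) (- (k0 * `|q| `^ g)) s0.
rewrite add0r div1r => h1 h2.
transitivity (Gamma beta * (2 / g * s `^ (- beta) * expR (- (k0 * `|q| `^ g) / s))).
  rewrite -h2 -RintZ//; apply: eq_Rint => x.
  by rewrite /cos_part powRr0 mul1r normM_powR mulNr !mulrA.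
rewrite /eigen_even gaussE.
have -> : - (k0 * `|q| `^ g) / s = - (k0 / s * `|q| `^ g) by ring.
ring.
Qed.

Lemma sin_part_theta_gauss q s : 0 < s ->
  \int[mu]_x (sin_part (q * x) * (theta x * gauss s x)) =
  eigen_odd * s `^ (- beta') * (theta q * gauss (k0 / s) q).
Proof.
move=> s0; have p0 : 0 <= 2 * nu + 2 by rewrite addr_ge0// mulr_ge0// ltW.
have [] := Psi_gauss_integral g_gt1 p0 (- (k0 * `|q| `^ g)) s0.
rewrite beta'E => h1 h2.
transitivity (odd_coef * theta q * (2 / g * s `^ (- beta') * expR (- (k0 * `|q| `^ g) / s))).
  rewrite -h2 -RintZ//; apply: eq_Rint => x.
  by rewrite /sin_part -theta_sqr normM_powR thetaM mulNr !mulrA; ring.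
rewrite /eigen_odd gaussE.
have -> : - (k0 * `|q| `^ g) / s = - (k0 / s * `|q| `^ g) by ring.
ring.
Qed.

(** The real kernel playing, for the complex one, the part that [cos + sin]
    plays for the exponential (Hartley transform). *)
Definition kern x : R := cos_part x + sin_part x.

Lemma continuous_kern : continuous kern.
Proof. by move=> x; apply: cvgD; [exact: continuous_cos_part | exact: continuous_sin_part]. Qed.

Lemma half_order_kern : half_order kern.
Proof. by apply: half_orderD; [exact: half_order_cos_part | exact: half_order_sin_part]. Qed.

Lemma kern_gauss q s : 0 < s -> summable (fun x => kern (q * x) * gauss s x) /\
  \int[mu]_x (kern (q * x) * gauss s x) = eigen_even * s `^ (- beta) * gauss (k0 / s) q.
Proof.
move=> s0.
have hc := half_order_gauss half_order_cos_part continuous_cos_part q s0.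
have hs := half_order_gauss half_order_sin_part continuous_sin_part q s0.
split; first exact: (half_order_gauss half_order_kern continuous_kern).
rewrite -cos_part_gauss// -[RHS]addr0.
rewrite -(@Rint_odd _ (fun x => sin_part (q * x) * gauss s x))//.
- by rewrite -RintD//; apply: eq_Rint => x; rewrite /kern mulrDl.
- exact: summable_measurable.
- by move=> x; rewrite mulrN sin_partN gaussN mulNr.
Qed.

Let half_order_mul_theta f : half_order f -> continuous f -> forall q s, 0 < s ->
  summable (fun x => f (q * x) * (theta x * gauss s x)).
Proof.
move=> hof cf q s s0; have s2 : 0 < s / 2 by rewrite divr_gt0.
have sf := half_order_gauss hof cf q s2.
have [M [kap [M0 k00 H]]] := half_order_dilate half_order_theta.
have A0 : 0 < kap / (s / 2) by rewrite divr_gt0.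
have AB : kap <= kap / (s / 2) * (s / 2) by rewrite divfK ?gt_eqF.
have := summableZ (M * gauss (- (kap / (s / 2))) 1) (summable_norm sf).
apply: le_summable.
  apply: measurable_funM.
    apply: continuous_measurable_fun => x; apply: continuous_comp; last exact: cf.
    by apply: cvgMr; exact: cvg_id.
  apply: measurable_funM; last exact: measurable_gauss.
  by apply: continuous_measurable_fun; exact: continuous_theta.
move=> x; have := H _ _ A0 s2 AB 1 x; rewrite mul1r => Hx.
rewrite !(normrM (f _)) (normrM (theta x)) !(ger0_norm (gauss_ge0 _ _ _)) [leRHS]mulrCA.
apply: ler_wpM2l => //; apply: le_trans (ler_wpM2r (gauss_ge0 _ _ _) Hx) _.
have e : gauss (- (s / 2)) x * gauss s x = gauss (s / 2) x.
  by rewrite gaussM (_ : - (s / 2) + s = s / 2)//; field.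
by rewrite -!mulrA e lexx.
Qed.

Lemma kern_theta_gauss q s : 0 < s ->
  summable (fun x => kern (q * x) * (theta x * gauss s x)) /\
  \int[mu]_x (kern (q * x) * (theta x * gauss s x)) =
  eigen_odd * s `^ (- beta') * (theta q * gauss (k0 / s) q).
Proof.
move=> s0.
have hc := half_order_mul_theta half_order_cos_part continuous_cos_part q s0.
have hs := half_order_mul_theta half_order_sin_part continuous_sin_part q s0.
split; first exact: (half_order_mul_theta half_order_kern continuous_kern).
rewrite -sin_part_theta_gauss// -[RHS]add0r.
rewrite -(@Rint_odd _ (fun x => cos_part (q * x) * (theta x * gauss s x)))//.
- by rewrite -RintD//; apply: eq_Rint => x; rewrite /kern mulrDl.
- exact: summable_measurable.
- by move=> x; rewrite mulrN cos_partN gaussN thetaN; ring.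
Qed.

(** The transform on the span of the even and odd Gaussians narrower than [gauss N],
    as a relation: [D] is computed term by term from a way of writing [d], and only
    [gspan_transform] shows that it does not depend on it. *)
Inductive gspan (N : R) : (R -> R) -> (R -> R) -> Prop :=
| gspan_even c s : N < s -> 0 < s -> gspan N (fun x => c * gauss s x)
    (fun q => c * (eigen_even * s `^ (- beta) * gauss (k0 / s) q))
| gspan_odd c s : N < s -> 0 < s -> gspan N (fun x => c * (theta x * gauss s x))
    (fun q => c * (eigen_odd * s `^ (- beta') * (theta q * gauss (k0 / s) q)))
| gspan_add d D e E : gspan N d D -> gspan N e E ->
    gspan N (fun x => d x + e x) (fun q => D q + E q).

Lemma gspan_sub M N d D : M <= N -> gspan N d D -> gspan M d D.
Proof.
move=> MN; elim => [c s Ns s0|c s Ns s0|d' D' e E _ h _ h'].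
- by apply: gspan_even => //; exact: le_lt_trans Ns.
- by apply: gspan_odd => //; exact: le_lt_trans Ns.
- exact: gspan_add.
Qed.

Lemma gspanZ N a d D : gspan N d D -> gspan N (fun x => a * d x) (fun q => a * D q).
Proof.
elim => [c s Ns s0|c s Ns s0|d' D' e E _ h _ h'].
- have := gspan_even (a * c) Ns s0; congr gspan; apply/funext => x; ring.
- have := gspan_odd (a * c) Ns s0; congr gspan; apply/funext => x; ring.
- have := gspan_add h h'; congr gspan; apply/funext => x; ring.
Qed.

Lemma gspan_continuous N d D : gspan N d D -> continuous d /\ continuous D.
Proof.
have cg s : continuous (gauss s) by exact: (continuous_gauss g_gt1).
have cth s x : theta y * gauss s y @[y --> x] --> theta x * gauss s x.
  by apply: cvgM; [exact: continuous_theta | exact: cg].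
elim => [c s Ns s0|c s Ns s0|d' D' e E _ [h1 h2] _ [h3 h4]]; split => x.
- by apply: cvgMr; exact: cg.
- by apply: cvgMr; apply: cvgMr; exact: cg.
- by apply: cvgMr; exact: cth.
- by apply: cvgMr; apply: cvgMr; exact: cth.
- by apply: cvgD; [exact: h1 | exact: h3].
- by apply: cvgD; [exact: h2 | exact: h4].
Qed.

Lemma gspan_transform N d D : gspan N d D -> forall q,
  summable (fun x => kern (q * x) * d x) /\ \int[mu]_x (kern (q * x) * d x) = D q.
Proof.
have pull c (f h : R -> R) : (fun x => f x * (c * h x)) = (fun x => c * (f x * h x)).
  by apply/funext => x; ring.
elim => [c s Ns s0 q|c s Ns s0 q|d' D' e E _ h _ h' q].
- have [h1 h2] := kern_gauss q s0; rewrite pull; split; first exact: summableZ.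
  by rewrite RintZ// h2.
- have [h1 h2] := kern_theta_gauss q s0; rewrite pull; split; first exact: summableZ.
  by rewrite RintZ// h2.
- have [h1 h2] := h q; have [h3 h4] := h' q.
  have -> : (fun x => kern (q * x) * (d' x + e x)) =
      (fun x => kern (q * x) * d' x + kern (q * x) * e x).
    by apply/funext => x; rewrite mulrDr.
  by split; [exact: summableD | rewrite RintD// h2 h4].
Qed.

Definition plancherel_const := 4 * u_coef nu ^+ 2.

Lemma u_coef_gt0 : 0 < u_coef nu.
Proof. by rewrite mulr_gt0 ?powR_gt0// div1r Gamma_gt0// beta_gt0. Qed.

Lemma plancherel_const_gt0 : 0 < plancherel_const.
Proof. by rewrite mulr_gt0// exprn_gt0// u_coef_gt0. Qed.

Let gpow r r' : g `^ r * g `^ r' = g `^ (r + r').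
Proof. by rewrite -powRD// (gt_eqF g_gt0) implybT. Qed.

Let plancherel_constE : plancherel_const = 4 * (Gamma beta) ^+ 2 * g `^ (- (2 * al)).
Proof.
have e : g `^ (- (2 * al)) = g `^ (- al) * g `^ (- al).
  by rewrite gpow; congr (_ `^ _); ring.
rewrite /plancherel_const /u_coef div1r e.
by move: (Gamma _) (_ `^ _) => *; ring.
Qed.

Lemma eigen_even_sqr : eigen_even ^+ 2 * k0 `^ (- beta) = plancherel_const.
Proof.
rewrite plancherel_constE k0_powR /eigen_even.
have -> : (2 / g * Gamma beta) ^+ 2 * g `^ (- (2 * (- beta))) =
    4 * Gamma beta ^+ 2 * (g `^ (-2) * g `^ (- (2 * (- beta)))).
  by rewrite powR_invn ?ltW//; field.
by rewrite gpow; congr (_ * _ `^ _); rewrite alE; ring.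
Qed.

Lemma eigen_odd_sqr : eigen_odd ^+ 2 * k0 `^ (- beta') = plancherel_const.
Proof.
rewrite plancherel_constE k0_powR /eigen_odd /odd_coef.
have -> : (2 / g * (Gamma beta * g `^ (- (2 * al)))) ^+ 2 * g `^ (- (2 * (- beta'))) =
    4 * Gamma beta ^+ 2 * (g `^ (-2) * (g `^ (- (2 * al)) * g `^ (- (2 * al))) *
    g `^ (- (2 * (- beta')))).
  by rewrite powR_invn ?ltW//; field.
by rewrite !gpow; congr (_ * _ `^ _); rewrite alE; ring.
Qed.

(** The parameters of the transforms combine as a parallel sum. *)
Let harmonic_powR r s s' : 0 < s -> 0 < s' ->
  s `^ (- r) * s' `^ (- r) * (k0 / s + k0 / s') `^ (- r) =
  k0 `^ (- r) * (s + s') `^ (- r).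
Proof.
move=> s0 s'0; have kp := k0_gt0.
have -> : k0 / s + k0 / s' = k0 * (s + s') / (s * s').
  by field; rewrite !gt_eqF.
rewrite !powRM ?mulr_ge0 ?invr_ge0 ?mulr_ge0 ?exprn_ge0 ?(ltW g_gt0) ?addr_ge0 ?(ltW s0) ?(ltW s'0)//.
rewrite -[(s * s')^-1](powR_inv1) ?mulr_ge0 ?(ltW s0) ?(ltW s'0)//.
rewrite -powRrM mulN1r opprK powRM ?(ltW s0) ?(ltW s'0)// !powRN.
by field; rewrite ?gt_eqF ?powR_gt0 ?addr_gt0.
Qed.

(** The transform of a Gaussian being a Gaussian, both sides are Gamma integrals;
    they vanish by oddness for Gaussians of opposite parities, and for equal
    parities the ratio is the same constant for all widths and both parities. *)
Lemma gspan_isometry M N d D e E : gspan M d D -> gspan N e E ->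
  [/\ summable (fun x => d x * e x), summable (fun q => D q * E q) &
      \int[mu]_q (D q * E q) = plancherel_const * \int[mu]_x (d x * e x)].
Proof.
have pull a b a' b' (f h p : R -> R) : (forall x, f x * h x = p x) ->
    (fun x => a * (b * f x) * (a' * (b' * h x))) = (fun x => a * a' * (b * b') * p x).
  by move=> fh; apply/funext => x; rewrite -fh; ring.
have pull1 a a' (f h p : R -> R) : (forall x, f x * h x = p x) ->
    (fun x => a * f x * (a' * h x)) = (fun x => a * a' * p x).
  by move=> fh; apply/funext => x; rewrite -fh; ring.
have kp s : 0 < s -> 0 < k0 / s by move=> s0; rewrite divr_gt0// k0_gt0.
have mixed c c' b b' s s' r r' : 0 < s -> 0 < s' -> 0 < r -> 0 < r' ->
    [/\ summable (fun x => c * gauss s x * (c' * (theta x * gauss s' x))),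
        summable (fun x => c * (b * gauss r x) * (c' * (b' * (theta x * gauss r' x)))) &
    \int[mu]_x (c * (b * gauss r x) * (c' * (b' * (theta x * gauss r' x)))) =
    plancherel_const * \int[mu]_x (c * gauss s x * (c' * (theta x * gauss s' x)))].
  move=> s0 s'0 r0 r'0.
  have e1 (t t' : R) x : gauss t x * (theta x * gauss t' x) = theta x * gauss (t + t') x.
    by rewrite -gaussM; ring.
  rewrite (pull _ _ _ _ _ _ _ (e1 _ _)) (pull1 _ _ _ _ _ (e1 _ _)).
  have [h1 h2] := Rint_theta_gauss (addr_gt0 s0 s'0).
  have [h3 h4] := Rint_theta_gauss (addr_gt0 r0 r'0).
  split; [exact: summableZ | exact: summableZ |].
  by rewrite !RintZ// h2 h4 !mulr0.
elim => [c s Ms s0|c s Ms s0|d' D' e' E' _ h _ h' hE].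
- elim => [c' s' Ns s'0|c' s' Ns s'0|d' D' e' E' _ [h1 h2 h3] _ [h4 h5 h6]].
  + rewrite (pull _ _ _ _ _ _ _ (gaussM _ _ _)) (pull1 _ _ _ _ _ (gaussM _ _ _)).
    have r0 := addr_gt0 (kp _ s0) (kp _ s'0); have s1 := addr_gt0 s0 s'0.
    split; [exact/summableZ/summable_gauss | exact/summableZ/summable_gauss |].
    rewrite !RintZ ?Rint_gauss//; try exact: summable_gauss.
    rewrite -eigen_even_sqr.
    have := harmonic_powR beta s0 s'0 => H.
    transitivity (c * c' * eigen_even ^+ 2 * (2 / g * Gamma beta) *
      (s `^ (- beta) * s' `^ (- beta) * (k0 / s + k0 / s') `^ (- beta))); first ring.
    rewrite H; ring.
  + apply: mixed => //; exact: kp.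
  + have -> : (fun x => c * gauss s x * (d' x + e' x)) =
        (fun x => c * gauss s x * d' x + c * gauss s x * e' x).
      by apply/funext => x; rewrite mulrDr.
    have -> : (fun x => c * (eigen_even * s `^ (- beta) * gauss (k0 / s) x) * (D' x + E' x)) =
        (fun x => c * (eigen_even * s `^ (- beta) * gauss (k0 / s) x) * D' x +
          c * (eigen_even * s `^ (- beta) * gauss (k0 / s) x) * E' x).
      by apply/funext => x; rewrite mulrDr.
    split; [exact: summableD | exact: summableD |].
    by rewrite !RintD// h3 h6 mulrDr.
- elim => [c' s' Ns s'0|c' s' Ns s'0|d' D' e' E' _ [h1 h2 h3] _ [h4 h5 h6]].
  + have [h1 h2 h3] := mixed c' c (eigen_even * s' `^ (- beta))
      (eigen_odd * s `^ (- beta')) _ _ _ _ s'0 s0 (kp _ s'0) (kp _ s0).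
    split.
    * by move: h1; congr summable; apply/funext => x; ring.
    * by move: h2; congr summable; apply/funext => x; ring.
    under eq_Rint do rewrite mulrC; rewrite h3.
    by congr (_ * _); apply: eq_Rint => x; rewrite mulrC.
  + have e1 (t t' : R) x : theta x * gauss t x * (theta x * gauss t' x) =
        theta x * theta x * gauss (t + t') x by rewrite -gaussM; ring.
    rewrite (pull _ _ _ _ _ _ _ (e1 _ _)) (pull1 _ _ _ _ _ (e1 _ _)).
    have [h1 h2] := Rint_theta2_gauss (addr_gt0 (kp _ s0) (kp _ s'0)).
    have [h3 h4] := Rint_theta2_gauss (addr_gt0 s0 s'0).
    split; [exact: summableZ | exact: summableZ |].
    rewrite !RintZ// h2 h4 -eigen_odd_sqr.
    have := harmonic_powR beta' s0 s'0 => H.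
    transitivity (c * c' * eigen_odd ^+ 2 * (2 / g * Gamma beta') *
      (s `^ (- beta') * s' `^ (- beta') * (k0 / s + k0 / s') `^ (- beta'))); first ring.
    rewrite H; ring.
  + have e1 (a b f h : R -> R) : (fun x => f x * (a x + b x)) =
        (fun x => f x * a x + f x * b x) by apply/funext => x; rewrite mulrDr.
    rewrite !(e1 _ _ _ theta); split; [exact: summableD | exact: summableD |].
    by rewrite !RintD// h3 h6 mulrDr.
- have [h1 h2 h3] := h hE; have [h4 h5 h6] := h' hE.
  have e1 (a b f : R -> R) : (fun x => (a x + b x) * f x) =
      (fun x => a x * f x + b x * f x) by apply/funext => x; rewrite mulrDl.
  rewrite !e1; split; [exact: summableD | exact: summableD |].
  by rewrite !RintD// h3 h6 mulrDr.
Qed.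

End kernel.

(** * Weierstrass approximation *)
Section weierstrass_approximation.
Context {R : realType}.
Implicit Types (x : R) (phi psi : nat -> R) (n k : nat).

(** The expectation of [phi] at a binomial variable of parameters [n] and [x]:
    with [phi k = F (k / n)], the Bernstein polynomial of [F]. *)
Fixpoint binomial_mean n phi x : R :=
  if n is m.+1 then
    x * binomial_mean m (phi \o S) x + (1 - x) * binomial_mean m phi x
  else phi 0%N.

Lemma binomial_mean_poly n phi :
  exists p : {poly R}, forall x, binomial_mean n phi x = p.[x].
Proof.
elim: n phi => [|n IH] phi; first by exists (phi 0%N)%:P => x; rewrite hornerC.
have [p Hp] := IH (phi \o S); have [q Hq] := IH phi.
by exists ('X * p + (1 - 'X) * q) => x; rewrite /= Hp Hq !hornerE.
Qed.

Lemma binomial_mean_linear n a c phi psi x :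
  binomial_mean n (fun k => a * phi k + c * psi k) x =
  a * binomial_mean n phi x + c * binomial_mean n psi x.
Proof.
elim: n phi psi => [//|n IH] phi psi /=.
by rewrite /comp/= (IH (fun k => phi k.+1)) IH; ring.
Qed.

Lemma binomial_mean_cst n c x : binomial_mean n (fun=> c) x = c.
Proof. by elim: n => [//|n IH] /=; rewrite /comp/= IH; ring. Qed.

Lemma binomial_mean_le n phi psi x : 0 <= x <= 1 ->
  (forall k, (k <= n)%N -> phi k <= psi k) ->
  binomial_mean n phi x <= binomial_mean n psi x.
Proof.
move=> /andP[x0 x1]; elim: n phi psi => [|n IH] phi psi h /=; first exact: h.
apply: lerD; apply: ler_wpM2l; rewrite ?subr_ge0//; apply: IH => k kn.
  exact: h.
by apply: h; exact: leqW.
Qed.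

Lemma binomial_mean_sqr n c x : binomial_mean n (fun k => (k%:R + c) ^+ 2) x =
  (n%:R * x + c) ^+ 2 + n%:R * x * (1 - x).
Proof.
elim: n c => [|n IH] c /=; first by ring.
have -> : (fun k => (k%:R + c) ^+ 2) \o S = (fun k => (k%:R + (c + 1)) ^+ 2).
  by apply/funext => k /=; rewrite -natr1; ring.
by rewrite !IH -natr1; ring.
Qed.

Lemma uniform_continuity_segment (F : R -> R) (a b e : R) : continuous F -> 0 < e ->
  exists2 d, 0 < d & forall x y, a <= x <= b -> `|x - y| < d -> `|F x - F y| <= e.
Proof.
move=> cF e0; have e2 : 0 < e / 2 by rewrite divr_gt0.
have /compact_near_coveringP := @segment_compact R a b.
move=> /(_ R 0^'+ (fun d x => forall y, `|x - y| < d -> `|F x - F y| <= e) _) H.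
have {H} : \forall d \near 0^'+, `[a, b] `<=`
    (fun x => forall y, `|x - y| < d -> `|F x - F y| <= e).
  apply: H => x _.
  have /cvgrPdist_lt/(_ _ e2)/nbhs_ballP[r /= r0 Hr] := cF x.
  have r2 : 0 < r / 2 by rewrite divr_gt0.
  exists (ball x (r / 2), [set d : R | d < r / 2]).
    by split => /=; [exact: nbhsx_ballx | exact: nbhs_right_lt].
  move=> [x' d] [/= xx' dr] y x'y.
  have h1 := Hr x' (le_ball (_ : r / 2 <= r) xx').
  have h2 : `|F x - F y| < e / 2.
    apply: Hr; rewrite /ball/=; apply: le_lt_trans (ler_distD x' _ _) _.
    by rewrite [ltRHS](splitr r); apply: ltrD => //; exact: lt_trans dr.
  apply: le_trans (ler_distD (F x) _ _) _; rewrite (splitr e) lerD// ltW//.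
  rewrite distrC; apply: h1; lra.
move=> H; have [d [d0 Hd]] := filter_ex (filterI (nbhs_right_gt (0 : R)) H).
by exists d => // x y xab xy; apply: Hd => //=; rewrite in_itv.
Qed.

(** Bernstein's proof: the variance of a binomial mean is at most a multiple of
    [1 / n], so by Chebyshev's inequality only the values of [F] near
    [x] contribute to the mean. *)
Theorem weierstrass_approximation (F : R -> R) (e : R) : continuous F -> 0 < e ->
  exists p : {poly R}, forall x, 0 <= x <= 1 -> `|F x - p.[x]| <= e.
Proof.
move=> cF e0; have e2 : 0 < e / 2 by rewrite divr_gt0.
have [d d0 Hd] := uniform_continuity_segment 0 1 cF e2.
(* Beyond distance [d] the oscillation [2 M] is at most [C] times the square. *)
have [M FM] : exists M, forall x, 0 <= x <= 1 -> `|F x| <= M.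
  have [|c _ Hc] := @EVT_max R (fun x => `|F x|) 0 1 ler01.
    by apply: continuous_subspaceT => x; apply: cvg_norm; exact: cF.
  by exists `|F c| => x x01; apply: Hc; rewrite in_itv.
have M0 : 0 <= M by apply: le_trans (FM 0 _); rewrite ?lexx ?ler01.
pose C := 2 * M / d ^+ 2.
have C0 : 0 <= C by rewrite divr_ge0 ?mulr_ge0 ?exprn_ge0// ltW.
pose n := (Num.trunc (2 * C / e)).+1.
have n0 : 0 < n%:R :> R by rewrite ltr0n.
have Cn : C / n%:R <= e / 2.
  have h : 2 * C / e <= n%:R by exact/ltW/truncnS_gt.
  rewrite ler_pdivrMr//; move: h; rewrite ler_pdivrMr// => h; lra.
have [p Hp] := binomial_mean_poly n (fun k => F (k%:R / n%:R)).
exists p => x /andP[x0 x1]; rewrite -Hp.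
pose psi k : R := 1 * (e / 2) + C / n%:R ^+ 2 * (k%:R + - (n%:R * x)) ^+ 2.
have psi_le k : (k <= n)%N -> `|F x - F (k%:R / n%:R)| <= psi k.
  move=> kn; have kn01 : 0 <= (k%:R / n%:R : R) <= 1.
    by rewrite divr_ge0//= ler_pdivrMr// mul1r ler_nat.
  have psiE : psi k = e / 2 + C * (x - k%:R / n%:R) ^+ 2.
    by rewrite /psi; field; rewrite gt_eqF.
  rewrite psiE; have [xk|xk] := ltP `|x - k%:R / n%:R| d.
    apply: le_trans (Hd _ _ _ xk) _; first by rewrite x0.
    by rewrite lerDl mulr_ge0 ?sqr_ge0.
  have h : 2 * M <= C * (x - k%:R / n%:R) ^+ 2.
    rewrite -real_normK ?num_real// /C -mulrA ler_peMr ?mulr_ge0//.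
    by rewrite mulrC ler_pdivlMr ?exprn_gt0// mul1r ler_sqr ?nnegrE ?(ltW d0).
  have h1 : `|F x| <= M by apply: FM; rewrite x0.
  have h2 := FM _ kn01; apply: le_trans (ler_normB _ _) _; lra.
have mean_psi : binomial_mean n psi x <= e.
  rewrite /psi binomial_mean_linear binomial_mean_cst binomial_mean_sqr subrr expr0n/=.
  have h : x * (1 - x) <= 1.
    by apply: mulr_ile1; rewrite ?subr_ge0// lerBlDr lerDl.
  have h3 : C / n%:R * (x * (1 - x)) <= C / n%:R * 1.
    by rewrite ler_wpM2l// divr_ge0.
  have -> : C / n%:R ^+ 2 * (0 + n%:R * x * (1 - x)) = C / n%:R * (x * (1 - x)).
    by field; rewrite gt_eqF.
  lra.
have x01 : 0 <= x <= 1 by rewrite x0.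
clearbody psi.
have up : binomial_mean n (fun k => F (k%:R / n%:R)) x <=
    binomial_mean n (fun k => 1 * F x + 1 * psi k) x.
  apply: binomial_mean_le => // k kn; have := psi_le k kn.
  rewrite ler_norml => /andP[]; lra.
have lo : binomial_mean n (fun k => 1 * F x + -1 * psi k) x <=
    binomial_mean n (fun k => F (k%:R / n%:R)) x.
  apply: binomial_mean_le => // k kn; have := psi_le k kn.
  rewrite ler_norml => /andP[]; lra.
move: up lo; rewrite !binomial_mean_linear !binomial_mean_cst => up lo.
rewrite ler_norml; apply/andP; split; lra.
Qed.

End weierstrass_approximation.

(** * Approximation by Gaussians *)
Section gaussian_approximation.
Context {R : realType} (nu : R) (nu_gt0 : 0 < nu).
Local Notation g := (nu + 2).
Local Notation gauss := (gauss g).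
Local Notation theta := (theta nu).
Local Notation gspan := (gspan nu).
Implicit Types (q s t x : R) (f h : R -> R).

Let g_gt0 : 0 < g. Proof. by rewrite addr_gt0. Qed.

(** Supported in a compact set that avoids the origin. *)
Definition annular f := exists a b, 0 < a /\ forall x, f x != 0 -> a <= `|x| <= b.

Lemma gaussX n x : gauss 1 x ^+ n = gauss n%:R x.
Proof.
elim: n => [|n IH]; first by rewrite expr0 gauss0.
by rewrite exprS IH gaussM nat1r.
Qed.

Lemma gauss_gt0 s x : 0 < gauss s x.
Proof. by rewrite gaussE expR_gt0. Qed.

Let gspan_poly (v : R -> R) : (forall (N : nat) c, exists D,
    gspan N%:R (fun x => c * (v x * gauss N.+1%:R x)) D) ->
  forall (p : {poly R}) (N : nat), exists D,
    gspan N%:R (fun x => v x * (p.[gauss 1 x] * gauss N.+1%:R x)) D.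
Proof.
move=> gv; elim/poly_ind => [|p c IH] N.
  have [D HD] := gv N 0; exists D; move: HD; congr gspan; apply/funext => x.
  by rewrite horner0 !mul0r mulr0.
have [D HD] := IH N.+1; have [D1 HD1] := gv N c.
have NS : N%:R <= N.+1%:R :> R by rewrite ler_nat.
exists (fun q => D q + D1 q).
have := gspan_add (gspan_sub NS HD) HD1; congr gspan; apply/funext => x.
rewrite hornerD hornerM hornerX hornerC -(gaussX N.+2) exprS (gaussX N.+1).
by move: (gauss _ _) (gauss _ _) p.[_] => *; ring.
Qed.

Lemma gspan_even_poly (p : {poly R}) (N : nat) : exists D,
  gspan N%:R (fun x => p.[gauss 1 x] * gauss N.+1%:R x) D.
Proof.
have [|D HD] := gspan_poly (v := fun=> 1) _ p N.
  move=> M c; eexists; have -> : (fun x => c * (1 * gauss M.+1%:R x)) =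
      (fun x => c * gauss M.+1%:R x) by apply/funext => x; rewrite mul1r.
  by apply: gspan_even; rewrite ?ltr_nat.
by exists D; move: HD; congr gspan; apply/funext => x; rewrite mul1r.
Qed.

Lemma gspan_odd_poly (p : {poly R}) (N : nat) : exists D,
  gspan N%:R (fun x => theta x * (p.[gauss 1 x] * gauss N.+1%:R x)) D.
Proof.
apply: gspan_poly => M c; eexists.
by apply: gspan_odd; rewrite ?ltr_nat.
Qed.

(** In the variable [w = gauss 1 x], an even function supported in an annulus is a
    continuous function on the segment from 0 to 1 vanishing near 0, and polynomials
    in [w] are sums of Gaussians. Dividing by [w ^ N.+1] beforehand makes the error
    decay with [x] and all the Gaussians narrow. *)
Lemma even_annular_approx h (N : nat) e : continuous h -> annular h ->
  (forall x, h (- x) = h x) -> 0 < e -> exists p : {poly R},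
  forall x, `|h x - p.[gauss 1 x] * gauss N.+1%:R x| <= e * gauss N.+1%:R x.
Proof.
move=> ch [a [b [a0 hab]]] evh e0.
have h0 x : `|x| < a \/ b < `|x| -> h x = 0.
  move=> xab; apply/eqP/negPn/negP => /hab /andP[ax xb].
  by case: xab; rewrite ltNge ?ax ?xb.
pose z w : R := `|ln w| `^ g^-1.
pose F w := h (z w) / w ^+ N.+1.
have z_ge0 w : 0 <= z w by exact: powR_ge0.
have gV0 : 0 < g^-1 by rewrite invr_gt0.
pose b' := Num.max b 0.
have b'0 : 0 <= b' by rewrite le_max lexx orbT.
pose w0 := expR (- (b' `^ g + 1)).
have F0 w : w < w0 -> F w = 0.
  move=> ww0; rewrite /F; suff -> : h (z w) = 0 by rewrite mul0r.
  apply: h0; rewrite (ger0_norm (z_ge0 w)).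
  have [w_le0|w_gt0] := leP w 0.
    by left; rewrite /z ln0// normr0 powR0 ?gt_eqF.
  right; have lnw : ln w < - (b' `^ g + 1).
    by rewrite -(expRK (- (b' `^ g + 1))) ltr_ln ?posrE ?expR_gt0.
  have b'g : b' `^ g < `|ln w|.
    have p0 : 0 <= b' `^ g by exact: powR_ge0.
    by rewrite ltr0_norm; lra.
  apply: (@le_lt_trans _ _ b'); first by rewrite le_max lexx.
  have -> : b' = (b' `^ g) `^ g^-1.
    by rewrite -powRrM mulfV ?gt_eqF// powRr1.
  by apply: gt0_ltr_powR; rewrite ?nnegrE ?powR_ge0.
have cF : continuous F.
  move=> w; have [w_lt|w_ge] := ltP w w0.
    rewrite /continuous_at F0//; apply: cvg_near_cst.
    by apply: filterS (lt_nbhsl w_lt) => v /F0 ->.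
  have w_gt0 : 0 < w by apply: lt_le_trans w_ge; exact: expR_gt0.
  apply: cvgM.
    apply: (@continuous_comp _ _ _ z h); last exact: ch.
    apply: (@continuous_comp _ _ _ (@ln R) (fun y => `|y| `^ g^-1)).
      exact: continuous_ln.
    by apply: continuous_powR_norm; exact: ltW.
  apply: (@continuousV _ _ (fun v : R => v ^+ N.+1)).
    by rewrite expf_neq0// gt_eqF.
  exact: exprn_continuous.
have [p Hp] := weierstrass_approximation cF e0; exists p => x.
have w01 : 0 <= gauss 1 x <= 1.
  rewrite ltW ?gauss_gt0//= gaussE -[leRHS]expR0 ler_expR oppr_le0 mul1r.
  exact: powR_ge0.
have -> : h x = F (gauss 1 x) * gauss N.+1%:R x.
  rewrite /F gaussX divfK ?gt_eqF ?gauss_gt0// /z gaussE expRK mul1r normrN.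
  rewrite (ger0_norm (powR_ge0 _ _)) -powRrM mulfV ?gt_eqF// powRr1//.
  by have [x0|x0] := leP 0 x; rewrite ?(ger0_norm x0) ?(ltr0_norm x0)// evh.
rewrite -mulrBl normrM [X in _ * X]gtr0_norm ?gauss_gt0//.
by rewrite ler_wpM2r ?(ltW (gauss_gt0 _ _))// Hp.
Qed.

(** The odd part is [theta] times an even function, continuous because [f] vanishes
    near the origin. *)
Lemma annular_approx f (N : nat) e : continuous f -> annular f -> 0 < e ->
  exists d D, gspan N%:R d D /\
  forall x, `|f x - d x| <= e * ((1 + `|theta x|) * gauss N.+1%:R x).
Proof.
move=> cf [a [b [a0 fab]]] e0.
have cfN : continuous (fun x => f (- x)).
  by move=> x; apply: continuous_comp; [exact: opp_continuous | exact: cf].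
pose fe x := (f x + f (- x)) / 2; pose fo x := (f x - f (- x)) / 2.
have out x : ~~ (a <= `|x| <= b) -> f x = 0 /\ f (- x) = 0.
  move=> xab; split; apply/eqP; apply: contraNT xab; first exact: fab.
  by move=> /fab; rewrite normrN.
have theta_eq0 x : theta x = 0 -> x = 0.
  by move=> /eqP; rewrite mulf_eq0 powR_eq0 normr_eq0 => /orP[/eqP//|/andP[/eqP]].
pose ho x := fo x / theta x.
have ann (h : R -> R) : (forall x, f x = 0 -> f (- x) = 0 -> h x = 0) -> annular h.
  move=> hh; exists a, b; split => // x; apply: contraNT => /out[h1 h2].
  by apply/eqP; exact: hh.
have cfo : continuous fo by move=> x; apply: cvgMl; apply: cvgB; [exact: cf | exact: cfN].
have cho : continuous ho.
  move=> x; have [->|x0] := eqVneq x 0.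
    have foz y : `|y| < a -> ho y = 0.
      move=> ya; have [|f1 f2] := out y; first by rewrite negb_and -ltNge ya.
      by rewrite /ho /fo f1 f2 subrr !mul0r.
    rewrite /continuous_at foz ?normr0//; apply: cvg_near_cst.
    apply/nbhs_ballP; exists a => //= y; rewrite /ball/= sub0r normrN => ya.
    by rewrite foz.
  apply: cvgM; first exact: cfo.
  apply: (@continuousV _ _ theta); last exact: continuous_theta.
  by apply: contra_neq x0; exact: theta_eq0.
have [] := @even_annular_approx fe N e.
- by move=> x; apply: cvgMl; apply: cvgD; [exact: cf | exact: cfN].
- by apply: ann => x h1 h2; rewrite /fe h1 h2 addr0 mul0r.
- by move=> x; rewrite /fe opprK addrC.
- exact: e0.
move=> p Hp.
have [] := @even_annular_approx ho N e.
- exact: cho.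
- by apply: ann => x h1 h2; rewrite /ho /fo h1 h2 subrr !mul0r.
- move=> x; rewrite /ho /fo opprK thetaN invrN mulrN -mulNr; congr (_ / _).
  by rewrite -mulNr opprB.
- exact: e0.
move=> p' Hp'.
have [D HD] := gspan_even_poly p N; have [D' HD'] := gspan_odd_poly p' N.
exists (fun x => p.[gauss 1 x] * gauss N.+1%:R x +
  theta x * (p'.[gauss 1 x] * gauss N.+1%:R x)), (fun q => D q + D' q).
split; first exact: gspan_add.
move=> x; have foE : fo x = theta x * ho x.
  rewrite /ho; have [t0|t0] := eqVneq (theta x) 0; last by rewrite mulrC divfK.
  by rewrite t0 mul0r /fo (theta_eq0 _ t0) oppr0 subrr mul0r.
have -> : f x = fe x + theta x * ho x by rewrite -foE /fe /fo; field.
rewrite opprD addrACA -mulrBr; apply: le_trans (ler_normD _ _) _.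
have -> : e * ((1 + `|theta x|) * gauss N.+1%:R x) =
    e * gauss N.+1%:R x + `|theta x| * (e * gauss N.+1%:R x) by ring.
apply: lerD; first exact: Hp.
by rewrite normrM ler_wpM2l// Hp'.
Qed.

End gaussian_approximation.

(** * The closed graph of the transform *)
Section square_summable.
Context {R : realType}.
Local Notation mu := (@lebesgue_measure R).
Implicit Types (f h p : R -> R) (e t : R).

Definition sqsum f : Prop := measurable_fun setT f /\ summable (fun x => f x ^+ 2).
(** The square of the norm of L2. *)
Definition energy f : R := \int[mu]_x (f x ^+ 2).

Lemma measurable_sqr f : measurable_fun setT f -> measurable_fun setT (fun x => f x ^+ 2).
Proof. by move=> mf; under eq_fun do rewrite expr2; exact: measurable_funM. Qed.

Lemma energy_ge0 f : 0 <= energy f.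
Proof. by apply: Rintegral_ge0 => x _; exact: sqr_ge0. Qed.

Lemma le_sqsum f h : measurable_fun setT f -> (forall x, `|f x| <= h x) ->
  sqsum h -> sqsum f /\ energy f <= energy h.
Proof.
move=> mf fh [mh sh].
have fh2 x : f x ^+ 2 <= h x ^+ 2.
  rewrite -(real_normK (num_real (f x))) ler_sqr ?nnegrE//.
  exact: le_trans (fh x).
have sf : summable (fun x => f x ^+ 2).
  apply: le_summable sh; first exact: measurable_sqr.
  by move=> x; rewrite ger0_norm ?sqr_ge0.
by split => //; apply: ler_Rint.
Qed.

Lemma summable_mul f h : sqsum f -> sqsum h -> summable (fun x => f x * h x).
Proof.
move=> [mf sf] [mh sh]; apply: le_summable (summableD sf sh).
  exact: measurable_funM.
move=> x; rewrite ler_norml; apply/andP; split.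
  by have := sqr_ge0 (f x + h x); have := sqr_ge0 (f x); have := sqr_ge0 (h x); nra.
by have := sqr_ge0 (f x - h x); have := sqr_ge0 (f x); have := sqr_ge0 (h x); nra.
Qed.

Lemma sqsumZ a f : sqsum f -> sqsum (fun x => a * f x).
Proof.
move=> [mf sf]; split; first exact: measurable_funM.
by under eq_fun do rewrite exprMn; exact: summableZ.
Qed.

Lemma sqsumD f h : sqsum f -> sqsum h -> sqsum (fun x => f x + h x).
Proof.
move=> sf sh; split; first exact: (measurable_funD sf.1 sh.1).
have := summableD (summableD sf.2 sh.2) (summableZ 2 (summable_mul sf sh)).
by congr summable; apply/funext => x; ring.
Qed.

Lemma sqsumB f h : sqsum f -> sqsum h -> sqsum (fun x => f x - h x).
Proof.
move=> sf /(sqsumZ (-1)) sh; have := sqsumD sf sh.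
by congr sqsum; apply/funext => x; rewrite mulN1r.
Qed.

Lemma energyZ a f : sqsum f -> energy (fun x => a * f x) = a ^+ 2 * energy f.
Proof.
by move=> sf; rewrite /energy -RintZ//; [apply: eq_Rint => x; rewrite exprMn | exact: sf.2].
Qed.

Lemma energyD f h : sqsum f -> sqsum h -> energy (fun x => f x + h x) =
  energy f + energy h + 2 * \int[mu]_x (f x * h x).
Proof.
move=> sf sh; have sm := summable_mul sf sh.
rewrite /energy -RintZ// -RintD; [|exact: sf.2|exact: sh.2].
rewrite -RintD; [|exact: (summableD sf.2 sh.2)|exact: summableZ].
by apply: eq_Rint => x; ring.
Qed.

(** By the parallelogram identity. *)
Lemma energyD_le f h : sqsum f -> sqsum h ->
  energy (fun x => f x + h x) <= 2 * energy f + 2 * energy h.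
Proof.
move=> sf sh; rewrite -!RintZ; [|exact: sh.2|exact: sf.2].
rewrite -RintD; [|exact: (summableZ _ sf.2)|exact: (summableZ _ sh.2)].
apply: ler_Rint; [exact: (sqsumD sf sh).2 | |].
  by apply: summableD; apply: summableZ; [exact: sf.2 | exact: sh.2].
by move=> x; have := sqr_ge0 (f x - h x); nra.
Qed.

Lemma energyBC f h : energy (fun x => f x - h x) = energy (fun x => h x - f x).
Proof. by apply: eq_Rint => x; ring. Qed.

Lemma energy_triangle f h p : sqsum f -> sqsum h -> sqsum p ->
  energy (fun x => f x - p x) <=
  2 * energy (fun x => f x - h x) + 2 * energy (fun x => h x - p x).
Proof.
move=> sf sh sp; have := energyD_le (sqsumB sf sh) (sqsumB sh sp).
by congr (_ <= _); apply: eq_Rint => x; congr (_ ^+ 2); ring.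
Qed.

(** Young's form of the triangle inequality, sharp enough for equalities. *)
Lemma energy_young f h t : sqsum f -> sqsum h -> 0 < t ->
  energy f <= (1 + t) * energy h + (1 + t^-1) * energy (fun x => f x - h x).
Proof.
move=> sf sh t0; have sfh := sqsumB sf sh.
rewrite -!RintZ; [|exact: sfh.2|exact: sh.2].
rewrite -RintD; [|exact: (summableZ _ sh.2)|exact: (summableZ _ sfh.2)].
apply: ler_Rint; [exact: sf.2 | |].
  by apply: summableD; apply: summableZ; [exact: sh.2 | exact: sfh.2].
move=> x; rewrite -subr_ge0.
have -> : (1 + t) * h x ^+ 2 + (1 + t^-1) * (f x - h x) ^+ 2 - f x ^+ 2 =
    t^-1 * (t * h x - (f x - h x)) ^+ 2 by field; rewrite gt_eqF.
by rewrite mulr_ge0 ?sqr_ge0// invr_ge0 ltW.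
Qed.

(** Fatou's lemma, in the form that bounds a pointwise limit in energy. *)
Lemma sqsum_fatou (f_ : nat -> R -> R) f c :
  (forall n, sqsum (f_ n)) -> (forall x, f_ n x @[n --> \oo] --> f x) ->
  (\forall n \near \oo, energy (f_ n) <= c) -> sqsum f /\ energy f <= c.
Proof.
move=> sf ff fc.
have mf : measurable_fun setT f.
  by apply: (measurable_fun_cvg (fun n => (sf n).1)) => x _; exact: ff.
have le_c : (\int[mu]_x (f x ^+ 2)%:E <= c%:E)%E.
  apply: (@fatou_le _ (fun n x => f_ n x ^+ 2)).
  - by move=> n; apply: measurable_sqr; exact: (sf n).1.
  - by move=> n x; exact: sqr_ge0.
  - by move=> x; under eq_fun do rewrite expr2; rewrite expr2; apply: cvgM.
  - by apply: filterS fc => n; rewrite -EFin_Rint ?lee_fin//; exact: (sf n).2.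
have s2 : summable (fun x => f x ^+ 2).
  apply: summable_ge0; [exact: measurable_sqr | by move=> x; exact: sqr_ge0 |].
  by apply: le_lt_trans le_c _; exact: ltry.
by split; [split | rewrite -lee_fin /energy EFin_Rint].
Qed.

Lemma cvg_harmonic_bound (u : nat -> R) (l c : R) :
  (forall n, `|u n - l| <= c / n.+1%:R) -> u n @[n --> \oo] --> l.
Proof.
move=> h; apply/cvgrPdist_le => e e0.
have c0 : 0 <= c.
  by have := le_trans (normr_ge0 _) (h 0%N); rewrite divr1.
exists (Num.trunc (c / e)) => //= n cn; rewrite distrC; apply: le_trans (h n) _.
rewrite ler_pdivrMr ?ltr0n// mulrC -ler_pdivrMr//; apply: le_trans (ltW (truncnS_gt _)) _.
by rewrite ler_nat.
Qed.

Lemma le_of_le_add_eps (a b K : R) : 0 <= K ->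
  (forall t, 0 < t <= 1 -> a <= b + t * K) -> a <= b.
Proof.
move=> K0 h; rewrite leNgt; apply/negP => ba.
have K1 : 0 < K + 1 by lra.
have d0 : 0 < a - b by lra.
pose t := Num.min 1 ((a - b) / (2 * (K + 1))).
have t0 : 0 < t by rewrite lt_min ltr01 divr_gt0// mulr_gt0.
have t1 : t <= 1 by rewrite ge_min lexx.
have tK : t * (2 * (K + 1)) <= a - b.
  by rewrite -ler_pdivlMr ?mulr_gt0// ge_min lexx orbT.
have := h t; rewrite t0 t1 => /(_ isT); nra.
Qed.

End square_summable.

Section transform_graph.
Context {R : realType} (nu : R) (nu_gt0 : 0 < nu).
Local Notation mu := (@lebesgue_measure R).
Local Notation g := (nu + 2).
Local Notation gauss := (gauss g).
Local Notation theta := (theta nu).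
Local Notation kern := (kern nu).
Local Notation gspan := (gspan nu).
Local Notation C := (plancherel_const nu).
Implicit Types (q s t x e : R) (f h : R -> R).

Let C_gt0 : 0 < C. Proof. exact: plancherel_const_gt0. Qed.

Definition transf f q : R := \int[mu]_x (kern (q * x) * f x).

(** The graph of the extension of the transform to L2: the closure of the set of
    pairs of a combination of Gaussians and its transform. *)
Definition Gr f X : Prop := [/\ sqsum f, sqsum X & forall e, 0 < e -> exists d D,
  [/\ gspan 0 d D, energy (fun x => f x - d x) <= e & energy (fun q => X q - D q) <= e]].

Lemma gspan_sqsum N d D : gspan N d D -> [/\ sqsum d, sqsum D & energy D = C * energy d].
Proof.
move=> dD; have [cd cD] := gspan_continuous nu_gt0 dD.
have [h1 h2 h3] := gspan_isometry nu_gt0 dD dD.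
split; [split | split |].
- exact: continuous_measurable_fun.
- by under eq_fun do rewrite expr2.
- exact: continuous_measurable_fun.
- by under eq_fun do rewrite expr2.
- by rewrite /energy; under eq_Rint do rewrite expr2; rewrite h3;
    congr (_ * _); apply: eq_Rint => x; rewrite expr2.
Qed.

(** The isometry of the span passes to the closure. Norms being used only through
    their squares, an error of size [t ^ 2] in energy is split off by
    [energy_young], at the cost of a factor [1 + t]. *)
Lemma Gr_isometry f X : Gr f X -> energy X = C * energy f.
Proof.
move=> [sf sX H].
have aux (k m : R) (u v : R -> R) : 0 <= k -> 0 <= m -> sqsum u -> sqsum v ->
    (forall e, 0 < e -> exists a b, [/\ sqsum a, sqsum b, k * energy a = m * energy b,
      energy (fun x => u x - a x) <= e & energy (fun x => v x - b x) <= e]) ->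
    k * energy u <= m * energy v.
  move=> k0 m0 su sv Huv; have v0 := energy_ge0 v.
  apply: (@le_of_le_add_eps _ _ _ (2 * k + 3 * m * energy v + 4 * m)).
    by rewrite !addr_ge0 ?mulr_ge0.
  move=> t /andP[t0 t1]; have t2 : 0 < t ^+ 2 by rewrite exprn_gt0.
  have [a [b [sa sb ab ua vb]]] := Huv _ t2.
  have y1 := energy_young su sa t0.
  have y2 := energy_young sb sv t0; rewrite energyBC in y2.
  have i1 : (1 + t^-1) * energy (fun x => u x - a x) <= t + t ^+ 2.
    apply: le_trans (ler_wpM2l _ ua) _; first by rewrite addr_ge0// invr_ge0 ltW.
    by rewrite mulrDl mul1r expr2 mulrA mulVf ?gt_eqF// mul1r addrC.
  have i2 : (1 + t^-1) * energy (fun x => v x - b x) <= t + t ^+ 2.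
    apply: le_trans (ler_wpM2l _ vb) _; first by rewrite addr_ge0// invr_ge0 ltW.
    by rewrite mulrDl mul1r expr2 mulrA mulVf ?gt_eqF// mul1r addrC.
  have tt : t + t ^+ 2 <= 2 * t by nra.
  have e1 : k * energy u <= (1 + t) * (k * energy a) + k * (2 * t).
    apply: le_trans (ler_wpM2l k0 (le_trans y1 (lerD (lexx _) (le_trans i1 tt)))) _.
    by rewrite mulrDr mulrCA.
  have e2 : m * energy b <= (1 + t) * (m * energy v) + m * (2 * t).
    apply: le_trans (ler_wpM2l m0 (le_trans y2 (lerD (lexx _) (le_trans i2 tt)))) _.
    by rewrite mulrDr mulrCA.
  rewrite ab in e1.
  have e3 : (1 + t) * (m * energy b) <= (1 + t) * ((1 + t) * (m * energy v) + m * (2 * t)).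
    by rewrite ler_wpM2l// addr_ge0// ltW.
  have mv : 0 <= m * energy v by rewrite mulr_ge0.
  apply: le_trans e1 _; apply: le_trans (lerD e3 (lexx _)) _; rewrite -subr_ge0.
  have -> : m * energy v + t * (2 * k + 3 * m * energy v + 4 * m) -
      ((1 + t) * ((1 + t) * (m * energy v) + m * (2 * t)) + k * (2 * t)) =
      t * (1 - t) * (m * energy v) + 2 * (t * (1 - t)) * m by ring.
  have t3 : 0 <= t * (1 - t) by rewrite mulr_ge0 ?subr_ge0// ltW.
  by rewrite addr_ge0// mulr_ge0// mulr_ge0.
apply/eqP; rewrite eq_le; apply/andP; split.
  rewrite -[leLHS]mul1r; apply: aux => //; first exact: ltW.
  move=> e /H [d [D [dD h1 h2]]]; have [sd sD E] := gspan_sqsum dD.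
  by exists D, d; split => //; rewrite mul1r.
rewrite -[leRHS]mul1r; apply: aux => //; first exact: ltW.
move=> e /H [d [D [dD h1 h2]]]; have [sd sD E] := gspan_sqsum dD.
by exists d, D; split => //; rewrite mul1r.
Qed.

Lemma GrD f X h Y : Gr f X -> Gr h Y -> Gr (fun x => f x + h x) (fun q => X q + Y q).
Proof.
move=> [sf sX H1] [sh sY H2]; split; [exact: sqsumD | exact: sqsumD |] => e e0.
have e4 : 0 < e / 4 by rewrite divr_gt0.
have [d [D [dD a1 a2]]] := H1 _ e4; have [d' [D' [dD' b1 b2]]] := H2 _ e4.
have [sd sD _] := gspan_sqsum dD; have [sd' sD' _] := gspan_sqsum dD'.
exists (fun x => d x + d' x), (fun q => D q + D' q); split; first exact: gspan_add.
  have := energyD_le (sqsumB sf sd) (sqsumB sh sd').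
  rewrite (_ : energy (fun x => f x - d x + (h x - d' x)) =
    energy (fun x => f x + h x - (d x + d' x))); first by lra.
  by apply: eq_Rint => x; congr (_ ^+ 2); ring.
have := energyD_le (sqsumB sX sD) (sqsumB sY sD').
rewrite (_ : energy (fun x => X x - D x + (Y x - D' x)) =
  energy (fun x => X x + Y x - (D x + D' x))); first by lra.
by apply: eq_Rint => x; congr (_ ^+ 2); ring.
Qed.

Lemma GrZ a f X : Gr f X -> Gr (fun x => a * f x) (fun q => a * X q).
Proof.
move=> [sf sX H]; split; [exact: sqsumZ | exact: sqsumZ |] => e e0.
have a1 : 0 < a ^+ 2 + 1 by rewrite ltr_wpDl ?sqr_ge0.
have e1 : 0 < e / (a ^+ 2 + 1) by rewrite divr_gt0.
have [d [D [dD h1 h2]]] := H _ e1; have [sd sD _] := gspan_sqsum dD.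
have le r : 0 <= r -> r <= e / (a ^+ 2 + 1) -> a ^+ 2 * r <= e.
  move=> r0; rewrite ler_pdivlMr// => h; apply: le_trans h.
  by rewrite mulrC ler_wpM2l// lerDl.
exists (fun x => a * d x), (fun q => a * D q); split; first exact: gspanZ.
  have -> : energy (fun x => a * f x - a * d x) = a ^+ 2 * energy (fun x => f x - d x).
    by rewrite -energyZ; [apply: eq_Rint => x; rewrite mulrBr | exact: sqsumB].
  by apply: le => //; exact: energy_ge0.
have -> : energy (fun x => a * X x - a * D x) = a ^+ 2 * energy (fun x => X x - D x).
  by rewrite -energyZ; [apply: eq_Rint => x; rewrite mulrBr | exact: sqsumB].
by apply: le => //; exact: energy_ge0.
Qed.

Lemma GrB f X h Y : Gr f X -> Gr h Y -> Gr (fun x => f x - h x) (fun q => X q - Y q).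
Proof.
move=> GX /(GrZ (-1)) GY; have := GrD GX GY.
by congr Gr; apply/funext => x; rewrite mulN1r.
Qed.

Lemma Gr_closed f X : sqsum f -> sqsum X -> (forall e, 0 < e -> exists f' X',
  [/\ Gr f' X', energy (fun x => f x - f' x) <= e & energy (fun q => X q - X' q) <= e]) ->
  Gr f X.
Proof.
move=> sf sX H; split => // e e0; have e4 : 0 < e / 4 by rewrite divr_gt0.
have [f' [X' [[sf' sX' H'] h1 h2]]] := H _ e4; have [d [D [dD h3 h4]]] := H' _ e4.
have [sd sD _] := gspan_sqsum dD; exists d, D; split => //.
  by have := energy_triangle sf sf' sd; lra.
by have := energy_triangle sX sX' sD; lra.
Qed.

(** Along a sequence converging in energy, the transforms are Cauchy in energy
    by isometry, so a pointwise limit of theirs is also the limit in energy. *)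
Lemma Gr_pointwise_closed (f_ X_ : nat -> R -> R) f X (u : nat -> R) :
  sqsum f -> (forall n, Gr (f_ n) (X_ n)) ->
  (forall n, energy (fun x => f_ n x - f x) <= u n) -> u n @[n --> \oo] --> (0 : R) ->
  (forall q, X_ n q @[n --> \oo] --> X q) -> Gr f X.
Proof.
move=> sf GX fu u0 XX.
have sf_ n : sqsum (f_ n) by have [] := GX n.
have sX_ n : sqsum (X_ n) by have [] := GX n.
have tail e : 0 < e -> exists n, energy (fun x => f x - f_ n x) <= e /\
    (sqsum (fun q => X q - X_ n q) /\ energy (fun q => X q - X_ n q) <= e).
  move=> e0; have K0 : 0 < 4 * C + 1 by rewrite addr_gt0// mulr_gt0.
  have e1 : 0 < e / (4 * C + 1) by rewrite divr_gt0.
  have e1E : e / (4 * C + 1) * (4 * C + 1) = e by rewrite divfK ?gt_eqF.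
  have /cvgrPdist_le/(_ _ e1)[N _ HN] := u0.
  have uN n : (N <= n)%N -> energy (fun x => f_ n x - f x) <= e / (4 * C + 1).
    move=> Nn; apply: le_trans (fu n) _; apply: le_trans (ler_norm _) _.
    by have := HN n Nn; rewrite sub0r normrN.
  exists N; split.
    rewrite energyBC; apply: le_trans (uN N (leqnn N)) _.
    by rewrite ler_pdivrMr// ler_peMr ?(ltW e0)// lerDr mulr_ge0// ltW.
  apply: (@sqsum_fatou _ (fun m q => X_ m q - X_ N q)).
  - by move=> m; exact: sqsumB.
  - by move=> q; apply: cvgB; [exact: XX | exact: cvg_cst].
  exists N => // m Nm /=; rewrite (Gr_isometry (GrB (GX m) (GX N))).
  have := energy_triangle (sf_ m) sf (sf_ N).
  have := uN _ Nm; have := uN _ (leqnn N); rewrite (energyBC (f_ N)) => h1 h2 h3.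
  have h4 : energy (fun x => f_ m x - f_ N x) <= 4 * (e / (4 * C + 1)) by lra.
  apply: le_trans (ler_wpM2l (ltW C_gt0) h4) _; rewrite -[leRHS]e1E -subr_ge0.
  set r := e / _ in e1 *; have -> : r * (4 * C + 1) - C * (4 * r) = r by ring.
  exact: ltW.
have sX : sqsum X.
  have [n [_ [h _]]] := tail 1 ltr01; have := sqsumD h (sX_ n).
  by congr sqsum; apply/funext => q; rewrite subrK.
apply: Gr_closed => // e /tail[n [h1 [_ h2]]].
by exists (f_ n), (X_ n).
Qed.

Let wt x : R := (1 + `|theta x|) * gauss 1 x.

Let measurable_kern_dilate q : measurable_fun setT (fun x : R => kern (q * x)).
Proof.
apply: continuous_measurable_fun => x; apply: continuous_comp.
  by apply: cvgMr; exact: cvg_id.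
exact: continuous_kern.
Qed.

Let measurable_theta : measurable_fun setT theta.
Proof. by apply: continuous_measurable_fun; exact: continuous_theta. Qed.

Let measurable_wt : measurable_fun setT wt.
Proof.
apply: measurable_funM; last exact: measurable_gauss.
by apply: measurable_funD => //; exact: measurableT_comp.
Qed.

Let sqsum_wt : sqsum wt.
Proof.
split => //; have [h1 _] := Rint_theta2_gauss nu_gt0 (ltr0Sn R 1).
have h2 := summable_gauss nu_gt0 (ltr0Sn R 1).
apply: le_summable (summableZ 2 (summableD h2 h1)).
  exact: measurable_sqr.
move=> x; rewrite ger0_norm ?sqr_ge0// /wt exprMn gaussX.
rewrite -[X in _ <= 2 * (X + _)]mul1r -mulrDl mulrA.
rewrite ler_wpM2r ?gauss_ge0// -expr2 -(real_normK (num_real (theta x))).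
by have := sqr_ge0 (1 - `|theta x|); nra.
Qed.

Let summable_kern_wt q : summable (fun x => `|kern (q * x)| * wt x).
Proof.
have [h1 _] := kern_gauss nu_gt0 q ltr01; have [h2 _] := kern_theta_gauss nu_gt0 q ltr01.
have := summableD (summable_norm h1) (summable_norm h2).
congr summable; apply/funext => x.
rewrite (normrM (kern _)) (normrM (kern _)) (normrM (theta x)) (ger0_norm (gauss_ge0 _ _ _)).
by rewrite /wt; ring.
Qed.

(** For such [f] the approximation by Gaussians is uniform against the weight [wt],
    so it controls both the energy and, for each frequency, the integral that
    defines the transform. *)
Lemma annular_Gr f : continuous f -> annular f -> Gr f (transf f).
Proof.
move=> cf af; have mf := continuous_measurable_fun cf.
have approx (n : nat) : exists dD : (R -> R) * (R -> R), gspan 0 dD.1 dD.2 /\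
    forall x, `|f x - dD.1 x| <= n.+1%:R^-1 * wt x.
  have n0 : 0 < n.+1%:R^-1 :> R by rewrite invr_gt0.
  by have [d [D [h1 h2]]] := annular_approx nu_gt0 0 cf af n0; exists (d, D).
have [dD HdD] := choice approx.
have sd n : sqsum (dD n).1 by have [] := gspan_sqsum (HdD n).1.
have mfd n : measurable_fun setT (fun x => f x - (dD n).1 x).
  by apply: measurable_funB => //; exact: (sd n).1.
have sfd n : sqsum (fun x => f x - (dD n).1 x) /\
    energy (fun x => f x - (dD n).1 x) <= energy wt / n.+1%:R.
  have [h1 h2] := le_sqsum (mfd n) (HdD n).2 (sqsumZ _ sqsum_wt); split => //.
  apply: le_trans h2 _; rewrite energyZ// mulrC ler_wpM2l ?energy_ge0//.
  rewrite expr2 ler_piMr// invf_le1 ?ler1n//.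
have sf : sqsum f.
  by have := sqsumD (sfd 0%N).1 (sd 0%N); congr sqsum; apply/funext => x; rewrite subrK.
have cvg0 (c : R) : c / n.+1%:R @[n --> \oo] --> (0 : R).
  apply: (@cvg_harmonic_bound _ _ _ `|c|) => n.
  by rewrite subr0 normrM [X in _ * X]gtr0_norm ?invr_gt0.
apply: (@Gr_pointwise_closed (fun n => (dD n).1) (fun n => (dD n).2) _ _
  (fun n => energy wt / n.+1%:R)) => //.
- move=> n; have [s1 s2 _] := gspan_sqsum (HdD n).1; split => // e e0.
  exists (dD n).1, (dD n).2; split; first exact: (HdD n).1.
    by rewrite /energy; under eq_Rint do rewrite subrr expr0n/=;
      rewrite Rintegral_cst//= mul0r ltW.
  by rewrite /energy; under eq_Rint do rewrite subrr expr0n/=;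
    rewrite Rintegral_cst//= mul0r ltW.
- by move=> n; rewrite energyBC; exact: (sfd n).2.
move=> q; apply: (@cvg_harmonic_bound _ _ _ (\int[mu]_x (`|kern (q * x)| * wt x))) => n.
have [s1 e1] := gspan_transform nu_gt0 (HdD n).1 q.
have bnd x : `|kern (q * x) * f x - kern (q * x) * (dD n).1 x| <=
    n.+1%:R^-1 * (`|kern (q * x)| * wt x).
  by rewrite -mulrBr normrM mulrCA ler_wpM2l// (HdD n).2.
have mk : measurable_fun setT (fun x => kern (q * x) * f x - kern (q * x) * (dD n).1 x).
  by apply: measurable_funB; apply: measurable_funM => //; exact: (sd n).1.
have sk := le_summable mk bnd (summableZ _ (summable_kern_wt q)).
have skf : summable (fun x => kern (q * x) * f x).
  by have := summableD sk s1; congr summable; apply/funext => x; rewrite subrK.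
rewrite -e1 /transf distrC -RintB// mulrC -RintZ//.
exact: ler_norm_Rint mk (summableZ _ (summable_kern_wt q)) bnd.
Qed.

End transform_graph.

(** * Functions of bounded support *)
Section compact_support.
Context {R : realType} (nu : R) (nu_gt0 : 0 < nu).
Local Notation mu := (@lebesgue_measure R).
Local Notation g := (nu + 2).
Local Notation gauss := (gauss g).
Local Notation kern := (kern nu).
Local Notation Gr := (Gr nu).
Local Notation transf := (transf nu).
Implicit Types (q s t x e r : R) (f h : R -> R).

Let g_gt0 : 0 < g. Proof. by rewrite addr_gt0. Qed.

Definition supp_in r f := forall x, r <= `|x| -> f x = 0.

Definition cut r f x : R := f x * \1_[set y : R | `|y| < r] x.

(** Removing the origin too makes [puncture r f] the pointwise limit of continuous
    annular functions when [f] is continuous. *)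
Definition puncture r f x : R := f x * \1_[set y : R | 0 < `|y| < r] x.

Lemma measurable_ball0 r : measurable [set y : R | `|y| < r].
Proof.
rewrite (_ : [set _ | _] = `]- r, r[%classic); first exact: measurable_itv.
by apply/seteqP; split => x /=; rewrite in_itv/= ltr_norml.
Qed.

Lemma measurable_annulus r : measurable [set y : R | 0 < `|y| < r].
Proof.
rewrite (_ : [set _ | _] = [set y : R | `|y| < r] `\ 0).
  by apply: measurableD => //; exact: measurable_ball0.
apply/seteqP; split => x /=; rewrite normr_gt0.
  by move=> /andP[/eqP].
by move=> [-> /eqP ->].
Qed.

Lemma measurable_cut r f : measurable_fun setT f -> measurable_fun setT (cut r f).
Proof.
move=> mf; apply: measurable_funM => //; apply: measurable_indic.
exact: measurable_ball0.
Qed.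

Lemma measurable_puncture r f : measurable_fun setT f -> measurable_fun setT (puncture r f).
Proof.
move=> mf; apply: measurable_funM => //; apply: measurable_indic.
exact: measurable_annulus.
Qed.

Lemma cutE r f x : cut r f x = if `|x| < r then f x else 0.
Proof.
rewrite /cut indicE; case: ifPn => xr.
  by rewrite mem_set ?mulr1.
by rewrite memNset ?mulr0//=; exact/negP.
Qed.

Lemma punctureE r f x : puncture r f x = if 0 < `|x| < r then f x else 0.
Proof.
rewrite /puncture indicE; case: ifPn => xr.
  by rewrite mem_set ?mulr1.
by rewrite memNset ?mulr0//=; exact/negP.
Qed.

Lemma supp_in_puncture r f : supp_in r (puncture r f).
Proof. by move=> x rx; rewrite punctureE [`|x| < r]ltNge rx andbF. Qed.

Lemma supp_in_cut r f : supp_in r (cut r f).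
Proof. by move=> x rx; rewrite cutE ltNge rx. Qed.

Lemma puncture_le r f x : `|puncture r f x| <= `|f x|.
Proof. by rewrite punctureE; case: ifP; rewrite ?normr0. Qed.

Lemma cut_le r f x : `|cut r f x| <= `|f x|.
Proof. by rewrite cutE; case: ifP; rewrite ?normr0. Qed.

Lemma sqsum_norm f : sqsum f -> sqsum (fun x => `|f x|).
Proof.
move=> [mf sf]; split; first exact: measurableT_comp.
by under eq_fun do rewrite real_normK ?num_real//.
Qed.

Lemma sqsum_puncture r f : sqsum f -> sqsum (puncture r f).
Proof.
move=> sf; apply: (proj1 (le_sqsum _ (puncture_le r f) (sqsum_norm sf))).
exact: measurable_puncture sf.1.
Qed.

Lemma sqsum_cut r f : sqsum f -> sqsum (cut r f).
Proof.
move=> sf; apply: (proj1 (le_sqsum _ (cut_le r f) (sqsum_norm sf))).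
exact: measurable_cut sf.1.
Qed.

Lemma ball_gauss r x : `|x| < r -> 1 <= expR (r `^ g) * gauss 1 x.
Proof.
move=> xr; rewrite gaussE -expRD -[leLHS]expR0 ler_expR mul1r subr_ge0.
by rewrite ge0_ler_powR ?(ltW g_gt0)// ?nnegrE ?(ltW xr)// (le_trans _ (ltW xr)).
Qed.

Lemma sqsum_gauss : sqsum (gauss 1).
Proof.
split; first exact: measurable_gauss.
by under eq_fun do rewrite gaussX; exact: summable_gauss.
Qed.

Lemma kern_compact_bound q r : exists2 c, 0 <= c & forall x, `|x| < r -> `|kern (q * x)| <= c.
Proof.
have [M [kap [M0 k0 H]]] := half_order_dilate (half_order_kern nu_gt0).
exists (M * (gauss (- kap) q * expR (r `^ g))).
  by rewrite !mulr_ge0 ?gauss_ge0 ?expR_ge0.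
move=> x xr; apply: le_trans (H kap 1 k0 ltr01 _ q x) _; first by rewrite mulr1.
rewrite ler_wpM2l// ler_wpM2l ?gauss_ge0// gaussE ler_expR mulN1r opprK.
by rewrite ge0_ler_powR ?(ltW g_gt0)// ?nnegrE ?(ltW xr)// (le_trans _ (ltW xr)).
Qed.

(** On functions of bounded support the integral transform is continuous in energy,
    by the Cauchy-Schwarz inequality, written with a free parameter [t]. *)
Lemma transf_compact_bound q r : exists2 c, 0 <= c & forall h, sqsum h -> supp_in r h ->
  forall t, 0 < t -> summable (fun x => kern (q * x) * h x) /\
  `|transf h q| <= c * (t + t^-1 * energy h).
Proof.
have [c0 c00 Hc0] := kern_compact_bound q r.
pose E := expR (r `^ g); pose G := \int[mu]_x gauss 1 x.
have G0 : 0 <= G by apply: Rintegral_ge0 => x _; exact: gauss_ge0.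
have E0 : 0 <= E by exact: expR_ge0.
exists (c0 * (E * G + 1)) => [|h sh hr t t0].
  by rewrite mulr_ge0// addr_ge0// mulr_ge0.
have mk : measurable_fun setT (fun x => kern (q * x) * h x).
  apply: measurable_funM; last exact: sh.1.
  apply: continuous_measurable_fun => x; apply: continuous_comp.
    by apply: cvgMr; exact: cvg_id.
  exact: continuous_kern.
have sg := summable_gauss nu_gt0 ltr01.
have sdom : summable (fun x => c0 * (t * E * gauss 1 x + t^-1 * h x ^+ 2)).
  by apply/summableZ/summableD; apply: summableZ => //; exact: sh.2.
have tV0 : 0 < t^-1 by rewrite invr_gt0.
have bnd x : `|kern (q * x) * h x| <= c0 * (t * E * gauss 1 x + t^-1 * h x ^+ 2).
  have [xr|xr] := ltP `|x| r; last first.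
    rewrite hr// mulr0 normr0 mulr_ge0// addr_ge0// ?mulr_ge0 ?gauss_ge0 ?sqr_ge0//; exact: ltW.
  rewrite normrM ler_pM// ?Hc0//; apply: (@le_trans _ _ (t + t^-1 * h x ^+ 2)).
    rewrite -subr_ge0 -(real_normK (num_real (h x))).
    have -> : t + t^-1 * `|h x| ^+ 2 - `|h x| =
        t^-1 * ((`|h x| - t / 2) ^+ 2 + 3 / 4 * t ^+ 2) by field; rewrite gt_eqF.
    by rewrite mulr_ge0 ?(ltW tV0)// addr_ge0 ?sqr_ge0// mulr_ge0 ?sqr_ge0.
  by rewrite lerD2r -mulrA ler_peMr ?(ltW t0)// ball_gauss.
split; first exact: le_summable mk bnd sdom.
apply: le_trans (ler_norm_Rint mk sdom bnd) _.
rewrite RintZ; last by apply: summableD; apply: summableZ => //; exact: sh.2.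
rewrite RintD; [|exact: summableZ|by apply: summableZ; exact: sh.2].
rewrite !RintZ//; last exact: sh.2.
rewrite -/(energy h) -/G -[leRHS]mulrA; apply: ler_wpM2l => //; rewrite -subr_ge0.
have -> : (E * G + 1) * (t + t^-1 * energy h) - (t * E * G + t^-1 * energy h) =
    E * G * (t^-1 * energy h) + t by ring.
have h0 := energy_ge0 h.
by rewrite addr_ge0 ?(ltW t0)// mulr_ge0// mulr_ge0// ltW.
Qed.

(** Energy limits inside a fixed ball are harmless: the integral transforms converge
    at every frequency, and [Gr_pointwise_closed] applies. *)
Lemma Gr_compact_closed r f : sqsum f -> supp_in r f ->
  (forall e, 0 < e -> exists f', [/\ supp_in r f', Gr f' (transf f') &
     energy (fun x => f x - f' x) <= e]) -> Gr f (transf f).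
Proof.
move=> sf rf H.
have n0 (n : nat) : 0 < n.+1%:R^-1 :> R by rewrite invr_gt0.
have n2 (n : nat) : 0 < n.+1%:R^-1 ^+ 2 :> R by rewrite exprn_gt0.
have [f_ Hf_] := choice (fun n => H _ (n2 n)).
have s_ n : sqsum (f_ n) by have [_ [] ] := Hf_ n.
apply: (@Gr_pointwise_closed _ nu nu_gt0 f_ (fun n => transf (f_ n)) _ _
  (fun n => n.+1%:R^-1 ^+ 2)) => //.
- by move=> n; have [] := Hf_ n.
- by move=> n; rewrite energyBC; have [] := Hf_ n.
- apply: (@cvg_harmonic_bound _ _ _ 1) => n; rewrite subr0 ger0_norm ?(ltW (n2 n))//.
  by rewrite expr2 ler_wpM2r ?(ltW (n0 n))// invf_le1 ?ler1n.
move=> q; have [c c0 Hc] := transf_compact_bound q r.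
apply: (@cvg_harmonic_bound _ _ _ (c * 2)) => n.
have [rf_ _ en] := Hf_ n.
have [s1 _] := Hc _ (s_ n) rf_ _ ltr01; have [s2 _] := Hc _ sf rf _ ltr01.
have sB := sqsumB (s_ n) sf.
have rB : supp_in r (fun x => f_ n x - f x) by move=> x rx; rewrite rf_// rf// subrr.
have -> : transf (f_ n) q - transf f q = transf (fun x => f_ n x - f x) q.
  by rewrite /transf -RintB//; apply: eq_Rint => x; rewrite mulrBr.
have [_ h] := Hc _ sB rB _ (n0 n); apply: le_trans h _.
rewrite -mulrA ler_wpM2l// mulr2n mulrDl mul1r lerD2l invrK energyBC.
apply: le_trans (ler_wpM2l _ en) _ => //.
by rewrite expr2 mulrA mulfV ?mul1r ?pnatr_eq0.
Qed.

(** The retraction of the line onto [-m, m]. *)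
Definition clamp (m y : R) : R := (`|y + m| - `|y - m|) / 2.

Lemma continuous_clamp m f : continuous f -> continuous (fun x => clamp m (f x)).
Proof.
move=> cf x; apply: cvgMl; apply: cvgB; apply: cvg_norm.
  by apply: cvgD; [exact: cf | exact: cvg_cst].
by apply: cvgB; [exact: cf | exact: cvg_cst].
Qed.

Lemma clamp_id m y : `|y| <= m -> clamp m y = y.
Proof.
rewrite ler_norml => /andP[h1 h2]; rewrite /clamp ger0_norm; last by lra.
by rewrite ler0_norm; lra.
Qed.

Lemma clamp_norm_le m y : 0 <= m -> `|clamp m y| <= m.
Proof.
move=> m0; rewrite /clamp ler_norml.
have := ler_normD (y - m) (2 * m); rewrite (_ : y - m + 2 * m = y + m); last by ring.
have := ler_normB (y + m) (2 * m); rewrite (_ : y + m - 2 * m = y - m); last by ring.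
rewrite [`|2 * m|]ger0_norm ?mulr_ge0// => h1 h2.
by apply/andP; split; lra.
Qed.

Lemma clamp_dist m y z : `|clamp m y - clamp m z| <= `|y - z|.
Proof.
have h1 := ler_dist_dist (y + m) (z + m); have h2 := ler_dist_dist (y - m) (z - m).
rewrite (_ : y + m - (z + m) = y - z) in h1; last by ring.
rewrite (_ : y - m - (z - m) = y - z) in h2; last by ring.
move: h1 h2; rewrite /clamp !ler_norml => /andP[h1 h2] /andP[h3 h4].
by apply/andP; split; lra.
Qed.

Lemma measurable_clamp m f : measurable_fun setT f -> measurable_fun setT (fun x => clamp m (f x)).
Proof.
move=> mf; apply: measurable_funM => //; apply: measurable_funB; apply: measurableT_comp => //.
  exact: measurable_funD.
exact: measurable_funB.
Qed.

(* The retraction of the line onto the segment from 0 to 1. *)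
Let clip y : R := (1 + `|y| - `|y - 1|) / 2.

Let clip_le0 y : y <= 0 -> clip y = 0.
Proof. by move=> y0; rewrite /clip ler0_norm// ler0_norm; lra. Qed.

Let clip_ge1 y : 1 <= y -> clip y = 1.
Proof. by move=> y1; rewrite /clip ger0_norm ?ger0_norm; lra. Qed.

Let clip01 y : 0 <= clip y <= 1.
Proof.
have [y0|y0] := leP y 0; first by rewrite clip_le0// lexx ler01.
have [y1|y1] := leP 1 y; first by rewrite clip_ge1// lexx ler01.
by rewrite /clip gtr0_norm// ltr0_norm; lra.
Qed.

Let continuous_clip f : continuous f -> continuous (fun x => clip (f x)).
Proof.
move=> cf x; apply: cvgMl; apply: cvgB.
  by apply: cvgD; [exact: cvg_cst | apply: cvg_norm; exact: cf].
by apply: cvg_norm; apply: cvgB; [exact: cf | exact: cvg_cst].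
Qed.

Lemma sqsum_puncture_bounded r M f : measurable_fun setT f ->
  (forall x, `|x| < r -> `|f x| <= M) -> sqsum (puncture r f).
Proof.
move=> mf fM; have M0 x : `|x| < r -> 0 <= M by move=> /fM; exact: le_trans.
apply: (proj1 (@le_sqsum _ _ (fun x => `|M| * (expR (r `^ g) * gauss 1 x)) _ _ _)).
- exact: measurable_puncture.
- move=> x; rewrite punctureE; case: ifPn => [/andP[_ xr]|_].
    apply: le_trans (fM x xr) _; apply: le_trans (ler_norm _) _.
    by rewrite ler_peMr// ball_gauss.
  by rewrite normr0 !mulr_ge0 ?expR_ge0 ?gauss_ge0.
- by apply/sqsumZ/sqsumZ/sqsum_gauss.
Qed.

Lemma energy_dominated_cvg0 (u : nat -> R -> R) h : (forall n, measurable_fun setT (u n)) ->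
  sqsum h -> (forall n x, `|u n x| <= `|h x|) ->
  (forall x, u n x @[n --> \oo] --> (0 : R)) ->
  forall e, 0 < e -> exists n, energy (u n) <= e.
Proof.
move=> mu_ [mh sh] uh u0 e e0.
have [||||_] := @Rint_dominated_cvg _ (fun n x => u n x ^+ 2) (fun=> 0) (fun x => h x ^+ 2).
- by move=> n; exact: measurable_sqr.
- exact: sh.
- move=> n x; rewrite ger0_norm ?sqr_ge0//.
  by rewrite -(real_normK (num_real (u n x))) -(real_normK (num_real (h x))) ler_sqr ?nnegrE.
- move=> x; rewrite -(mulr0 0); under eq_fun do rewrite expr2; exact: cvgM.
rewrite Rintegral_cst//= mul0r => /cvgrPdist_le/(_ _ e0)[N _ HN].
exists N; have := HN N (leqnn N); rewrite /= sub0r normrN.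
exact: le_trans (ler_norm _).
Qed.

Let puncture_continuous r f : 0 < r -> continuous f ->
  Gr (puncture r f) (transf (puncture r f)).
Proof.
move=> r0 cf; have mf := continuous_measurable_fun cf.
have [M fM] : exists M, forall x, `|x| < r -> `|f x| <= M.
  have [||c _ Hc] := @EVT_max R (fun x => `|f x|) (- r) r.
  - by rewrite ge0_cp// ltW.
  - by apply: continuous_subspaceT => x; apply: cvg_norm; exact: cf.
  exists `|f c| => x xr; apply: Hc; rewrite in_itv/=; move: xr.
  by rewrite ltr_norml => /andP[h1 h2]; rewrite !ltW.
have sp := sqsum_puncture_bounded mf fM.
(* Cut-offs that vanish off the punctured ball and increase to its indicator. *)
pose chi (n : nat) x := clip (n.+1%:R * `|x| - 1) * clip (n.+1%:R * (r - `|x|)).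
have cnorm : continuous (fun x : R => `|x|) by exact: norm_continuous.
have cchi n : continuous (chi n).
  move=> x; apply: cvgM.
    apply: (@continuous_clip (fun x => n.+1%:R * `|x| - 1)) => y.
    by apply: cvgB; [apply: cvgMr; exact: cnorm | exact: cvg_cst].
  apply: (@continuous_clip (fun x => n.+1%:R * (r - `|x|))) => y; apply: cvgMr.
  by apply: cvgB; [exact: cvg_cst | exact: cnorm].
have chi_out n x : ~~ (0 < `|x| < r) -> chi n x = 0.
  rewrite negb_and -!leNgt => /orP[x0|rx].
    rewrite /chi clip_le0 ?mul0r// lerBlDr add0r.
    by rewrite (_ : `|x| = 0) ?mulr0//; apply/eqP; rewrite eq_le x0/=.
  by rewrite /chi [X in _ * X]clip_le0 ?mulr0// pmulr_rle0// subr_le0.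
have chi01 n x : `|1 - chi n x| <= 1.
  have := clip01 (n.+1%:R * `|x| - 1); have := clip01 (n.+1%:R * (r - `|x|)).
  rewrite /chi; move: (clip _) (clip _) => a b /andP[a0 a1] /andP[b0 b1].
  by rewrite ler_norml; apply/andP; split; nra.
have cfchi n : continuous (fun x => f x * chi n x).
  by move=> x; apply: cvgM; [exact: cf | exact: cchi].
apply: (@Gr_compact_closed r) => //; first exact: supp_in_puncture.
move=> e e0.
have [] := @energy_dominated_cvg0 (fun n x => puncture r f x - f x * chi n x) (puncture r f)
  _ sp _ _ e e0.
- by move=> n; apply: measurable_funB; [exact: sp.1 | exact: continuous_measurable_fun].
- move=> n x; rewrite punctureE; case: ifPn => [_|/chi_out ->].
    by rewrite -{1}(mulr1 (f x)) -mulrBr normrM ler_piMr.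
  by rewrite mulr0 subrr.
- move=> x; rewrite punctureE; case: ifPn => [/andP[x0 xr]|xr]; last first.
    by apply: cvg_near_cst; apply: nearW => n; rewrite chi_out// mulr0 subrr.
  apply: cvg_near_cst; pose k := Num.max (2 / `|x|) (1 / (r - `|x|)).
  have rx0 : 0 < r - `|x| by rewrite subr_gt0.
  exists (Num.trunc k) => //= n kn.
  have kn1 : k <= n.+1%:R.
    by apply: le_trans (ltW (truncnS_gt k)) _; rewrite ler_nat.
  have h1 : 2 <= n.+1%:R * `|x|.
    by rewrite -ler_pdivrMr//; apply: le_trans kn1; rewrite le_max lexx.
  have h2 : 1 <= n.+1%:R * (r - `|x|).
    by rewrite -ler_pdivrMr//; apply: le_trans kn1; rewrite le_max lexx orbT.
  by rewrite /chi !clip_ge1// ?mulr1 ?subrr//; lra.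
move=> n Hn; exists (fun x => f x * chi n x); split => //.
  by move=> x rx; rewrite chi_out ?mulr0// negb_and -!leNgt rx orbT.
apply: annular_Gr => //; exists n.+1%:R^-1, r; split; first by rewrite invr_gt0.
move=> x; rewrite mulf_eq0 negb_or => /andP[_ chi0]; apply/andP; split; last first.
  by apply: contra_neqT chi0; rewrite -ltNge => rx; rewrite chi_out// negb_and -!leNgt (ltW rx) orbT.
apply: contra_neqT chi0; rewrite -ltNge => xn; rewrite /chi clip_le0 ?mul0r//.
by rewrite subr_le0 mulrC -ler_pdivlMr// div1r ltW.
Qed.

Let int_indic (A : set R) f : (\int[mu]_(x in A) (f x)%:E = \int[mu]_x (f x * \1_A x)%:E)%E.
Proof.
rewrite integral_mkcond; apply: eq_integral => x _; rewrite patchE indicE.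
by case: ifPn => _; rewrite ?mulr1 ?mulr0.
Qed.

Let puncture_bounded r f M : 0 < r -> 0 < M -> measurable_fun setT f ->
  (forall x, `|f x| <= M) -> Gr (puncture r f) (transf (puncture r f)).
Proof.
move=> r0 M0 mf fM.
have sp : sqsum (puncture r f) by apply: (@sqsum_puncture_bounded r M).
have mp := sp.1.
have sp1 : summable (puncture r f).
  apply: le_summable (summableZ M (summableZ (expR (r `^ g)) (summable_gauss nu_gt0 ltr01))) => //.
  move=> x; rewrite punctureE; case: ifPn => [/andP[_ xr]|_].
    by apply: le_trans (fM x) _; rewrite ler_peMr ?(ltW M0)// ball_gauss.
  by rewrite normr0 !mulr_ge0 ?expR_ge0 ?gauss_ge0// ltW.
pose E : set R := `[- r, r]%classic.
have mE : measurable E by exact: measurable_itv.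
have Efin : (mu E < +oo)%E.
  by rewrite /E lebesgue_measure_itv/=; case: ifP => _; rewrite ?ltry// -EFinB ltry.
have iE : mu.-integrable E (EFin \o puncture r f).
  by apply: integrableS sp1 => //.
have [f_ [cf_ if_ Hf_]] := approximation_continuous_integrable mE Efin iE.
apply: (@Gr_compact_closed r) => //; first exact: supp_in_puncture.
move=> e e0.
have e1 : 0 < e / (2 * M) by rewrite divr_gt0// mulr_gt0.
have [n Hn] : exists n, (\int[mu]_(z in E) `|(puncture r f z - f_ n z)%:E| <= (e / (2 * M))%:E)%E.
  have /fine_cvgP[[N1 _ HN1] /cvgrPdist_le/(_ _ e1)[N2 _ HN2]] := Hf_.
  exists (maxn N1 N2); have := HN2 _ (leq_maxr N1 N2); have h := HN1 _ (leq_maxl N1 N2).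
  rewrite /= sub0r normrN => h2; rewrite -[leLHS](fineK h) lee_fin.
  exact: le_trans (ler_norm _) h2.
pose c x := clamp M (f_ n x).
have cc : continuous c by apply: continuous_clamp; exact: cf_.
exists (puncture r c); split; [exact: supp_in_puncture | exact: puncture_continuous |].
have scp : sqsum (puncture r c).
  apply: (@sqsum_puncture_bounded r M); first exact: continuous_measurable_fun.
  by move=> x _; apply: clamp_norm_le; exact: ltW.
have mfn : measurable_fun setT (f_ n) by apply: continuous_measurable_fun; exact: cf_.
rewrite -lee_fin /energy EFin_Rint; last exact: (sqsumB sp scp).2.
apply: (@le_trans _ _ (\int[mu]_x ((2 * M) * (`|puncture r f x - f_ n x| * \1_E x))%:E)%E).
  apply: ge0_le_int => //.
  - by apply: measurable_sqr; apply: measurable_funB => //; exact: scp.1.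
  - apply: measurable_funM => //; apply: measurable_funM.
      by apply: measurableT_comp => //; exact: measurable_funB.
    exact: measurable_indic.
  - by move=> x _; exact: sqr_ge0.
  move=> x _; have [xr|xr] := boolP (0 < `|x| < r); last first.
    rewrite !punctureE (negbTE xr) subrr expr0n/=.
    by rewrite !mulr_ge0// ltW.
  have xE : E x by move: xr => /andP[_]; rewrite /E/= in_itv/= ltr_norml => /andP[h1 h2]; rewrite !ltW.
  rewrite indicE mem_set// mulr1 !punctureE xr.
  have h1 : `|f x - c x| <= `|f x - f_ n x|.
    by rewrite -{1}(clamp_id (fM x)); exact: clamp_dist.
  have h2 : `|f x - c x| <= 2 * M.
    apply: le_trans (ler_normB _ _) _; have := fM x.
    have := clamp_norm_le (f_ n x) (ltW M0); rewrite -/(c x); lra.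
  by rewrite -(real_normK (num_real (f x - c x))) expr2 ler_pM.
under eq_integral do rewrite EFinM.
have mw : measurable_fun setT (fun x => `|puncture r f x - f_ n x| * \1_E x).
  apply: measurable_funM; last exact: measurable_indic.
  by apply: measurableT_comp => //; exact: measurable_funB.
rewrite ge0_integralZl; [|exact: measurableT|exact: measurable_EFin
  |by move=> x _; rewrite lee_fin mulr_ge0|by rewrite lee_fin mulr_ge0// ltW].
rewrite -int_indic.
have := lee_wpmul2l (_ : (0 <= (2 * M)%:E)%E) Hn.
rewrite lee_fin mulr_ge0 ?(ltW M0)// => /(_ isT); rewrite -EFinM.
have -> : 2 * M * (e / (2 * M)) = e by rewrite mulrC divfK// gt_eqF// mulr_gt0.
exact.
Qed.

(* Truncating the values at height [n] reduces to bounded functions. *)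
Let puncture_sqsum r f : 0 < r -> sqsum f -> Gr (puncture r f) (transf (puncture r f)).
Proof.
move=> r0 sf; have mf := sf.1.
apply: (@Gr_compact_closed r); [exact: sqsum_puncture | exact: supp_in_puncture |] => e e0.
have [] := @energy_dominated_cvg0
  (fun n x => puncture r f x - puncture r (fun y => clamp n.+1%:R (f y)) x) f _ sf _ _ e e0.
- move=> n; apply: measurable_funB; apply: measurable_puncture => //.
  exact: measurable_clamp.
- move=> n x; rewrite !punctureE; case: ifP => _; last by rewrite subrr normr0.
  have [h|h] := leP `|f x| n.+1%:R; first by rewrite clamp_id// subrr normr0.
  have n0 : 0 <= n.+1%:R :> R by exact: ler0n.
  have [fx|fx] := leP 0 (f x).
    have fx0 : `|f x| = f x := ger0_norm fx.
    rewrite /clamp fx0 in h *; rewrite (@ger0_norm _ (f x + n.+1%:R)); last by lra.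
    by rewrite (@ger0_norm _ (f x - n.+1%:R)); [rewrite ger0_norm; lra | lra].
  have fx0 : `|f x| = - f x := ltr0_norm fx.
  rewrite /clamp fx0 in h *; rewrite (@ltr0_norm _ (f x + n.+1%:R)); last by lra.
  by rewrite (@ltr0_norm _ (f x - n.+1%:R)); [rewrite ler0_norm; lra | lra].
- move=> x; apply: cvg_near_cst; exists (Num.trunc `|f x|) => //= n xn.
  rewrite !punctureE clamp_id; first by rewrite subrr.
  by apply: le_trans (ltW (truncnS_gt _)) _; rewrite ler_nat.
move=> n Hn; exists (puncture r (fun y => clamp n.+1%:R (f y))); split => //.
  exact: supp_in_puncture.
apply: (@puncture_bounded r _ n.+1%:R) => //; first exact: measurable_clamp.
by move=> x; exact: clamp_norm_le.
Qed.

(** Continuous, then bounded, then square-integrable functions on a ball are reached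
    in turn by limits in energy; the origin is a null set. *)
Lemma cut_Gr r f : 0 < r -> sqsum f -> Gr (cut r f) (transf (cut r f)).
Proof.
move=> r0 sf; apply: (@Gr_compact_closed r); [exact: sqsum_cut | exact: supp_in_cut |] => e e0.
exists (puncture r f); split; [exact: supp_in_puncture | exact: puncture_sqsum |].
rewrite (_ : energy _ = 0) ?(ltW e0)//.
have -> : energy (fun x => cut r f x - puncture r f x) =
    \int[mu]_x ((cut r f 0) ^+ 2 * \1_[set (0 : R)] x).
  apply: eq_Rint => x; rewrite cutE punctureE indicE.
  have [->|x0] := eqVneq x 0.
    by rewrite mem_set// mulr1 cutE normr0 ltxx subr0.
  rewrite memNset; last by apply/eqP.
  by rewrite mulr0 normr_gt0 x0/= subrr expr0n.
rewrite /Rintegral -int_indic integral_set1//.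
Qed.

End compact_support.

(** * The transform on all square-integrable functions *)
Section riesz_fischer.
Context {R : realType}.
Local Notation mu := (@lebesgue_measure R).
Implicit Types (f h : R -> R) (X : nat -> R -> R).

Let geometric_half_sum n (c : R) : 0 <= c <= 2^-1 -> \sum_(0 <= k < n) c ^+ k <= 2.
Proof.
move=> /andP[c0 c1].
suff : \sum_(0 <= k < n) c ^+ k <= 2 - 2 * c ^+ n.
  by have := exprn_ge0 n c0; lra.
elim: n => [|n IH]; first by rewrite big_geq// expr0; lra.
rewrite big_nat_recr//= exprS; have := exprn_ge0 n c0; nra.
Qed.

Lemma eq_energy_off (Z : set R) f h : measurable Z -> mu Z = 0%E ->
  measurable_fun setT f -> measurable_fun setT h -> (forall x, ~ Z x -> f x = h x) ->
  energy f = energy h.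
Proof.
move=> mZ Z0 mf mh fh; rewrite /energy /Rintegral; congr fine.
apply: ae_eq_integral => //.
- by apply: measurable_EFin; exact: measurable_sqr.
- by apply: measurable_EFin; exact: measurable_sqr.
exists Z; split => // x /= /not_implyP[_ nfh].
by apply: contrapT => /fh fhx; apply: nfh; rewrite fhx.
Qed.

(** The Riesz-Fischer theorem. Along a subsequence the increments [d k] have energy
    at most [8 ^ - k]; since [|d k| <= 2 ^ - k + 2 ^ k (d k) ^ 2], the increments
    are summable almost everywhere. Off a null set the limit is pointwise, and on
    it all functions are replaced by 0. *)
Lemma sqsum_complete X : (forall n, sqsum (X n)) ->
  (forall e, 0 < e -> exists N, forall m n, (N <= m)%N -> (N <= n)%N ->
    energy (fun x => X m x - X n x) <= e) ->
  exists2 Y, sqsum Y & forall e, 0 < e -> exists N, forall n, (N <= n)%N ->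
    energy (fun x => X n x - Y x) <= e.
Proof.
move=> sX cX.
have e8 (k : nat) : 0 < (8^-1 : R) ^+ k by rewrite exprn_gt0// invr_gt0.
have [N_ HN] := choice (fun k => cX _ (e8 k)).
pose phi k := (k + \sum_(0 <= i < k.+1) N_ i)%N.
have phi_ge k : (N_ k <= phi k)%N.
  by rewrite /phi big_nat_recr//= addnA leq_addl.
have phi_geS k : (N_ k <= phi k.+1)%N.
  apply: leq_trans (phi_ge k) _; rewrite /phi [in leqRHS]big_nat_recr//=.
  by apply: leq_add => //; exact: leq_addr.
have phi_gek k : (k <= phi k)%N by rewrite leq_addr.
pose d k x := X (phi k.+1) x - X (phi k) x.
have sd k : sqsum (d k) by exact: sqsumB.
have ed k : energy (d k) <= 8^-1 ^+ k by apply: HN.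
pose u (k : nat) x : R := 2 ^+ k * d k x ^+ 2.
have u0 k x : 0 <= u k x by apply: mulr_ge0; [exact: exprn_ge0 | exact: sqr_ge0].
have mu_ k : measurable_fun setT (u k).
  by apply: measurable_funM => //; exact: measurable_sqr (sd k).1.
pose D x := (\sum_(k <oo) (u k x)%:E)%E.
have D0 x : (0 <= D x)%E by apply: nneseries_ge0 => k _ _; rewrite lee_fin.
have mD : measurable_fun setT D.
  by apply: ge0_emeasurable_sum => [k x _ _|k _]; [rewrite lee_fin | exact: measurable_EFin].
have intD : (\int[mu]_x D x <= 2%:E)%E.
  rewrite integral_nneseries; [|exact: measurableT
    |by move=> k; exact: (measurable_EFin (mu_ k))|by move=> k x _; rewrite lee_fin].
  apply: lime_le.
    by apply: is_cvg_nneseries => k _ _; apply: integral_ge0 => x _; rewrite lee_fin.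
  apply: nearW => n.
  apply: (@le_trans _ _ (\sum_(0 <= k < n) ((4^-1 : R) ^+ k)%:E)%E).
    apply: lee_sum => k _.
    rewrite -EFin_Rint; last exact: (summableZ _ (sd k).2).
    rewrite lee_fin RintZ; last exact: (sd k).2.
    apply: le_trans (ler_wpM2l (exprn_ge0 k (ler0n _ 2)) (ed k)) _.
    rewrite -exprMn (_ : 2 * 8^-1 = 4^-1)//; by field.
  rewrite sumEFin lee_fin geometric_half_sum// invr_ge0 ler0n/=.
  by rewrite lef_pV2 ?posrE// ler_nat.
have iD : mu.-integrable setT D.
  apply/integrableP; split; first exact: mD.
  under eq_integral do rewrite gee0_abs//.
  by apply: le_lt_trans intD _; exact: ltry.
have [Z [mZ Z0 HZ]] := integrable_ae measurableT iD.
have Dfin x : ~ Z x -> D x \is a fin_num.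
  move=> nZ; apply: contrapT => nD; apply: nZ; apply: HZ => /=.
  by move=> /(_ Logic.I).
pose Y_ k x := X (phi k) x * \1_(~` Z) x.
have Y_off k x : ~ Z x -> Y_ k x = X (phi k) x.
  by move=> nZ; rewrite /Y_ indicE mem_set// mulr1.
have mY k : measurable_fun setT (Y_ k).
  apply: measurable_funM; first exact: (sX _).1.
  by apply: measurable_indic; exact: measurableC.
have cY x : cvgn (Y_ ^~ x).
  have [Zx|nZ] := pselect (Z x).
    apply/cvg_ex; exists 0; apply: cvg_near_cst; apply: nearW => k.
    by rewrite /Y_ indicE memNset ?mulr0//=; exact.
  have -> : Y_ ^~ x = (fun k => X (phi 0%N) x + series (d ^~ x) k).
    apply/funext => k; rewrite Y_off// /series/= /d.
    by rewrite (telescope_sumr (fun k => X (phi k) x))// addrC subrK.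
  apply: is_cvgD; first exact: is_cvg_cst.
  apply: normed_cvg; apply: nondecreasing_is_cvgn.
    by apply: nondecreasing_series => k _ _; rewrite /= normr_ge0.
  exists (2 + fine (D x)) => _ [n _ <-].
  apply: (@le_trans _ _ (\sum_(0 <= k < n) (2^-1 ^+ k + u k x))).
    apply: ler_sum => k _; rewrite /u.
    have t0 : 0 < (2 : R) ^+ k by rewrite exprn_gt0.
    rewrite exprVn -subr_ge0 -(real_normK (num_real (d k x))).
    have -> : (2 ^+ k)^-1 + 2 ^+ k * `|d k x| ^+ 2 - `|d k x| =
        2 ^+ k * ((`|d k x| - (2 ^+ k)^-1 / 2) ^+ 2 + 3 / 4 * (2 ^+ k)^-1 ^+ 2).
      by field; rewrite gt_eqF.
    by rewrite mulr_ge0 ?(ltW t0)// addr_ge0 ?sqr_ge0// mulr_ge0 ?sqr_ge0.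
  rewrite big_split/=; apply: lerD.
    by apply: geometric_half_sum; rewrite invr_ge0 ler0n lexx.
  rewrite -lee_fin fineK; last exact: Dfin.
  rewrite -sumEFin; apply: nneseries_lim_ge => k _ _; by rewrite lee_fin.
pose Y x := limn (Y_ ^~ x).
have tail e : 0 < e -> exists N, forall n, (N <= n)%N ->
    sqsum (fun x => X n x - Y x) /\ energy (fun x => X n x - Y x) <= e.
  move=> /cX[N HNe]; exists N => n Nn.
  have sYn k : sqsum (fun x => X n x - Y_ k x).
    have sk := sqsumB (sX n) (sX (phi k)).
    have mk : measurable_fun setT (fun x => X n x - Y_ k x).
      by apply: measurable_funB; [exact: (sX n).1 | exact: mY].
    have : sqsum (fun x => `|X n x| + `|X (phi k) x|).
      have abs m : sqsum (fun x => `|X m x|).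
        split; first by apply: measurableT_comp => //; exact: (sX m).1.
        by under eq_fun do rewrite real_normK ?num_real//; exact: (sX m).2.
      by apply: sqsumD; exact: abs.
    move=> sabs; apply: (proj1 (le_sqsum mk _ sabs)) => x.
    apply: le_trans (ler_normB _ _) _; rewrite lerD2l /Y_ normrM indicE.
    by case: (_ \in _); rewrite ?normr1 ?mulr1 ?normr0 ?mulr0.
  apply: (@sqsum_fatou _ (fun k x => X n x - Y_ k x)) => //.
    by move=> x; apply: cvgB; [exact: cvg_cst | exact: cY].
  exists N => // k Nk /=.
  rewrite (@eq_energy_off Z _ (fun x => X n x - X (phi k) x))//.
  - by apply: HNe => //; exact: leq_trans (phi_gek k).
  - exact: (sYn k).1.
  - by apply: measurable_funB; [exact: (sX n).1 | exact: (sX _).1].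
  - by move=> x nZ; rewrite Y_off.
exists Y.
  have [N /(_ N (leqnn N))[h _]] := tail 1 ltr01.
  by have := sqsumB (sX N) h; congr sqsum; apply/funext => x; rewrite subKr.
by move=> e /tail[N H]; exists N => n /H[].
Qed.

End riesz_fischer.

Section unitary.
Context {R : realType} (nu : R) (nu_gt0 : 0 < nu).
Local Notation mu := (@lebesgue_measure R).
Local Notation C := (plancherel_const nu).
Local Notation Gr := (Gr nu).
Local Notation transf := (transf nu).
Implicit Types (e r : R) (f h X Y : R -> R).

(** Polarization of the isometry. *)
Lemma Gr_inner f X h Y : Gr f X -> Gr h Y ->
  \int[mu]_q (X q * Y q) = C * \int[mu]_x (f x * h x).
Proof.
move=> GX GY; have [sf sX _] := GX; have [sh sY _] := GY.
have := Gr_isometry nu_gt0 (GrD nu_gt0 GX GY).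
rewrite !energyD// (Gr_isometry nu_gt0 GX) (Gr_isometry nu_gt0 GY) => h1.
lra.
Qed.

Lemma cut_cvg f : sqsum f -> forall e, 0 < e -> exists2 r0, 0 < r0 &
  forall r, r0 <= r -> energy (fun x => f x - cut r f x) <= e.
Proof.
move=> sf e e0.
have mB r : measurable_fun setT (fun x => f x - cut r f x).
  by apply: measurable_funB; [exact: sf.1 | exact: measurable_cut sf.1].
have [] := @energy_dominated_cvg0 _ (fun n x => f x - cut n.+1%:R f x) f _ sf _ _ e e0.
- by move=> n; exact: mB.
- by move=> n x; rewrite cutE; case: ifP; rewrite ?subrr ?subr0 ?normr0.
- move=> x; apply: cvg_near_cst; exists (Num.trunc `|x|) => //= n xn.
  rewrite cutE (_ : `|x| < n.+1%:R) ?subrr//.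
  by apply: lt_le_trans (truncnS_gt _) _; rewrite ler_nat.
move=> n Hn; exists n.+1%:R => // r nr; apply: le_trans Hn.
have ab : sqsum (fun x => `|f x - cut n.+1%:R f x|).
  by apply: sqsum_norm; apply: sqsumB => //; exact: sqsum_cut.
have le_r x : `|f x - cut r f x| <= `|f x - cut n.+1%:R f x|.
  rewrite !cutE; case: ifPn => [_|xr]; first by rewrite subrr normr0.
  case: ifPn => // xn; move: xr; rewrite -leNgt => rx.
  by have := lt_le_trans xn (le_trans nr rx); rewrite ltxx.
have [_ le_e] := le_sqsum (mB r) le_r ab; apply: le_trans le_e _.
rewrite /energy le_eqVlt; apply/orP; left; apply/eqP.
by apply: eq_Rint => x; rewrite real_normK ?num_real.
Qed.

Lemma transf_cut_dist f X r : 0 < r -> Gr f X ->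
  energy (fun q => transf (cut r f) q - X q) = C * energy (fun x => f x - cut r f x).
Proof.
move=> r0 GX; have [sf _ _] := GX.
by rewrite (Gr_isometry nu_gt0 (GrB nu_gt0 (cut_Gr nu_gt0 r0 sf) GX)) energyBC.
Qed.

(** The transforms of the truncations of [f] are Cauchy in energy by isometry. *)
Lemma Gr_exists f : sqsum f -> exists X, Gr f X.
Proof.
move=> sf; have C0 := plancherel_const_gt0 nu_gt0.
pose F (n : nat) := transf (cut n.+1%:R f).
have GF n : Gr (cut n.+1%:R f) (F n) by exact: cut_Gr.
have sF n : sqsum (F n) by have [] := GF n.
have sc r : sqsum (cut r f) by exact: sqsum_cut.
have near_cut e : 0 < e -> exists N, forall n, (N <= n)%N ->
    energy (fun x => f x - cut n.+1%:R f x) <= e.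
  move=> /(cut_cvg sf)[r0 _ H]; exists (Num.trunc r0) => n rn; apply: H.
  by apply: le_trans (ltW (truncnS_gt _)) _; rewrite ler_nat.
have [] := @sqsum_complete _ F sF.
  move=> e e0; have e1 : 0 < e / (4 * C) by rewrite divr_gt0// mulr_gt0.
  have [N HN] := near_cut _ e1; exists N => m n Nm Nn.
  rewrite (Gr_isometry nu_gt0 (GrB nu_gt0 (GF m) (GF n))).
  have h := energy_triangle (sc m.+1%:R) sf (sc n.+1%:R).
  have h1 := HN m Nm; have h2 := HN n Nn; rewrite energyBC in h1.
  have h3 : energy (fun x => cut m.+1%:R f x - cut n.+1%:R f x) <= 4 * (e / (4 * C)) by lra.
  apply: le_trans (ler_wpM2l (ltW C0) h3) _.
  by rewrite le_eqVlt; apply/orP; left; apply/eqP; field; rewrite gt_eqF.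
move=> X sX HX; exists X; apply: Gr_closed => // e e0.
have [N1 H1] := near_cut e e0; have [N2 H2] := HX e e0.
exists (cut (maxn N1 N2).+1%:R f), (F (maxn N1 N2)); split => //.
  by apply: H1; rewrite leq_maxl.
by rewrite energyBC; apply: H2; rewrite leq_maxr.
Qed.

End unitary.

(** * The eigenvalue equation *)
Section eigenfunctions.
Context {R : realType} (nu : R) (nu_gt0 : 0 < nu).
Local Notation g := (nu + 2).
Local Notation beta := (g^-1).
Local Notation beta' := (2 - g^-1).
Local Notation al := ((nu + 1) / (nu + 2)).
Local Notation k0 := ((g ^+ 2)^-1).
Local Notation theta := (theta nu).
Implicit Types (q x : R) (f D : R -> R).

Let g_gt0 : 0 < g. Proof. by rewrite addr_gt0. Qed.
Let g_neq0 : g != 0. Proof. by rewrite gt_eqF. Qed.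

(** Caratheodory's characterization of the derivative, at the origin. *)
Lemma is_derive0_factor f (phi : R -> R) : (forall h, f h = f 0 + h * phi h) ->
  continuous phi -> is_derive (0 : R) (1 : R) f (phi 0).
Proof.
move=> fE cphi.
have lim : h^-1 *: (f (h *: (1 : R) + 0) - f 0) @[h --> 0^'] --> phi 0.
  apply: (@cvg_trans _ (phi h @[h --> 0^'])).
    apply: near_eq_cvg; rewrite near_withinE; apply: nearW => h h0.
    by rewrite addr0 /GRing.scale/= mulr1 [f h]fE addrC addKr mulKf.
  by apply: cvg_within_filter; exact: cphi.
split; first by apply/cvg_ex; exists (phi 0).
exact: cvg_lim lim.
Qed.

Lemma is_derive_norm_powR p x : x != 0 ->
  is_derive x (1 : R) (fun y => `|y| `^ p) (p * (x * `|x| `^ (p - 2))).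
Proof.
move=> x0; have [xp|xn] := ltP 0 x.
  have -> : x * `|x| `^ (p - 2) = x `^ (p - 1).
    rewrite gtr0_norm// -{1}(powRr1 (ltW xp)) -powRD ?(gt_eqF xp) ?implybT//.
    by congr (_ `^ _); ring.
  apply: (near_eq_is_derive _ (is_derive1_powR p xp)) => //.
  by near=> y; rewrite gtr0_norm//; near: y; exact: lt_nbhsr.
have {}xn : x < 0 by rewrite lt_neqAle x0.
have nx : 0 < - x by rewrite oppr_gt0.
have -> : p * (x * `|x| `^ (p - 2)) = p * (- x) `^ (p - 1) * (-1).
  rewrite ltr0_norm//.
  have -> : (- x) `^ (p - 1) = - x * (- x) `^ (p - 2).
    rewrite -{2}(powRr1 (ltW nx)) -powRD ?(gt_eqF nx) ?implybT//.
    by congr (_ `^ _); ring.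
  ring.
have d := is_derive1_comp (is_derive1_powR p nx) (is_deriveN (is_derive_id x (1 : R))).
apply: (near_eq_is_derive _ d) => //.
near=> y; rewrite /= ltr0_norm//; near: y; exact: lt_nbhsl.
Unshelve. all: by end_near. Qed.

(** At the origin too, where the exponent [g] exceeds 1. *)
Lemma is_derive_radial x : is_derive x (1 : R) (fun y => `|y| `^ g) (g * theta x).
Proof.
have [->|x0] := eqVneq x 0.
  have t0 : theta 0 = 0 by rewrite /theta mul0r.
  rewrite t0 mulr0 -[X in is_derive _ _ _ X]t0.
  apply: is_derive0_factor; last exact: continuous_theta.
  move=> h; rewrite normr0 powR0// add0r /theta mulrA -expr2.
  rewrite -(real_normK (num_real h)) -(powR_mulrn 2 (normr_ge0 h)) -powRD; last first.
    by rewrite gt_eqF// addrC.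
  by congr (_ `^ _); ring.
have := is_derive_norm_powR g x0; move=> hd; apply: (is_derive_eq hd).
by rewrite /theta; congr (_ * (_ * _ `^ _)); ring.
Qed.

Lemma is_derive_theta x : is_derive x (1 : R) theta ((nu + 1) * `|x| `^ nu).
Proof.
have [->|x0] := eqVneq x 0.
  have n0 : `|0 : R| `^ nu = 0 by rewrite normr0 powR0// gt_eqF.
  rewrite n0 mulr0 -[X in is_derive _ _ _ X]n0.
  apply: (@is_derive0_factor theta (fun y => `|y| `^ nu)).
    by move=> h; rewrite /theta mul0r add0r.
  by move=> y; exact: (continuous_powR_norm (ltW nu_gt0)).
have := is_derive1M (is_derive_id x (1 : R)) (is_derive_norm_powR nu x0).
move=> hd; apply: (is_derive_eq hd); rewrite mul1r.
have -> : `|x| `^ nu = x * x * `|x| `^ (nu - 2).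
  rewrite -expr2 -(real_normK (num_real x)) -(powR_mulrn 2 (normr_ge0 x)) -powRD.
    by congr (_ `^ _); ring.
  by rewrite normr_eq0 x0 implybT.
ring.
Qed.

Lemma quasi_derive_factor f D : (forall x, is_derive x (1 : R) f (`|x| `^ nu * D x)) ->
  continuous D -> quasi_derive nu f = D /\
  cvg (f^`()%classic y / `|y| `^ nu @[y --> within [set y | y != 0] (nbhs 0)]).
Proof.
move=> df cD.
have dE x : x != 0 -> f^`()%classic x / `|x| `^ nu = D x.
  move=> x0; rewrite derive1E; have [_ ->] := df x.
  by rewrite mulrC mulKf// powR_eq0 normr_eq0 negb_and x0.
have lim : f^`()%classic y / `|y| `^ nu @[y --> within [set y | y != 0] (nbhs 0)] --> D 0.
  apply: (@cvg_trans _ (D y @[y --> within [set y | y != 0] (nbhs 0)])).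
    by apply: near_eq_cvg; rewrite near_withinE; apply: nearW => y y0; rewrite dE.
  by apply: cvg_within_filter; exact: cD.
split; last by apply/cvg_ex; exists (D 0).
apply/funext => x; rewrite /quasi_derive /continuous_extension.
have [->|x0] := eqVneq x 0.
  rewrite memNset/=; last by move=> /eqP.
  have lim' : f^`()%classic y / `|y| `^ nu @[y --> 0^'] --> D 0 by [].
  exact: (cvg_lim (@Rhausdorff R) lim').
by rewrite mem_set/= ?dE.
Qed.

(** If [f' = |x| ^ nu D] with [D] differentiable everywhere, the quasi-derivative of
    [f] is [D], at the origin by continuity. *)
Lemma L_regular_factor f D D' : (forall x, is_derive x (1 : R) f (`|x| `^ nu * D x)) ->
  (forall x, is_derive x (1 : R) D (D' x)) ->
  L_regular nu f /\ forall x, Lop nu f x = 2^-1 * D' x.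
Proof.
move=> df dD; have cD : continuous D by move=> x; exact: is_derive_continuous (dD x).
have [qE qcvg] := quasi_derive_factor df cD.
split; first split.
- by move=> x; apply: ex_derive; exact: df.
- exact: qcvg.
- by move=> x; rewrite qE; apply: ex_derive; exact: dD.
by move=> x; rewrite /Lop qE derive1E; have [_ ->] := dD x.
Qed.

Section at_frequency.
Context (q : R).
Let A := k0 * `|q| `^ g.
Let W x := - (A * `|x| `^ g).

Let AE : A * g ^+ 2 = `|q| `^ g.
Proof. by rewrite /A mulrC mulrA mulfV ?mul1r// expf_neq0. Qed.

Let argE x : - (k0 * `|q * x| `^ g) = W x.
Proof. by rewrite /W /A normM_powR mulrA. Qed.

Let is_derive_PsiW b x : 0 < b ->
  is_derive x (1 : R) (fun x => Psi b (W x)) (Psi (b + 1) (W x) * (- (A * (g * theta x)))).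
Proof.
move=> b0; apply: (is_derive1_comp (f := Psi b)); first exact: is_derive_Psi.
have := is_derive1Z (- A) (is_derive_radial x).
rewrite mulNr (_ : (fun x => - A * _) = W)//.
by apply/funext => y; rewrite /W mulNr.
Qed.

Let x_theta x : x * theta x = `|x| `^ g.
Proof.
rewrite /theta mulrA -expr2 -(real_normK (num_real x)) -(powR_mulrn 2 (normr_ge0 x)).
rewrite -powRD; first by congr (_ `^ _); ring.
by rewrite gt_eqF// addrC.
Qed.

Let theta_theta x : theta x * theta x = `|x| `^ nu * `|x| `^ g.
Proof. by rewrite -x_theta /theta; ring. Qed.

(** Differentiation takes [Psi beta (W x)] to [|x| ^ nu] times an odd function, as
    [W] is radial of degree [g]; [Psi_rec] closes the second differentiation. *)
Lemma cos_part_eigen : L_regular nu (fun x => cos_part nu (q * x)) /\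
  forall x, Lop nu (fun x => cos_part nu (q * x)) x =
    - (2^-1 * `|q| `^ g) * cos_part nu (q * x).
Proof.
have b0 : 0 < beta by rewrite invr_gt0.
have b1 : 0 < beta + 1 by rewrite addr_gt0.
pose c := - (Gamma beta * A * g).
have [||h1 h2] := @L_regular_factor (fun x => cos_part nu (q * x))
  (fun x => c * (x * Psi (beta + 1) (W x))) (fun x => c * (g * Psi beta (W x))).
- move=> x; have := is_derive1Z (Gamma beta) (is_derive_PsiW x b0).
  rewrite (_ : (fun x => Gamma beta * _) = (fun x => cos_part nu (q * x))); last first.
    by apply/funext => y; rewrite /cos_part argE.
  move=> hd; by apply: (is_derive_eq hd); rewrite /c /theta; ring.
- move=> x; have := is_derive1Z c (is_derive1M (is_derive_id x (1 : R)) (is_derive_PsiW x b1)).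
  move=> hd; apply: (is_derive_eq hd); rewrite -(Psi_rec (W x) b0) mul1r; congr (_ * _).
  have -> : x * (Psi (beta + 1 + 1) (W x) * - (A * (g * theta x))) =
      - (A * (x * theta x)) * g * Psi (beta + 1 + 1) (W x) by ring.
  by rewrite x_theta -/(W x); field.
split => // x; rewrite h2 /cos_part argE -AE /c; ring.
Qed.

(** Here [Psi_rec] is used in the first differentiation, with parameter
    [beta' - 1]: the derivative of [theta x * Psi beta' (W x)] is
    [g |x| ^ nu Psi (beta' - 1) (W x)]. *)
Lemma sin_part_eigen : L_regular nu (fun x => sin_part nu (q * x)) /\
  forall x, Lop nu (fun x => sin_part nu (q * x)) x =
    - (2^-1 * `|q| `^ g) * sin_part nu (q * x).
Proof.
have n0 := nu_gt0.
have al0 : 0 < al by rewrite divr_gt0// addr_gt0.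
have alS : al + 1 = beta' by field.
have b0 : 0 < beta' by rewrite -alS addr_gt0.
pose c := odd_coef nu * theta q.
have [||h1 h2] := @L_regular_factor (fun x => sin_part nu (q * x))
  (fun x => c * (g * Psi al (W x)))
  (fun x => c * (g * (Psi beta' (W x) * (- (A * (g * theta x)))))).
- move=> x; have := is_derive1Z c (is_derive1M (is_derive_theta x) (is_derive_PsiW x b0)).
  rewrite (_ : (fun x => c * _) = (fun x => sin_part nu (q * x))); last first.
    by apply/funext => y; rewrite /sin_part argE thetaM /c; ring.
  move=> hd; apply: (is_derive_eq hd); rewrite -(Psi_rec (W x) al0) alS.
  have -> : theta x * (Psi (beta' + 1) (W x) * - (A * (g * theta x))) =
      - (A * g * Psi (beta' + 1) (W x) * (theta x * theta x)) by ring.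
  by rewrite theta_theta /W; field.
- move=> x; rewrite -alS.
  by have := is_derive1Z c (is_derive1Z g (is_derive_PsiW x al0)).
split => // x; rewrite h2 /sin_part argE thetaM -AE /c; ring.
Qed.

Lemma eeq_eigenfunction :
  generalized_eigenfunction nu (- (2^-1 * `|q| `^ g)) (eeq nu q).
Proof.
have reE : (fun y => complex.Re (eeq nu q y)) = (fun x => cos_part nu (q * x)).
  by apply/funext => y; rewrite /eeq eeE.
have imE : (fun y => complex.Im (eeq nu q y)) = (fun x => sin_part nu (q * x)).
  by apply/funext => y; rewrite /eeq eeE.
have [c1 c2] := cos_part_eigen; have [s1 s2] := sin_part_eigen.
split.
- by exists 0; rewrite /eeq mulr0 /ee eqxx oner_eq0.
- by rewrite reE.
- by rewrite imE.
- by move=> x; rewrite /LopC reE imE c2 s2 /eeq eeE// realC_mul.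
Qed.

End at_frequency.

End eigenfunctions.

(** * Uniqueness against Gaussians *)
Section gaussian_uniqueness.
Context {R : realType} (nu : R) (nu_gt0 : 0 < nu).
Local Notation mu := (@lebesgue_measure R).
Local Notation g := (nu + 2).
Local Notation gauss := (gauss g).
Local Notation theta := (theta nu).
Local Notation gspan := (gspan nu).
Implicit Types (x y : R) (h u : R -> R).


Lemma Rint_eq0_continuous u : continuous u -> (forall x, 0 <= u x) -> summable u ->
  \int[mu]_x u x = 0 -> forall x, u x = 0.
Proof.
move=> cu u0 su iu x; apply/eqP/negPn/negP => ux0.
have upos : 0 < u x by rewrite lt_neqAle eq_sym ux0 u0.
have u2 : 0 < u x / 2 by rewrite divr_gt0.
have /cvgrPdist_lt/(_ _ u2)/nbhs_ballP[r /= r0 Hr] := cu x.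
have r2 : 0 < r / 2 by rewrite divr_gt0.
have mu_ := continuous_measurable_fun cu.
pose J : set R := `[x - r / 2, x + r / 2]%classic.
have mJ : measurable J by exact: measurable_itv.
have muJ : mu J = r%:E.
  rewrite /J lebesgue_measure_itv/= lte_fin (_ : x - r / 2 < x + r / 2); last by lra.
  by rewrite -EFinB; congr EFin; lra.
pose c := u x / 2.
have : ((c * r)%:E <= \int[mu]_x (u x)%:E)%E.
  apply: (@le_trans _ _ (\int[mu]_(y in J) c%:E)%E).
    by rewrite integral_cst// [X in (_ * X)%E]muJ EFinM.
  apply: (@le_trans _ _ (\int[mu]_(y in J) (u y)%:E)%E).
    apply: ge0_le_int => //; first by move=> y _; rewrite ltW.
    move=> y; rewrite /J/= in_itv/= => /andP[h1 h2].
    have : `|u x - u y| < u x / 2.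
      by apply: Hr; rewrite /ball/= ltr_norml; apply/andP; split; lra.
    by rewrite ltr_norml /c => /andP[_]; lra.
  exact: ge0_subset_int.
rewrite -EFin_Rint// iu lee_fin leNgt mulr_gt0//.
Qed.

Lemma gspan_summable N M d D h : gspan N d D -> 0 <= M -> measurable_fun setT h ->
  (forall x, `|h x| <= M * gauss (- N) x) -> summable (fun x => h x * d x).
Proof.
move=> dD M0 mh hM; have split_gauss s y : gauss (- N) y * gauss s y = gauss (s - N) y.
  by rewrite gaussM (addrC _ s).
have mgauss s : measurable_fun setT (gauss s) by exact: measurable_gauss.
elim: dD => [c s Ns s0|c s Ns s0|d' D' e E _ h1 _ h2].
- have sN : 0 < s - N by rewrite subr_gt0.
  apply: le_summable (summableZ (M * `|c|) (summable_gauss nu_gt0 sN)).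
    by apply: measurable_funM => //; apply: measurable_funM.
  move=> y; rewrite (normrM (h y)) (normrM c) (ger0_norm (gauss_ge0 _ _ _)) -split_gauss.
  rewrite (_ : M * `|c| * (gauss (- N) y * gauss s y) =
    M * gauss (- N) y * (`|c| * gauss s y)); last by ring.
  by rewrite ler_wpM2r// mulr_ge0 ?gauss_ge0.
- have sN : 0 < s - N by rewrite subr_gt0.
  have [h1 _] := Rint_theta_gauss nu_gt0 sN.
  have mtheta : measurable_fun setT theta.
    by apply: continuous_measurable_fun; exact: continuous_theta.
  apply: le_summable (summableZ (M * `|c|) (summable_norm h1)).
    by apply: measurable_funM => //; do 2 apply: measurable_funM => //.
  move=> y; rewrite (normrM (h y)) (normrM c) !(normrM (theta y)) !(ger0_norm (gauss_ge0 _ _ _)).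
  rewrite -split_gauss (_ : M * `|c| * (`|theta y| * (gauss (- N) y * gauss s y)) =
    M * gauss (- N) y * (`|c| * (`|theta y| * gauss s y))); last by ring.
  by rewrite ler_wpM2r// mulr_ge0// mulr_ge0 ?gauss_ge0.
- by have := summableD h1 h2; congr summable; apply/funext => y; rewrite mulrDr.
Qed.

(** A function orthogonal to all narrow Gaussians is orthogonal to the products of
    itself and nonnegative bumps avoiding the origin, as these are limits of
    Gaussians; so its square vanishes off the origin, and by continuity at it. *)
Lemma gspan_uniqueness (N : nat) h M : continuous h -> 0 <= M ->
  (forall x, `|h x| <= M * gauss (- N%:R) x) ->
  (forall d D, gspan N%:R d D -> \int[mu]_x (h x * d x) = 0) ->
  forall x, h x = 0.
Proof.
move=> ch M0 hM hd.
have mh := continuous_measurable_fun ch.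
pose wt x := (1 + `|theta x|) * gauss N.+1%:R x.
have wt0 x : 0 <= wt x by rewrite mulr_ge0 ?gauss_ge0// addr_ge0.
have mtheta : measurable_fun setT theta.
  by apply: continuous_measurable_fun; exact: continuous_theta.
have hwt x : `|h x| * wt x <= M * ((1 + `|theta x|) * gauss 1 x).
  have e : gauss (- N%:R) x * gauss N.+1%:R x = gauss 1 x.
    by rewrite gaussM (_ : - N%:R + N.+1%:R = 1 :> R)// -natr1; ring.
  rewrite -e /wt mulrCA; apply: le_trans (ler_wpM2l _ (ler_wpM2r (gauss_ge0 _ _ _) (hM x))) _.
    by rewrite addr_ge0.
  by rewrite le_eqVlt; apply/orP; left; apply/eqP; ring.
have swt : summable (fun x => M * ((1 + `|theta x|) * gauss 1 x)).
  apply: summableZ; have [h1 _] := Rint_theta_gauss nu_gt0 ltr01.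
  have := summableD (summable_gauss nu_gt0 ltr01) (summable_norm h1).
  congr summable; apply/funext => x.
  by rewrite (normrM (theta x)) (ger0_norm (gauss_ge0 _ _ _)); ring.
have mgauss s : measurable_fun setT (gauss s) by exact: measurable_gauss.
have mwt : measurable_fun setT wt.
  apply: measurable_funM => //; apply: measurable_funD => //.
  exact: measurableT_comp.
have shwt : summable (fun x => `|h x| * wt x).
  apply: le_summable swt; first by apply: measurable_funM => //; exact: measurableT_comp.
  by move=> x; rewrite ger0_norm// mulr_ge0.
have nonzero x : x != 0 -> h x = 0.
  move=> x0; have nx0 : 0 < `|x| by rewrite normr_gt0.
  (* A bump at [|x|], the positive part of a tent of half-width [|x| / 2]. *)
  pose v y := 1 - 2 / `|x| * `| `|y| - `|x| |.
  pose chi y := (v y + `|v y|) / 2.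
  have cv : continuous v.
    move=> y; apply: cvgB; first exact: cvg_cst.
    apply: cvgMr; apply: cvg_norm; apply: cvgB; last exact: cvg_cst.
    exact: norm_continuous.
  have cchi : continuous chi.
    by move=> y; apply: cvgMl; apply: cvgD; [exact: cv | apply: cvg_norm; exact: cv].
  have chi0 y : 0 <= chi y.
    by rewrite /chi; have := ler_norm (- v y); rewrite normrN; lra.
  have chix : chi x = 1 by rewrite /chi /v subrr normr0 mulr0 subr0 normr1; lra.
  pose f y := h y * chi y.
  have cf : continuous f by move=> y; apply: cvgM; [exact: ch | exact: cchi].
  have af : annular f.
    exists (`|x| / 2), (`|x| * (3 / 2)); split; first by rewrite divr_gt0.
    move=> y; apply: contra_neqT => out; rewrite /f.
    suff -> : chi y = 0 by rewrite mulr0.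
    have : `|x| / 2 < `| `|y| - `|x| |.
      rewrite ltNge; apply: contra out; rewrite ler_norml => /andP[h1 h2].
      by apply/andP; split; lra.
    rewrite -subr_gt0 => hv.
    have v0 : v y <= 0.
      rewrite /v subr_le0 -ler_pdivrMl ?divr_gt0// mulr1 invf_div; lra.
    by rewrite /chi ler0_norm// subrr mul0r.
  have shf_d e d D : 0 < e -> gspan N%:R d D -> (forall y, `|f y - d y| <= e * wt y) ->
      summable (fun y => h y * (f y - d y)) /\
      `|\int[mu]_y (h y * (f y - d y))| <= e * \int[mu]_y (`|h y| * wt y).
    move=> e0 dD fd; have [cd _] := gspan_continuous nu_gt0 dD.
    have mk : measurable_fun setT (fun y => h y * (f y - d y)).
      by apply: continuous_measurable_fun => y; apply: cvgM; [exact: ch | apply: cvgB; [exact: cf | exact: cd]].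
    have bnd y : `|h y * (f y - d y)| <= e * (`|h y| * wt y).
      by rewrite normrM mulrCA ler_wpM2l.
    split; first by apply: le_summable bnd _ => //; exact: summableZ.
    by rewrite -RintZ//; apply: ler_norm_Rint => //; exact: summableZ.
  have shd d D (dD : gspan N%:R d D) := gspan_summable dD M0 mh hM.
  have hf_eq0 : summable (fun y => h y * f y) /\ \int[mu]_y (h y * f y) = 0.
    have hf e : 0 < e -> summable (fun y => h y * f y) /\
        `|\int[mu]_y (h y * f y)| <= e * \int[mu]_y (`|h y| * wt y).
      move=> e0; have [d [D [dD fd]]] := annular_approx nu_gt0 N cf af e0.
      have [s1 i1] := shf_d e d D e0 dD fd; have s2 := shd d D dD.
      have eq y : h y * f y = h y * (f y - d y) + h y * d y by ring.
      split; first by rewrite (funext eq); exact: summableD.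
      by rewrite (eq_Rint eq) RintD// (hd d D dD) addr0.
    have [s1 _] := hf 1 ltr01; split => //; apply/eqP; rewrite -normr_le0.
    apply: (@le_of_le_add_eps _ _ _ (\int[mu]_y (`|h y| * wt y))).
      by apply: Rintegral_ge0 => y _; rewrite mulr_ge0.
    by move=> e /andP[e0 _]; rewrite add0r; have [] := hf e e0.
  have := @Rint_eq0_continuous (fun y => h y * f y) _ _ hf_eq0.1 hf_eq0.2 x.
  rewrite {3}/f chix mulr1 => H; apply/eqP; rewrite -sqrf_eq0 expr2; apply/eqP/H.
    by move=> y; apply: cvgM; [exact: ch | exact: cf].
  by move=> y; rewrite /f mulrA mulr_ge0// -expr2 sqr_ge0.
move=> x; have [->|x0] := eqVneq x 0; last exact: nonzero.
have c1 : h y @[y --> 0^'] --> h 0 by apply: cvg_within_filter; exact: ch.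
have c2 : h y @[y --> 0^'] --> (0 : R).
  apply: (@cvg_trans _ ((fun=> 0 : R) y @[y --> 0^'])); last exact: cvg_cst.
  by apply: near_eq_cvg; rewrite near_withinE; apply: nearW => y y0; rewrite nonzero.
exact: (cvg_unique _ c1 c2).
Qed.

End gaussian_uniqueness.


(** * The heat kernel *)
Section heat_kernel.
Context {R : realType} (nu : R) (nu_gt0 : 0 < nu) (t : R) (t_gt0 : 0 < t).
Local Notation mu := (@lebesgue_measure R).
Local Notation g := (nu + 2).
Local Notation gauss := (gauss g).
Local Notation beta := (g^-1).
Local Notation beta' := (2 - g^-1).
Local Notation al := ((nu + 1) / (nu + 2)).
Local Notation k0 := ((g ^+ 2)^-1).
Local Notation theta := (theta nu).
Local Notation kern := (kern nu).
Local Notation gspan := (gspan nu).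
Local Notation C := (plancherel_const nu).
Implicit Types (q s x y : R).

Let g_gt0 : 0 < g. Proof. by rewrite addr_gt0. Qed.
Let g_gt1 : 1 < g. Proof. by rewrite (@lt_trans _ _ 2) ?ltr1n// ltrDr. Qed.
Let g_neq0 : g != 0. Proof. by rewrite gt_eqF. Qed.

(** The Gaussians [gauss heat_rate] are the exponential factors of the kernel. *)
Definition heat_rate : R := 2 * k0 / t.
Local Notation r := heat_rate.

Let r_gt0 : 0 < r. Proof. by rewrite divr_gt0// mulr_gt0// k0_gt0. Qed.

(** The heat kernel as an entire expression in the powers [g] of the variables,
    regular across the axes. *)
Definition heat_closed x y : R := gauss r x * gauss r y / (t * g) *
  (r `^ (- al) * Psi beta (r ^+ 2 * `|x| `^ g * `|y| `^ g) +
   r `^ al * (theta x * theta y) * Psi beta' (r ^+ 2 * `|x| `^ g * `|y| `^ g)).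

Lemma heat_kernel_formulaE x y : x * y != 0 ->
  heat_kernel_formula nu t (x, y) = heat_closed x y.
Proof.
move=> xy0; have n0 := nu_gt0; have b0 := beta_gt0 nu_gt0.
have nxy : 0 < `|x * y| by rewrite normr_gt0.
rewrite /heat_kernel_formula.
have h2 : nu / 2 + 1 = g / 2 by field.
set z := `|x * y| `^ (nu / 2 + 1) / _.
have zE : z / 2 = r * `|x * y| `^ (g / 2).
  by rewrite /z h2 /heat_rate; field; rewrite g_neq0 gt_eqF.
have z0 : 0 < z.
  by rewrite divr_gt0 ?powR_gt0// mulr_gt0// exprn_gt0// h2 divr_gt0.
have sqE : (z / 2) ^+ 2 = r ^+ 2 * `|x| `^ g * `|y| `^ g.
  rewrite zE exprMn -(powR_mulrn 2 (powR_ge0 _ _)) -powRrM -[RHS]mulrA -normM_powR.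
  by congr (_ * _ `^ _); field.
have powz p : (z / 2) `^ p = r `^ p * `|x * y| `^ (g / 2 * p).
  by rewrite zE powRM ?powR_ge0 ?(ltW r_gt0)// -powRrM.
have alp : 0 < al by rewrite divr_gt0//; lra.
have al1 : al < 1 by rewrite (alE nu_gt0); lra.
rewrite besselI_Psi//; last by lra.
rewrite besselI_Psi//; last by lra.
have -> : - al + 1 = beta by rewrite (alE nu_gt0); ring.
have -> : al + 1 = beta' by rewrite (alE nu_gt0); ring.
rewrite sqE !powz.
have e1 : `|x * y| `^ ((nu + 1) / 2) * `|x * y| `^ (g / 2 * - al) = 1.
  rewrite -powRD; last by rewrite (gt_eqF nxy) implybT.
  by rewrite (_ : _ + _ = 0) ?powRr0//; field.
have e2 : Num.sg (x * y) * (`|x * y| `^ ((nu + 1) / 2) * `|x * y| `^ (g / 2 * al)) =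
    theta x * theta y.
  rewrite -powRD; last by rewrite (gt_eqF nxy) implybT.
  by rewrite -thetaM (sgr_theta nu_gt0); congr (_ * _ `^ _); field.
have e3 : expR (- ((`|x| `^ g + `|y| `^ g) / (2 * t * (nu / 2 + 1) ^+ 2))) =
    gauss r x * gauss r y.
  rewrite !gaussE -expRD; congr expR; rewrite /heat_rate h2.
  by field; rewrite g_neq0 gt_eqF.
rewrite e3 /heat_closed -e2.
move: e1; set P := `|x * y| `^ ((nu + 1) / 2); set Q := _ `^ (g / 2 * - al) => e1.
set S := _ `^ (g / 2 * al).
move: (Psi _ _) (Psi _ _) (r `^ _) (r `^ _) (gauss r x) (gauss r y) (Num.sg _) => p2 p1 rb ra g1 g2 sg.
have -> : P / (t * g) * (g1 * g2) * (ra * Q * p1 + sg * (rb * S * p2)) =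
    g1 * g2 / (t * g) * (ra * p1 * (P * Q) + rb * (sg * (P * S)) * p2) by ring.
by rewrite e1 mulr1.
Qed.

Let heat_closed_joint (p : R * R) : heat_closed q.1 q.2 @[q --> p] --> heat_closed p.1 p.2.
Proof.
have c1 (f : R -> R) : continuous f -> f q.1 @[q --> p] --> f p.1.
  by move=> cf; apply: (cvg_comp fst f); [exact: cvg_fst | exact: cf].
have c2 (f : R -> R) : continuous f -> f q.2 @[q --> p] --> f p.2.
  by move=> cf; apply: (cvg_comp snd f); [exact: cvg_snd | exact: cf].
have cg : continuous (gauss r) by exact: (continuous_gauss g_gt1).
have cp : continuous (fun x : R => `|x| `^ g) by exact: (continuous_powR_norm (ltW g_gt0)).
have cP b : 0 < b -> Psi b (r ^+ 2 * `|q.1| `^ g * `|q.2| `^ g) @[q --> p] -->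
    Psi b (r ^+ 2 * `|p.1| `^ g * `|p.2| `^ g).
  move=> b0; apply: (cvg_comp (fun q : R * R => r ^+ 2 * `|q.1| `^ g * `|q.2| `^ g) (Psi b)).
    by apply: cvgM; [apply: cvgMr; exact: (c1 _ cp) | exact: (c2 _ cp)].
  exact: Psi_continuous.
apply: cvgM; first by apply: cvgMl; apply: cvgM; [exact: c1 | exact: c2].
apply: cvgD; first by apply: cvgMr; apply: cP; exact: beta_gt0.
apply: cvgM; last by apply: cP; exact: beta'_gt0.
by apply: cvgMr; apply: cvgM; [apply: c1 | apply: c2]; exact: continuous_theta.
Qed.

Let off_axes_proper (p : R * R) : ProperFilter (within [set q : R * R | q.1 * q.2 != 0] (nbhs p)).
Proof.
apply: Build_ProperFilter_ex => P; rewrite /within/= => /nbhs_ballP[e /= e0 He].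
have near_nz (a : R) : exists2 b, b != 0 & `|a - b| < e.
  have [->|a0] := eqVneq a 0; last by exists a; rewrite ?subrr ?normr0.
  by exists (e / 2); rewrite ?gt_eqF ?divr_gt0// sub0r normrN gtr0_norm ?divr_gt0//; lra.
have [b1 b10 h1] := near_nz p.1; have [b2 b20 h2] := near_nz p.2.
by exists (b1, b2); apply: He => //=; rewrite mulf_neq0.
Qed.

(** The closed form is continuous on the plane, and the complement of the axes is
    dense; so it is the continuous extension of the formula. *)
Lemma heat_kernelE x y : heat_kernel nu t x y = heat_closed x y.
Proof.
rewrite /heat_kernel /continuous_extension; case: ifPn => [|_].
  by rewrite inE/= => xy; exact: heat_kernel_formulaE.
have PF := off_axes_proper (x, y).
apply: (@cvg_lim _ (@Rhausdorff R) _ _ PF).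
apply: (@cvg_trans _ (heat_closed q.1 q.2 @[q --> within [set q : R * R | q.1 * q.2 != 0] (nbhs (x, y))])).
  apply: near_eq_cvg; rewrite near_withinE; apply: nearW => -[a b] ab.
  by rewrite (heat_kernel_formulaE ab).
by apply: cvg_within_filter; exact: heat_closed_joint.
Qed.

Lemma continuous_heat_closed x : continuous (heat_closed x).
Proof.
move=> y; have pair_cvg : (x, z) @[z --> y] --> (x, y).
  by apply: (@cvg_pair _ _ _ _ (nbhs x) (nbhs y)); [exact: cvg_cst | exact: cvg_id].
have h := cvg_comp (fun z => (x, z)) (fun p : R * R => heat_closed p.1 p.2) pair_cvg (@heat_closed_joint (x, y)).
exact: h.
Qed.

Let heat_half_order x : half_order nu (heat_closed x).
Proof.
have hg : half_order nu (gauss r).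
  exists 1, 1; split => // y; rewrite mul1r mul1r ger0_norm ?gauss_ge0// gaussE.
  rewrite ler_expR; apply: (@le_trans _ _ 0); last exact: powR_ge0.
  by rewrite oppr_le0 mulr_ge0 ?powR_ge0// ltW.
have b0 := beta_gt0 nu_gt0; have b'0 := beta'_gt0 nu_gt0.
have ho a : half_order nu (fun=> a) by exact: half_order_cst.
have hP b : 0 < b -> half_order nu (fun y => Psi b (r ^+ 2 * `|x| `^ g * `|y| `^ g)).
  by move=> bp; exact: half_order_Psi.
apply: (half_orderM (half_orderM (half_orderM (ho _) hg) (ho _))).
apply: (half_orderD (half_orderM (ho _) (hP _ b0))).
apply: (half_orderM _ (hP _ b'0)).
by apply: (half_orderM (ho _)); apply: (half_orderM (ho _)); exact: half_order_theta.
Qed.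

(** The spectral integral, with the real kernel: after symmetrization in [q] it is the
    complex one. *)
Definition heat_integrand x y q : R := gauss (t / 2) q * (kern (q * x) * kern (q * y)).
Definition heat_spectral x y : R := \int[mu]_q heat_integrand x y q.

Let measurable_kern : measurable_fun setT kern.
Proof. by apply: continuous_measurable_fun; exact: continuous_kern. Qed.

Let measurable_gauss' s : measurable_fun setT (gauss s).
Proof. exact: measurable_gauss. Qed.

Let measurable_kern_dilate x : measurable_fun setT (fun q : R => kern (q * x)).
Proof. by apply: measurableT_comp => //; exact: measurable_funM. Qed.

(** The growth of the kernels is shared between the variables by [half_order_dilate]:
    in [q] it costs only half of the decay of [gauss (t / 2)]. *)
Lemma heat_integrand_bound : exists M B, [/\ 0 <= M, 0 < B & forall x y q,
  `|heat_integrand x y q| <= M * gauss (- B) x * gauss (- B) y * gauss (t / 4) q].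
Proof.
have [M [kap [M0 k00 H]]] := half_order_dilate (half_order_kern nu_gt0).
have t8 : 0 < t / 8 by rewrite divr_gt0.
have B0 : 0 < kap / (t / 8) by rewrite divr_gt0.
have AB : kap <= t / 8 * (kap / (t / 8)) by rewrite mulrC divfK ?gt_eqF.
exists (M ^+ 2), (kap / (t / 8)); split => [||x y q]//; first exact: sqr_ge0.
have h1 := H _ _ t8 B0 AB q x; have h2 := H _ _ t8 B0 AB q y.
rewrite /heat_integrand normrM (ger0_norm (gauss_ge0 _ _ _)) normrM.
apply: le_trans (ler_wpM2l (gauss_ge0 _ _ _) (ler_pM _ _ h1 h2)) _ => //.
have e : gauss (t / 2) q * (gauss (- (t / 8)) q * gauss (- (t / 8)) q) = gauss (t / 4) q.
  rewrite !gaussM (_ : t / 2 + (- (t / 8) + - (t / 8)) = t / 4)//; by field.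
rewrite -e le_eqVlt; apply/orP; left; apply/eqP.
move: (gauss _ _) (gauss _ _) (gauss _ _) (gauss _ _) => *; ring.
Qed.

Lemma measurable_heat_integrand x y : measurable_fun setT (heat_integrand x y).
Proof. by apply: measurable_funM => //; apply: measurable_funM. Qed.

Lemma summable_heat_integrand x y : summable (heat_integrand x y).
Proof.
have [M [B [M0 B0 H]]] := heat_integrand_bound.
have t4 : 0 < t / 4 by rewrite divr_gt0.
apply: le_summable (H x y) (summableZ _ (summable_gauss nu_gt0 t4)).
exact: measurable_heat_integrand.
Qed.

Lemma heat_spectral_bound M B x y : (forall x y q,
    `|heat_integrand x y q| <= M * gauss (- B) x * gauss (- B) y * gauss (t / 4) q) ->
  `|heat_spectral x y| <=
  M * gauss (- B) x * gauss (- B) y * \int[mu]_q gauss (t / 4) q.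
Proof.
move=> H; have t4 : 0 < t / 4 by rewrite divr_gt0.
have sg := summable_gauss nu_gt0 t4.
rewrite -RintZ//; apply: ler_norm_Rint (H x y).
  exact: measurable_heat_integrand.
exact: summableZ.
Qed.

Lemma continuous_heat_spectral x : continuous (heat_spectral x).
Proof.
move=> y0; have [M [B [M0 B0 H]]] := heat_integrand_bound.
have t4 : 0 < t / 4 by rewrite divr_gt0.
pose c := M * gauss (- B) x * expR (B * (`|y0| + 1) `^ g).
have gB y : y \in `]y0 - 1, y0 + 1[ -> gauss (- B) y <= expR (B * (`|y0| + 1) `^ g).
  rewrite in_itv/= => /andP[h1 h2]; rewrite gaussE mulNr opprK ler_expR.
  rewrite ler_wpM2l ?(ltW B0)// ge0_ler_powR ?(ltW g_gt0)// ?nnegrE ?addr_ge0//.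
  have : `|y - y0| <= 1 by rewrite ler_norml; apply/andP; split; lra.
  by have := ler_normD (y - y0) y0; rewrite subrK; lra.
have := @continuity_under_integral R _ _ mu (fun y q => heat_integrand x y q) setT
  measurableT (y0 - 1) (y0 + 1) _ _ (fun q => c * gauss (t / 4) q).
move=> /(_ _ _ _ _ y0); apply.
- by move=> y _; exact: summable_heat_integrand.
- apply: aeW => q _ y _; apply: cvgMr; apply: cvgMr.
  apply: (cvg_comp (fun y => q * y) kern); first by apply: cvgMr; exact: cvg_id.
  exact: continuous_kern.
- by apply: summableZ; exact: summable_gauss.
- move=> y yI; apply: aeW => q _; apply: le_trans (H x y q) _.
  rewrite ler_wpM2r ?gauss_ge0// ler_wpM2l ?mulr_ge0 ?gauss_ge0//.
  exact: gB.
- by rewrite inE/= in_itv/= ltrBlDr ltrDl ltr01.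
Qed.

(** Fubini's theorem, then the transform of [d]. *)
Lemma heat_spectral_gspan M B N d D x : 0 <= M -> (forall x y q,
    `|heat_integrand x y q| <= M * gauss (- B) x * gauss (- B) y * gauss (t / 4) q) ->
  gspan N d D -> summable (fun y => gauss (- B) y * `|d y|) ->
  summable (fun y => heat_spectral x y * d y) /\
  \int[mu]_y (heat_spectral x y * d y) =
  \int[mu]_q (kern (q * x) * (gauss (t / 2) q * D q)).
Proof.
move=> M0 H dD sd; have [cd _] := gspan_continuous nu_gt0 dD.
have md := continuous_measurable_fun cd.
have t4 : 0 < t / 4 by rewrite divr_gt0.
pose F q y := heat_integrand x y q * d y.
have mF : measurable_fun setT (fun p : R * R => F p.1 p.2).
  have m1 f : measurable_fun setT f -> measurable_fun setT (fun p : R * R => f p.1 : R).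
    by move=> mf; exact: (measurableT_comp mf measurable_fst).
  have m2 f : measurable_fun setT f -> measurable_fun setT (fun p : R * R => f p.2 : R).
    by move=> mf; exact: (measurableT_comp mf measurable_snd).
  apply: measurable_funM; last exact: m2.
  apply: measurable_funM; first exact: m1.
  apply: measurable_funM; first exact: (m1 _ (measurable_kern_dilate x)).
  apply: (measurableT_comp measurable_kern).
  by apply: measurable_funM; [exact: measurable_fst | exact: measurable_snd].
have bnd q y : `|F q y| <= M * gauss (- B) x * gauss (t / 4) q * (gauss (- B) y * `|d y|).
  rewrite normrM; apply: le_trans (ler_wpM2r _ (H x y q)) _ => //.
  rewrite le_eqVlt; apply/orP; left; apply/eqP.
  by move: (gauss _ _) (gauss _ _) (gauss _ _) => *; ring.
have [s1 s2 e] := Rint_fubini mF (summableZ (M * gauss (- B) x) (summable_gauss nu_gt0 t4)) sd bnd.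
have inner y : \int[mu]_q F q y = heat_spectral x y * d y.
  rewrite /F mulrC -RintZ; last exact: summable_heat_integrand.
  by apply: eq_Rint => q; rewrite mulrC.
have outer q : \int[mu]_y F q y = kern (q * x) * (gauss (t / 2) q * D q).
  have [h1 h2] := gspan_transform nu_gt0 dD q.
  rewrite mulrA -h2 -RintZ//; apply: eq_Rint => y.
  by rewrite /F /heat_integrand; ring.
rewrite -(funext inner); split => //.
by rewrite -e; apply: eq_Rint => q; exact: outer.
Qed.

Let w x : R := r ^+ 2 * `|x| `^ g.

(* The exponents of [|x| ^ g] agree because [k0 = heat_rate * t / 2]. *)
Let eigen_shift x s b : 0 < s -> (t / 2) `^ (- b) * ((s + r) `^ (- b) *
    (gauss r x * expR (w x / (s + r)))) =
  s `^ (- b) * ((t / 2 + k0 / s) `^ (- b) * gauss (k0 / (t / 2 + k0 / s)) x).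
Proof.
move=> s0; have sr0 : 0 < s + r by rewrite addr_gt0.
have t2 : 0 < t / 2 by rewrite divr_gt0.
have k0E : k0 = r * (t / 2).
  by rewrite /heat_rate; field; rewrite g_neq0 gt_eqF.
have sumE : t / 2 + k0 / s = t / 2 * (s + r) / s.
  by rewrite k0E; field; rewrite gt_eqF.
have -> : gauss r x * expR (w x / (s + r)) = gauss (k0 / (t / 2 + k0 / s)) x.
  rewrite !gaussE -expRD; congr expR; rewrite sumE /w k0E.
  by field; rewrite !gt_eqF.
rewrite sumE; move: (gauss (k0 / _) x) => G.
rewrite [(_ / s) `^ _]powRM ?mulr_ge0 ?invr_ge0 ?(ltW t_gt0) ?(ltW t2) ?(ltW sr0) ?(ltW s0)//.
rewrite [(t / 2 * _) `^ _]powRM ?mulr_ge0 ?(ltW t_gt0) ?(ltW t2) ?(ltW sr0)//.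
rewrite -[s^-1]powR_inv1 ?(ltW s0)// -powRrM mulN1r opprK.
have e : s `^ (- b) * s `^ b = 1.
  rewrite -powRD; last by rewrite (gt_eqF s0) implybT.
  by rewrite addNr powRr0.
move: e; move: (s `^ _) (s `^ _) => v u e.
transitivity (u * v * ((t / 2) `^ (- b) * ((s + r) `^ (- b) * G))).
  by rewrite e mul1r.
by move: (_ `^ _) (_ `^ _) => *; ring.
Qed.

Let heat_const b e : e ^+ 2 * k0 `^ (- b) = C ->
  C * (r `^ (b - 1) * (2 / g) / (t * g)) = e ^+ 2 * (t / 2) `^ (- b).
Proof.
have t2 : 0 < t / 2 by rewrite divr_gt0.
move=> <-; have -> : k0 `^ (- b) = r `^ (- b) * (t / 2) `^ (- b).
  rewrite -powRM ?(ltW r_gt0) ?(ltW t2)//; congr (_ `^ _).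
  by rewrite /heat_rate; field; rewrite g_neq0 gt_eqF.
have rV : r `^ (- b) * r `^ (b - 1) = r^-1.
  rewrite -powRD; last by rewrite (gt_eqF r_gt0) implybT.
  by rewrite (_ : - b + (b - 1) = -1) ?powR_inv1 ?(ltW r_gt0)//; ring.
transitivity (e ^+ 2 * (t / 2) `^ (- b) * (r `^ (- b) * r `^ (b - 1) * (2 / g / (t * g)))).
  by move: (_ `^ _) (_ `^ _) (_ `^ _) => *; ring.
rewrite rV -[RHS]mulr1; congr (_ * _).
by rewrite /heat_rate; field; rewrite g_neq0 gt_eqF.
Qed.

Let const_even : C * (r `^ (- al) * (2 / g) / (t * g)) =
  eigen_even nu ^+ 2 * (t / 2) `^ (- beta).
Proof.
by rewrite -(heat_const (eigen_even_sqr nu_gt0)) (_ : - al = beta - 1)// (alE nu_gt0); ring.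
Qed.

Let const_odd : C * (r `^ al * (2 / g) / (t * g)) =
  eigen_odd nu ^+ 2 * (t / 2) `^ (- beta').
Proof.
by rewrite -(heat_const (eigen_odd_sqr nu_gt0)) (_ : al = beta' - 1)// (alE nu_gt0); ring.
Qed.

Let half_order_cross x : half_order nu (fun y => theta y * Psi beta' (w x * `|y| `^ g)).
Proof.
by apply: half_orderM; [exact: half_order_theta | apply: half_order_Psi; exact: beta'_gt0].
Qed.

(** Closed form and spectral form agree against Gaussians: both reduce to the
    integral of [Psi] against a Gaussian. *)
Lemma heat_closed_gspan N d D x : gspan N d D ->
  [/\ summable (fun y => heat_closed x y * d y),
      summable (fun q => kern (q * x) * (gauss (t / 2) q * D q)) &
      C * \int[mu]_y (heat_closed x y * d y) =
      \int[mu]_q (kern (q * x) * (gauss (t / 2) q * D q))].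
Proof.
have b0 := beta_gt0 nu_gt0; have b'0 := beta'_gt0 nu_gt0.
have t2 : 0 < t / 2 by rewrite divr_gt0.
elim => [c s Ns s0|c s Ns s0|d' D' e E _ [h1 h2 h3] _ [h4 h5 h6]].
- have sr0 : 0 < s + r by rewrite addr_gt0.
  have ks0 : 0 < t / 2 + k0 / s by rewrite addr_gt0// divr_gt0// k0_gt0.
  have [k1 k2] := kern_gauss nu_gt0 x ks0.
  have [p1 p2] := Psi_gauss_integral g_gt1 (lexx 0) (w x) sr0.
  rewrite add0r div1r in p1 p2.
  pose K1 := c * gauss r x / (t * g) * r `^ (- al).
  pose K2 := c * gauss r x / (t * g) * r `^ al * theta x.
  have o1 : summable (fun y => theta y * Psi beta' (w x * `|y| `^ g) * gauss (s + r) y).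
    have cc : continuous (fun y => theta y * Psi beta' (w x * `|y| `^ g)).
      by move=> y; apply: cvgM; [exact: continuous_theta | exact: continuous_Psi_radial].
    have := half_order_gauss nu_gt0 (half_order_cross x) cc 1 sr0.
    by congr summable; apply/funext => y; rewrite mul1r.
  have i1 : \int[mu]_y (theta y * Psi beta' (w x * `|y| `^ g) * gauss (s + r) y) = 0.
    apply: Rint_odd => //; first exact: summable_measurable.
    by move=> y; rewrite thetaN normrN gaussN !mulNr.
  have eq y : heat_closed x y * (c * gauss s y) =
      K1 * (`|y| `^ 0 * Psi beta (w x * `|y| `^ g) * gauss (s + r) y) +
      K2 * (theta y * Psi beta' (w x * `|y| `^ g) * gauss (s + r) y).
    rewrite powRr0 mul1r -(gaussM _ s r) /K1 /K2 /heat_closed -/(w x).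
    by move: (gauss _ _) (gauss _ _) (gauss _ _) (Psi _ _) (Psi _ _) => *; ring.
  have eq2 q : kern (q * x) * (gauss (t / 2) q * (c * (eigen_even nu * s `^ (- beta) * gauss (k0 / s) q))) =
      c * (eigen_even nu * s `^ (- beta)) * (kern (x * q) * gauss (t / 2 + k0 / s) q).
    rewrite -(gaussM _ (t / 2)) (mulrC q).
    by move: (gauss _ _) (gauss _ _) (kern _) => *; ring.
  split.
  + by rewrite (funext eq); apply: summableD; exact: summableZ.
  + by rewrite (funext eq2); exact: summableZ.
  rewrite (eq_Rint eq) (eq_Rint eq2) RintD; [|exact: summableZ|exact: summableZ].
  rewrite !RintZ// i1 mulr0 addr0 k2 p2.
  transitivity (C * (r `^ (- al) * (2 / g) / (t * g)) * c *
      ((s + r) `^ (- beta) * (gauss r x * expR (w x / (s + r))))).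
    by rewrite /K1; move: (gauss _ _) (expR _) (_ `^ _) (_ `^ _) => *; ring.
  rewrite const_even.
  transitivity (eigen_even nu ^+ 2 * c * ((t / 2) `^ (- beta) * ((s + r) `^ (- beta) *
      (gauss r x * expR (w x / (s + r)))))); first by ring.
  rewrite eigen_shift//; ring.
- have sr0 : 0 < s + r by rewrite addr_gt0.
  have ks0 : 0 < t / 2 + k0 / s by rewrite addr_gt0// divr_gt0// k0_gt0.
  have [k1 k2] := kern_theta_gauss nu_gt0 x ks0.
  have p0 : 0 <= 2 * nu + 2 by rewrite addr_ge0// mulr_ge0// ltW.
  have [p1 p2] := Psi_gauss_integral g_gt1 p0 (w x) sr0.
  rewrite (beta'E nu_gt0) in p1 p2.
  pose K1 := c * gauss r x / (t * g) * r `^ (- al).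
  pose K2 := c * gauss r x / (t * g) * r `^ al * theta x.
  have o1 : summable (fun y => theta y * Psi beta (w x * `|y| `^ g) * gauss (s + r) y).
    have hc : half_order nu (fun y => theta y * Psi beta (w x * `|y| `^ g)).
      by apply: half_orderM; [exact: half_order_theta | exact: half_order_Psi].
    have cc : continuous (fun y => theta y * Psi beta (w x * `|y| `^ g)).
      by move=> y; apply: cvgM; [exact: continuous_theta | exact: continuous_Psi_radial].
    have := half_order_gauss nu_gt0 hc cc 1 sr0.
    by congr summable; apply/funext => y; rewrite mul1r.
  have i1 : \int[mu]_y (theta y * Psi beta (w x * `|y| `^ g) * gauss (s + r) y) = 0.
    apply: Rint_odd => //; first exact: summable_measurable.
    by move=> y; rewrite thetaN normrN gaussN !mulNr.
  have eq y : heat_closed x y * (c * (theta y * gauss s y)) =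
      K1 * (theta y * Psi beta (w x * `|y| `^ g) * gauss (s + r) y) +
      K2 * (`|y| `^ (2 * nu + 2) * Psi beta' (w x * `|y| `^ g) * gauss (s + r) y).
    rewrite -theta_sqr// -(gaussM _ s r) /K1 /K2 /heat_closed -/(w x).
    by move: (gauss _ _) (gauss _ _) (gauss _ _) (Psi _ _) (Psi _ _) => *; ring.
  have eq2 q : kern (q * x) * (gauss (t / 2) q *
      (c * (eigen_odd nu * s `^ (- beta') * (theta q * gauss (k0 / s) q)))) =
      c * (eigen_odd nu * s `^ (- beta')) * (kern (x * q) * (theta q * gauss (t / 2 + k0 / s) q)).
    rewrite -(gaussM _ (t / 2)) (mulrC q).
    by move: (gauss _ _) (gauss _ _) (kern _) => *; ring.
  split.
  + by rewrite (funext eq); apply: summableD; exact: summableZ.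
  + by rewrite (funext eq2); exact: summableZ.
  rewrite (eq_Rint eq) (eq_Rint eq2) RintD; [|exact: summableZ|exact: summableZ].
  rewrite !RintZ// i1 mulr0 add0r k2 p2.
  transitivity (C * (r `^ al * (2 / g) / (t * g)) * c * theta x *
      ((s + r) `^ (- beta') * (gauss r x * expR (w x / (s + r))))).
    by rewrite /K2; move: (gauss _ _) (expR _) (_ `^ _) (_ `^ _) => *; ring.
  rewrite const_odd.
  transitivity (eigen_odd nu ^+ 2 * c * theta x * ((t / 2) `^ (- beta') * ((s + r) `^ (- beta') *
      (gauss r x * expR (w x / (s + r)))))); first by ring.
  rewrite eigen_shift//; ring.
- have eq y : heat_closed x y * (d' y + e y) = heat_closed x y * d' y + heat_closed x y * e y.
    by rewrite mulrDr.
  have eq2 q : kern (q * x) * (gauss (t / 2) q * (D' q + E q)) =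
      kern (q * x) * (gauss (t / 2) q * D' q) + kern (q * x) * (gauss (t / 2) q * E q).
    by ring.
  rewrite (funext eq) (funext eq2); split; [exact: summableD | exact: summableD |].
  by rewrite !RintD// mulrDr h3 h6.
Qed.

(** The difference of the two sides is continuous in [y], grows no faster than the
    inverse of a Gaussian and is orthogonal to all Gaussians narrower than that. *)
Theorem heat_closed_spectral x y : C * heat_closed x y = heat_spectral x y.
Proof.
have C0 := plancherel_const_gt0 nu_gt0.
have [M [B [M0 B0 H]]] := heat_integrand_bound.
have t4 : 0 < t / 4 by rewrite divr_gt0.
have [M' [kap [M'0 kap0 H']]] := half_order_dilate (heat_half_order x).
pose N := (Num.trunc (B + kap)).+1.
have NB : B + kap <= N%:R by exact/ltW/truncnS_gt.
have le_gauss s s' z : s' <= s -> gauss s z <= gauss s' z.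
  by move=> ss; rewrite !gaussE ler_expR lerN2 ler_wpM2r ?powR_ge0.
pose h z := heat_spectral x z - C * heat_closed x z.
pose I := \int[mu]_q gauss (t / 4) q.
have I0 : 0 <= I by apply: Rintegral_ge0 => q _; exact: gauss_ge0.
suff : h y = 0 by move=> /eqP; rewrite subr_eq0 => /eqP.
apply: (@gspan_uniqueness _ nu nu_gt0 N h
  (M * gauss (- B) x * I + C * (M' * gauss (- 1) 1))).
- move=> z; apply: cvgB; first exact: continuous_heat_spectral.
  by apply: cvgMr; exact: continuous_heat_closed.
- apply: addr_ge0; first by rewrite !mulr_ge0 ?gauss_ge0.
  by apply: mulr_ge0 (ltW C0) _; rewrite mulr_ge0 ?gauss_ge0.
- move=> z; apply: le_trans (ler_normB _ _) _; rewrite mulrDl; apply: lerD.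
    apply: le_trans (heat_spectral_bound x z H) _.
    rewrite -/I mulrAC ler_wpM2l ?mulr_ge0 ?gauss_ge0// le_gauss// lerN2.
    by apply: le_trans NB; rewrite lerDl ltW.
  rewrite (normrM C) (gtr0_norm C0) -(mulrA C) -(mulrA M').
  apply: ler_wpM2l; first exact: ltW.
  have := H' 1 kap ltr01 kap0 _ 1 z; rewrite !mul1r => /(_ (lexx _)) h1.
  apply: le_trans h1 _; rewrite !ler_wpM2l ?gauss_ge0// le_gauss// lerN2.
  by apply: le_trans NB; rewrite lerDr ltW.
move=> d D dD.
have sd : summable (fun z => gauss (- B) z * `|d z|).
  have := summable_norm (gspan_summable nu_gt0 dD ler01 (measurable_gauss' (- B)) _).
  have gB z : `|gauss (- B) z| <= 1 * gauss (- N%:R) z.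
    rewrite mul1r ger0_norm ?gauss_ge0// le_gauss// lerN2.
    by apply: le_trans NB; rewrite lerDl ltW.
  move=> /(_ gB); congr summable; apply/funext => z.
  by rewrite normrM (ger0_norm (gauss_ge0 _ _ _)).
have [s1 e1] := heat_spectral_gspan x M0 H dD sd.
have [s2 _ e2] := heat_closed_gspan x dD.
have eq z : h z * d z = heat_spectral x z * d z - C * (heat_closed x z * d z).
  by rewrite /h mulrBl mulrA.
by rewrite (eq_Rint eq) RintB ?RintZ// ?e1 ?e2 ?subrr//; exact: summableZ.
Qed.

End heat_kernel.

(** * Complex square-integrable functions *)
Section complex_L2.
Context {R : realType}.
Local Notation mu := (@lebesgue_measure R).
Local Notation Re := (@complex.Re R).
Local Notation Im := (@complex.Im R).
Implicit Types (f h p : R -> R) (e r q t : R).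

Lemma ReB (z w : R[i]) : Re (z - w) = Re z - Re w. Proof. by case: z w => [a b] [c d]. Qed.
Lemma ImB (z w : R[i]) : Im (z - w) = Im z - Im w. Proof. by case: z w => [a b] [c d]. Qed.

Lemma normc_powR (z : R[i]) :
  (`|(ComplexField.Normc.normc z)%:E| `^ 2)%E = (Re z ^+ 2 + Im z ^+ 2)%:E.
Proof.
case: z => a b /=; have ab : 0 <= a ^+ 2 + b ^+ 2 by rewrite addr_ge0 ?sqr_ge0.
rewrite ger0_norm ?sqrtr_ge0//; congr EFin.
by rewrite (powR_mulrn 2) ?sqrtr_ge0// sqr_sqrtr.
Qed.

Lemma L2norm_sqr (F : R -> R[i]) :
  (L2norm F `^ 2 = \int[mu]_x (Re (F x) ^+ 2 + Im (F x) ^+ 2)%:E)%E.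
Proof.
rewrite /L2norm poweR_Lnorm ?pnatr_eq0//.
by apply: eq_integral => x _; exact: normc_powR.
Qed.

Definition csqsum (F : R -> R[i]) := sqsum (Re \o F) /\ sqsum (Im \o F).
Definition cenergy (F : R -> R[i]) := energy (Re \o F) + energy (Im \o F).

Lemma cenergy_ge0 F : 0 <= cenergy F.
Proof. by rewrite addr_ge0 ?energy_ge0. Qed.

Lemma L2norm_cenergy F : csqsum F -> (L2norm F `^ 2 = (cenergy F)%:E)%E.
Proof.
move=> [s1 s2]; rewrite L2norm_sqr /cenergy -RintD; [|exact: s1.2|exact: s2.2].
by rewrite EFin_Rint//; exact: (summableD s1.2 s2.2).
Qed.

Lemma L2P F : L2 F <-> csqsum F.
Proof.
split=> [[m1 m2 fin]|[s1 s2]].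
  have {}fin : (\int[mu]_x (Re (F x) ^+ 2 + Im (F x) ^+ 2)%:E < +oo)%E.
    rewrite -L2norm_sqr; move: fin (Lnorm_ge0 mu 2%:E (EFin \o (fun x => ComplexField.Normc.normc (F x)))).
    by rewrite -/(L2norm F); case: (L2norm F) => [a||]//= _ _; rewrite ltry.
  have ms : measurable_fun setT (fun x => Re (F x) ^+ 2 + Im (F x) ^+ 2).
    by apply: measurable_funD; exact: measurable_sqr.
  have ss : summable (fun x => Re (F x) ^+ 2 + Im (F x) ^+ 2).
    by apply: summable_ge0 => // x; rewrite addr_ge0 ?sqr_ge0.
  split; split => //; apply: le_summable ss; try exact: measurable_sqr.
    by move=> x; rewrite ger0_norm ?sqr_ge0// lerDl sqr_ge0.
  by move=> x; rewrite ger0_norm ?sqr_ge0// lerDr sqr_ge0.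
split; [exact: s1.1 | exact: s2.1 |].
have := L2norm_cenergy (conj s1 s2).
move: (Lnorm_ge0 mu 2%:E (EFin \o (fun x => ComplexField.Normc.normc (F x)))).
by rewrite -/(L2norm F); case: (L2norm F) => [a||] _; rewrite ?ltry ?ltNyy ?poweRyr ?pnatr_eq0.
Qed.

Lemma L2norm_le F e : csqsum F -> 0 <= e ->
  (L2norm F <= e%:E)%E = (cenergy F <= e ^+ 2).
Proof.
move=> sF e0; have [_ _] := (L2P F).2 sF; have := L2norm_cenergy sF.
move: (Lnorm_ge0 mu 2%:E (EFin \o (fun x => ComplexField.Normc.normc (F x)))).
rewrite -/(L2norm F); case: (L2norm F) => [a||]//=.
rewrite lee_fin => a0 [<-] _.
by rewrite (powR_mulrn 2)// lee_fin ler_sqr.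
Qed.

Lemma csqsumB F G : csqsum F -> csqsum G -> csqsum (fun x => F x - G x).
Proof.
move=> [a b] [c d]; have h1 := sqsumB a c; have h2 := sqsumB b d.
split; [move: h1 | move: h2]; congr sqsum; apply/funext => x /=; by rewrite (ReB, ImB).
Qed.

Lemma cenergy_triangle F G H : csqsum F -> csqsum G -> csqsum H ->
  cenergy (fun x => F x - H x) <=
  2 * cenergy (fun x => F x - G x) + 2 * cenergy (fun x => G x - H x).
Proof.
move=> [a1 a2] [b1 b2] [c1 c2]; have h1 := energy_triangle a1 b1 c1; have h2 := energy_triangle a2 b2 c2.
have eR (A B : R -> R[i]) : energy (Re \o (fun x => A x - B x)) = energy (fun x => Re (A x) - Re (B x)).
  by apply: eq_Rint => x /=; rewrite ReB.
have eI (A B : R -> R[i]) : energy (Im \o (fun x => A x - B x)) = energy (fun x => Im (A x) - Im (B x)).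
  by apply: eq_Rint => x /=; rewrite ImB.
rewrite /cenergy !eR !eI; move: h1 h2 => /=; lra.
Qed.

Lemma cenergyBC F G : cenergy (fun x => F x - G x) = cenergy (fun x => G x - F x).
Proof. by rewrite /cenergy; congr (_ + _); apply: eq_Rint => x /=; rewrite !(ReB, ImB); ring. Qed.

Lemma L2_limitP (F : R -> R -> R[i]) G : (forall r, 0 < r -> csqsum (F r)) -> csqsum G ->
  L2_limit F G <-> forall e, 0 < e -> exists2 r0, 0 < r0 &
    forall r, r0 <= r -> cenergy (fun x => F r x - G x) <= e.
Proof.
move=> sF sG; have sB r : 0 < r -> csqsum (fun x => F r x - G x).
  by move=> r0; apply: csqsumB => //; exact: sF.
split=> [[_ _ lim] e e0|H].
  have e1 : 0 < Num.sqrt e by rewrite sqrtr_gt0.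
  have /fine_cvgP[[M1 [_ H1]] /cvgrPdist_le/(_ _ e1)[M2 [_ H2]]] := lim.
  have m1 : M1 <= `|M1| := ler_norm _; have m2 : M2 <= `|M2| := ler_norm _.
  have n1 : 0 <= `|M1| := normr_ge0 _; have n2 : 0 <= `|M2| := normr_ge0 _.
  exists (`|M1| + `|M2| + 1) => [|r rM]; first by lra.
  have r0 : 0 < r by lra.
  have h1 := H1 r ltac:(lra); have := H2 r ltac:(lra).
  rewrite /= sub0r normrN => h2.
  have : (L2norm (fun x => F r x - G x)%R <= (Num.sqrt e)%:E)%E.
    by rewrite -[leLHS](fineK h1) lee_fin; exact: le_trans (ler_norm _) h2.
  by rewrite L2norm_le ?sqrtr_ge0 ?sqr_sqrtr ?(ltW e0)//; exact: sB.
split; [by move=> r r0; apply/L2P; exact: sF | exact/L2P |].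
have near_le e : 0 < e -> exists2 r0, 0 < r0 & forall r, r0 < r ->
    (0 <= L2norm (fun x => F r x - G x)%R <= e%:E)%E.
  move=> e0; have [r0 r00 Hr] := H _ (exprn_gt0 2 e0).
  exists r0 => // r rr; rewrite Lnorm_ge0/= L2norm_le ?(ltW e0)//; last exact: sB (lt_trans r00 rr).
  exact: Hr (ltW rr).
apply/fine_cvgP; split.
  have [r0 r00 Hr] := near_le 1 ltr01; exists r0; split; first exact: num_real.
  by move=> r /Hr/andP[a b]; rewrite ge0_fin_numE//; apply: le_lt_trans b _; exact: ltry.
apply/cvgrPdist_le => e /near_le[r0 r00 Hr]; exists r0; split; first exact: num_real.
move=> r /Hr /=; rewrite sub0r normrN.
by case: (L2norm _) => [a||]//=; rewrite ?lee_fin => /andP[a0 ae]; rewrite ger0_norm.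
Qed.

Lemma sqsum_oppr f : sqsum f -> sqsum (fun x => f (- x)).
Proof.
by move=> [mf sf]; split; [exact: measurable_oppr | exact: (summable_oppr sf)].
Qed.

(** An integral over the line depends only on the even part of the integrand. *)
Lemma eq_Rint_symmetric f h : summable f -> summable h ->
  (forall x, f x + f (- x) = h x + h (- x)) -> \int[mu]_x f x = \int[mu]_x h x.
Proof.
have dbl p : summable p -> \int[mu]_x (p x + p (- x)) = 2 * \int[mu]_x p x.
  move=> sp; rewrite (RintD sp (summable_oppr sp)) Rint_oppr; last exact: summable_measurable.
  by ring.
move=> sf sh fh; have := eq_Rint fh; rewrite !dbl//.
by apply: mulfI; rewrite pnatr_eq0.
Qed.

(** The quadratic [energy (p + t (f - h)) = energy p + 2 t I] in [t] stays
    nonnegative, so its slope vanishes. *)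
Lemma energy0_inner f h p : sqsum f -> sqsum h -> sqsum p ->
  energy (fun x => f x - h x) = 0 -> \int[mu]_x (f x * p x) = \int[mu]_x (h x * p x).
Proof.
move=> sf sh sp e0; apply/eqP; rewrite -subr_eq0 -RintB; [|exact: summable_mul|exact: summable_mul].
under eq_Rint do rewrite -mulrBl.
have sd := sqsumB sf sh; set I := \int[mu]_x _.
have H t : 0 <= energy p + 2 * (t * I).
  have := energy_ge0 (fun x => p x + t * (f x - h x)).
  rewrite (energyD sp (sqsumZ t sd)) (energyZ _ sd) e0 mulr0 addr0.
  rewrite -[in X in _ -> X](RintZ t (summable_mul sd sp)); congr (_ <= _ + 2 * _).
  by apply: eq_Rint => x; ring.
apply/negPn/negP => I0; have := H (- (energy p + 1) / (2 * I)).
rewrite (_ : _ + _ = -1); first by lra.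
by field.
Qed.

Lemma energy_eq0 f : sqsum f -> energy f = 0 <-> \forall x \ae mu, f x = 0.
Proof.
move=> [mf sf].
have m2 := measurable_EFin (measurable_sqr mf).
have abs_energy : (\int[mu]_(x in setT) `|(f x ^+ 2)%:E| = (energy f)%:E)%E.
  by under eq_integral do rewrite gee0_abs ?lee_fin ?sqr_ge0//; rewrite -EFin_Rint.
have [h1 h2] := ae_eq_integral_abs mu measurableT m2; split=> [e0|f0].
  have := h1 (etrans abs_energy (congr1 EFin e0)); apply: filterS => x /(_ Logic.I)[/eqP].
  by rewrite sqrf_eq0 => /eqP.
apply: EFin_inj; rewrite -abs_energy; apply: h2; move: f0.
apply: filterS; first exact: (ae_filter_ringOfSetsType mu).
by move=> x fx _; rewrite fx expr0n.
Qed.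

End complex_L2.

(** * The complex transform and the theorem *)
Section assembly.
Context {R : realType} (nu : R) (nu_gt0 : 0 < nu).
Local Notation mu := (@lebesgue_measure R).
Local Notation g := (nu + 2).
Local Notation C := (plancherel_const nu).
Local Notation Gr := (Gr nu).
Local Notation kern := (kern nu).
Local Notation cosp := (cos_part nu).
Local Notation sinp := (sin_part nu).
Local Notation transf := (transf nu).
Local Notation Re := (@complex.Re R).
Local Notation Im := (@complex.Im R).
Implicit Types (q r t x y : R) (X Y : R -> R) (G H : R -> R[i]).

Let C_gt0 : 0 < C. Proof. exact: plancherel_const_gt0. Qed.

Definition even_part X q : R := (X q + X (- q)) / 2.
Definition odd_part X q : R := (X q - X (- q)) / 2.

(** The complex transform of a function, read off from the real transforms [X] and [Y]
    of its real and imaginary parts: since [kern (- x) = cos_part x - sin_part x],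
    the even and odd parts of a real transform are its integrals against
    [cos_part] and [sin_part]. *)
Definition spectrum X Y q : R[i] :=
  (even_part X q + odd_part Y q) +i* (even_part Y q - odd_part X q).

Lemma sqsum_even_part X : sqsum X -> sqsum (even_part X).
Proof.
move=> sX; have := sqsumZ 2^-1 (sqsumD sX (sqsum_oppr sX)).
by congr sqsum; apply/funext => q; rewrite mulrC.
Qed.

Lemma sqsum_odd_part X : sqsum X -> sqsum (odd_part X).
Proof.
move=> sX; have := sqsumZ 2^-1 (sqsumB sX (sqsum_oppr sX)).
by congr sqsum; apply/funext => q; rewrite mulrC.
Qed.

Lemma csqsum_spectrum X Y : sqsum X -> sqsum Y -> csqsum (spectrum X Y).
Proof.
move=> sX sY; split.
  exact: (sqsumD (sqsum_even_part sX) (sqsum_odd_part sY)).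
exact: (sqsumB (sqsum_even_part sY) (sqsum_odd_part sX)).
Qed.

(** The products of even and odd parts cancel on adding the values at [q] and [- q]. *)
Lemma spectrum_inner X1 X2 Y1 Y2 : sqsum X1 -> sqsum X2 -> sqsum Y1 -> sqsum Y2 ->
  let A := spectrum X1 X2 in let B := spectrum Y1 Y2 in
  \int[mu]_q (Re (A q) * Re (B q) + Im (A q) * Im (B q)) =
  \int[mu]_q (X1 q * Y1 q + X2 q * Y2 q) /\
  \int[mu]_q (Re (A q) * Im (B q) - Im (A q) * Re (B q)) =
  \int[mu]_q (X1 q * Y2 q - X2 q * Y1 q).
Proof.
move=> s1 s2 s3 s4 A B; have [a1 a2] := csqsum_spectrum s1 s2.
have [b1 b2] := csqsum_spectrum s3 s4; split; apply: eq_Rint_symmetric.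
- exact: (summableD (summable_mul a1 b1) (summable_mul a2 b2)).
- exact: (summableD (summable_mul s1 s3) (summable_mul s2 s4)).
- by move=> q; rewrite /A /B /spectrum /even_part /odd_part /= !opprK; field.
- exact: (summableB (summable_mul a1 b2) (summable_mul a2 b1)).
- exact: (summableB (summable_mul s1 s4) (summable_mul s2 s3)).
- by move=> q; rewrite /A /B /spectrum /even_part /odd_part /= !opprK; field.
Qed.

Lemma cenergy_spectrum X Y : sqsum X -> sqsum Y ->
  cenergy (spectrum X Y) = energy X + energy Y.
Proof.
move=> sX sY; have [sR sI] := csqsum_spectrum sX sY.
have [h _] := spectrum_inner sX sY sX sY.
rewrite /cenergy -RintD; [|exact: sR.2|exact: sI.2].
rewrite -RintD; [|exact: sX.2|exact: sY.2].
by under eq_Rint do rewrite !expr2; rewrite h; apply: eq_Rint => q; rewrite !expr2.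
Qed.

Lemma spectrumB X1 X2 Y1 Y2 q :
  spectrum X1 X2 q - spectrum Y1 Y2 q =
  spectrum (fun q => X1 q - Y1 q) (fun q => X2 q - Y2 q) q.
Proof.
by apply/eqP; rewrite eq_complex /spectrum /even_part /odd_part /=;
  apply/andP; split; apply/eqP; field.
Qed.

Lemma cos_transf r X q : sqsum X -> supp_in r X ->
  summable (fun x => cosp (q * x) * X x) /\
  \int[mu]_x (cosp (q * x) * X x) = even_part (transf X) q.
Proof.
move=> sX rX; have [c _ H1] := transf_compact_bound nu_gt0 q r.
have [c' _ H2] := transf_compact_bound nu_gt0 (- q) r.
have [h1 _] := H1 X sX rX 1 ltr01; have [h2 _] := H2 X sX rX 1 ltr01.
have eq x : cosp (q * x) * X x = 2^-1 * (kern (q * x) * X x + kern (- q * x) * X x).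
  by rewrite mulNr /kern cos_partN sin_partN; field.
rewrite (funext eq); split; first by apply: summableZ; exact: summableD.
rewrite (RintZ _ (summableD h1 h2)) RintD// mulrC.
by [].
Qed.

Lemma sin_transf r X q : sqsum X -> supp_in r X ->
  summable (fun x => sinp (q * x) * X x) /\
  \int[mu]_x (sinp (q * x) * X x) = odd_part (transf X) q.
Proof.
move=> sX rX; have [c _ H1] := transf_compact_bound nu_gt0 q r.
have [c' _ H2] := transf_compact_bound nu_gt0 (- q) r.
have [h1 _] := H1 X sX rX 1 ltr01; have [h2 _] := H2 X sX rX 1 ltr01.
have eq x : sinp (q * x) * X x = 2^-1 * (kern (q * x) * X x - kern (- q * x) * X x).
  by rewrite mulNr /kern cos_partN sin_partN; field.
rewrite (funext eq); split; first by apply: summableZ; exact: summableB.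
rewrite (RintZ _ (summableB h1 h2)) RintB// mulrC.
by [].
Qed.

Lemma ball_integral r (F F0 : R -> R) : (forall x, F0 x = if `|x| < r then F x else 0) ->
  summable F0 -> mu.-integrable [set x | `|x| < r] (fun x => (F x)%:E) /\
  \int[mu]_(x in [set x | `|x| < r]) F x = \int[mu]_x F0 x.
Proof.
move=> F0E sF0; have mB := measurable_ball0 r.
have E : EFin \o F0 = (fun x => (F x)%:E) \_ [set x | `|x| < r].
  apply/funext => x; rewrite patchE /= F0E; case: ifPn => xr.
    by rewrite mem_set.
  by rewrite memNset//=; exact/negP.
split.
  by apply/integrable_mkcond; [exact: mB | rewrite -E].
rewrite /Rintegral integral_mkcond -E//.
Qed.

Lemma truncated_transform_spectrum G r q : csqsum G ->
  cintegrable [set x | `|x| < r] (transform_integrand nu G q) /\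
  truncated_transform nu G r q =
  spectrum (transf (cut r (Re \o G))) (transf (cut r (Im \o G))) q.
Proof.
move=> [s1 s2]; have c1 := sqsum_cut r s1; have c2 := sqsum_cut r s2.
have [a1 e1] := cos_transf q c1 (@supp_in_cut _ r _).
have [a2 e2] := cos_transf q c2 (@supp_in_cut _ r _).
have [a3 e3] := sin_transf q c1 (@supp_in_cut _ r _).
have [a4 e4] := sin_transf q c2 (@supp_in_cut _ r _).
have [|i1 E1] := @ball_integral r (fun x => Re (transform_integrand nu G q x)) _ _ (summableD a1 a4).
  move=> x; rewrite !cutE; case: ifP => _; last by rewrite !mulr0 addr0.
  by rewrite /transform_integrand (eeE nu_gt0) /=; case: (G x) => a b /=; ring.
have [|i2 E2] := @ball_integral r (fun x => Im (transform_integrand nu G q x)) _ _ (summableB a2 a3).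
  move=> x; rewrite !cutE; case: ifP => _; last by rewrite !mulr0 subr0.
  by rewrite /transform_integrand (eeE nu_gt0) /=; case: (G x) => a b /=; ring.
split; first by split.
rewrite /truncated_transform /cintegral E1 E2 RintD// RintB// e1 e2 e3 e4.
by [].
Qed.

Lemma csqsum_truncated G r : 0 < r -> csqsum G -> csqsum (truncated_transform nu G r).
Proof.
move=> r0 sG; have [s1 s2] := sG.
rewrite (funext (fun q => (truncated_transform_spectrum r q sG).2)).
have [_ h1 _] := cut_Gr nu_gt0 r0 s1; have [_ h2 _] := cut_Gr nu_gt0 r0 s2.
exact: csqsum_spectrum.
Qed.

Lemma spectrum_is_transform G X Y : Gr (Re \o G) X -> Gr (Im \o G) Y ->
  is_transform nu G (spectrum X Y).
Proof.
move=> GX GY; have [s1 sX _] := GX; have [s2 sY _] := GY.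
have sG : csqsum G by split.
apply/L2_limitP.
- by move=> r r0; exact: csqsum_truncated.
- exact: csqsum_spectrum.
move=> e e0; have e2 : 0 < e / (2 * C) by rewrite divr_gt0// mulr_gt0.
have [r1 r10 H1] := cut_cvg s1 e2; have [r2 r20 H2] := cut_cvg s2 e2.
exists (r1 + r2) => [|r rr]; first by rewrite addr_gt0.
have r0 : 0 < r by lra.
have h1 := H1 r ltac:(lra); have h2 := H2 r ltac:(lra).
have [_ t1 _] := cut_Gr nu_gt0 r0 s1; have [_ t2 _] := cut_Gr nu_gt0 r0 s2.
have -> : (fun q => truncated_transform nu G r q - spectrum X Y q) =
    spectrum (fun q => transf (cut r (Re \o G)) q - X q) (fun q => transf (cut r (Im \o G)) q - Y q).
  by apply/funext => q; rewrite (truncated_transform_spectrum r q sG).2 spectrumB.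
rewrite cenergy_spectrum; [|exact: sqsumB|exact: sqsumB].
rewrite (transf_cut_dist nu_gt0 r0 GX) (transf_cut_dist nu_gt0 r0 GY) -mulrDr.
have -> : e = C * (e / (2 * C) + e / (2 * C)) by field; rewrite gt_eqF.
by rewrite ler_wpM2l ?(ltW C_gt0)// lerD.
Qed.

Lemma is_transform_unique G A B : csqsum G -> is_transform nu G A -> is_transform nu G B ->
  cenergy (fun q => A q - B q) = 0.
Proof.
move=> sG tA tB; have sT r (r0 : 0 < r) := csqsum_truncated r0 sG.
have sA : csqsum A by apply/L2P; have [_] := tA.
have sB : csqsum B by apply/L2P; have [_] := tB.
have HA := (L2_limitP sT sA).1 tA; have HB := (L2_limitP sT sB).1 tB.
apply/eqP; rewrite eq_le cenergy_ge0 andbT.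
apply: (@le_of_le_add_eps _ _ _ 4) => // e /andP[e0 _]; rewrite add0r.
have [r1 r10 h1] := HA e e0; have [r2 r20 h2] := HB e e0.
have r0 : 0 < r1 + r2 by rewrite addr_gt0.
have {}h1 := h1 (r1 + r2) ltac:(lra); have {}h2 := h2 (r1 + r2) ltac:(lra).
have := cenergy_triangle sA (sT _ r0) sB; rewrite cenergyBC in h1; lra.
Qed.

(** An L2 limit being unique up to null sets, any transform may be replaced by the one
    built from the real transforms. *)
Lemma is_transform_spectrum G A : csqsum G -> is_transform nu G A -> exists X Y,
  [/\ Gr (Re \o G) X, Gr (Im \o G) Y,
      energy (fun q => Re (A q) - Re (spectrum X Y q)) = 0 &
      energy (fun q => Im (A q) - Im (spectrum X Y q)) = 0].
Proof.
move=> sG tA; have [s1 s2] := sG.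
have [X GX] := Gr_exists nu_gt0 s1; have [Y GY] := Gr_exists nu_gt0 s2.
exists X, Y; have := is_transform_unique sG tA (spectrum_is_transform GX GY).
rewrite /cenergy => /eqP; rewrite paddr_eq0 ?energy_ge0// => /andP[/eqP h1 /eqP h2].
split => //; [rewrite -[RHS]h1 | rewrite -[RHS]h2];
  by apply: eq_Rint => q /=; rewrite (ReB, ImB).
Qed.

Lemma transform_exists G : L2 G ->
  (forall r q, 0 < r -> cintegrable [set x | `|x| < r] (transform_integrand nu G q)) /\
  exists A, is_transform nu G A.
Proof.
move=> /L2P sG; have [s1 s2] := sG; split=> [r q _|].
  by have [] := truncated_transform_spectrum r q sG.
have [X GX] := Gr_exists nu_gt0 s1; have [Y GY] := Gr_exists nu_gt0 s2.
by exists (spectrum X Y); exact: spectrum_is_transform.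
Qed.

Lemma conjc_mulE G H : (fun x => conjc (G x) * H x) = (fun x =>
  (Re (G x) * Re (H x) + Im (G x) * Im (H x)) +i* (Re (G x) * Im (H x) - Im (G x) * Re (H x))).
Proof.
apply/funext => x; case: (G x) (H x) => a b [c d]; apply/eqP; rewrite eq_complex /=.
by apply/andP; split; apply/eqP; ring.
Qed.

Lemma cintegrable_conjc_mul G H : csqsum G -> csqsum H ->
  cintegrable setT (fun x => conjc (G x) * H x).
Proof.
move=> [g1 g2] [h1 h2]; rewrite conjc_mulE; split => /=.
  exact: (summableD (summable_mul g1 h1) (summable_mul g2 h2)).
exact: (summableB (summable_mul g1 h2) (summable_mul g2 h1)).
Qed.

Lemma plancherel_formula G H A B : L2 G -> L2 H ->
  is_transform nu G A -> is_transform nu H B ->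
  [/\ cintegrable setT (fun x => conjc (G x) * H x),
      cintegrable setT (fun q => conjc (A q) * B q) &
      cintegral setT (fun x => conjc (G x) * H x) =
      (C^-1)%:C * cintegral setT (fun q => conjc (A q) * B q)].
Proof.
move=> /L2P sG /L2P sH tA tB.
have sA : csqsum A by apply/L2P; have [_] := tA.
have sB : csqsum B by apply/L2P; have [_] := tB.
split; [exact: cintegrable_conjc_mul | exact: cintegrable_conjc_mul |].
have [X1 [X2 [GX1 GX2 e1 e2]]] := is_transform_spectrum sG tA.
have [Y1 [Y2 [GY1 GY2 e3 e4]]] := is_transform_spectrum sH tB.
have [_ sX1 _] := GX1; have [_ sX2 _] := GX2; have [_ sY1 _] := GY1; have [_ sY2 _] := GY2.
have [a1 a2] := sA; have [b1 b2] := sB; have [g1 g2] := sG; have [h1 h2] := sH.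
have [c1 c2] := csqsum_spectrum sX1 sX2; have [d1 d2] := csqsum_spectrum sY1 sY2.
have swap (u v p w : R -> R) : sqsum u -> sqsum v -> sqsum p -> sqsum w ->
    energy (fun x => u x - v x) = 0 -> energy (fun x => p x - w x) = 0 ->
    \int[mu]_x (u x * p x) = \int[mu]_x (v x * w x).
  move=> su sv sp sw uv pw; rewrite (energy0_inner su sv sp uv).
  under eq_Rint do rewrite mulrC; rewrite (energy0_inner sp sw sv pw).
  by apply: eq_Rint => x; rewrite mulrC.
have [in1 in2] := spectrum_inner sX1 sX2 sY1 sY2.
rewrite !conjc_mulE /cintegral /= !RintB ?RintD; try exact: summable_mul.
have C0 : C != 0 by rewrite gt_eqF.
apply/eqP; rewrite eq_complex /= !mul0r subr0 addr0; apply/andP; split; apply/eqP.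
  rewrite (swap _ _ _ _ a1 c1 b1 d1 e1 e3) (swap _ _ _ _ a2 c2 b2 d2 e2 e4).
  rewrite -RintD; [|exact: summable_mul|exact: summable_mul].
  rewrite [X in _ = _ * X]in1 RintD; [|exact: summable_mul|exact: summable_mul].
  rewrite (Gr_inner nu_gt0 GX1 GY1) (Gr_inner nu_gt0 GX2 GY2) -mulrDr mulKf//.
rewrite (swap _ _ _ _ a1 c1 b2 d2 e1 e4) (swap _ _ _ _ a2 c2 b1 d1 e2 e3).
rewrite -RintB; [|exact: summable_mul|exact: summable_mul].
rewrite [X in _ = _ * X]in2 RintB; [|exact: summable_mul|exact: summable_mul].
by rewrite (Gr_inner nu_gt0 GX1 GY2) (Gr_inner nu_gt0 GX2 GY1) -mulrBr mulKf.
Qed.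

(** An isometry is injective. *)
Lemma transform_complete : complete_system nu.
Proof.
move=> G A /L2P sG tA A0; have [s1 s2] := sG.
have [X [Y [GX GY e1 e2]]] := is_transform_spectrum sG tA.
have [_ sX _] := GX; have [_ sY _] := GY.
have [a1 a2] : csqsum A by apply/L2P; have [_] := tA.
have [c1 c2] := csqsum_spectrum sX sY.
have zero (p u : R -> R) : sqsum p -> sqsum u -> energy (fun q => p q - u q) = 0 ->
    (\forall q \ae mu, p q = 0) -> energy u = 0.
  move=> sp su pu /(energy_eq0 sp) p0; apply/eqP; rewrite eq_le energy_ge0 andbT.
  have := energyD_le sp (sqsumB su sp); rewrite energyBC pu p0 !mulr0 addr0.
  by rewrite (_ : energy (fun x => p x + (u x - p x)) = energy u)//;
    apply: eq_Rint => x; rewrite addrC subrK.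
have A1 : \forall q \ae mu, Re (A q) = 0.
  by move: A0; apply: filterS; [exact: (ae_filter_ringOfSetsType mu) | move=> q ->].
have A2 : \forall q \ae mu, Im (A q) = 0.
  by move: A0; apply: filterS; [exact: (ae_filter_ringOfSetsType mu) | move=> q ->].
have := cenergy_spectrum sX sY; rewrite /cenergy.
rewrite (zero _ _ a1 c1 e1 A1) (zero _ _ a2 c2 e2 A2) addr0 => /esym/eqP.
rewrite (Gr_isometry nu_gt0 GX) (Gr_isometry nu_gt0 GY) -mulrDr mulf_eq0 (gt_eqF C_gt0)/=.
rewrite paddr_eq0 ?energy_ge0// => /andP[/eqP/(energy_eq0 s1) g1 /eqP/(energy_eq0 s2) g2].
move: g1 g2; apply: filterS2; first exact: (ae_filter_ringOfSetsType mu).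
by move=> x /=; case: (G x) => a b /= -> ->.
Qed.

(** The real part of the complex integrand is the even part in [q] of
    [heat_integrand nu t x y]; the imaginary part is odd. *)
Lemma heat_kernel_transform t x y : 0 < t ->
  let f q := (expR (- (t / 2 * `|q| `^ g)))%:C * eeq nu q x * conjc (eeq nu q y) in
  cintegrable setT f /\ (heat_kernel nu t x y)%:C = (C^-1)%:C * cintegral setT f.
Proof.
move=> t0 f; pose H := heat_integrand nu t.
have sH a b : summable (H a b) by exact: summable_heat_integrand.
have HN a b q : H a b (- q) = H (- a) (- b) q.
  by rewrite /H /heat_integrand gaussN !mulNr !mulrN.
have kernE z : kern z = cosp z + sinp z by [].
have fE : f = (fun q => (2^-1 * (H x y q + H (- x) (- y) q)) +i*
    (2^-1 * (H x (- y) q - H (- x) y q))).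
  apply/funext => q; rewrite /f /H /heat_integrand gaussE /eeq !(eeE nu_gt0) !mulrN.
  rewrite !kernE !cos_partN !sin_partN; move: (expR _) (cosp _) (cosp _) (sinp _) (sinp _) => *.
  by apply/eqP; rewrite eq_complex /=; apply/andP; split; apply/eqP; field.
have sR := summableD (sH x y) (sH (- x) (- y)).
have sI := summableB (sH x (- y)) (sH (- x) y).
rewrite fE; split; first by split; apply: summableZ.
have mH a b : measurable_fun setT (H a b) := summable_measurable (sH a b).
have flip a b : \int[mu]_q H (- a) (- b) q = \int[mu]_q H a b q.
  by rewrite -(Rint_oppr (mH a b)); apply: eq_Rint => q; rewrite HN.
rewrite /cintegral /= !RintZ// RintD// RintB// flip.
have := flip x (- y); rewrite opprK => ->; rewrite subrr mulr0.
rewrite (heat_kernelE nu_gt0 t0).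
have := heat_closed_spectral nu_gt0 t0 x y; rewrite /heat_spectral -/(H x y) => <-.
have C0 : C != 0 by rewrite gt_eqF.
apply/eqP; rewrite eq_complex /= !mul0r mulr0 addr0 subr0 eqxx andbT.
by apply/eqP; field.
Qed.

End assembly.

Theorem proposition3p1 (R : realType) (nu : R) (nu_gt0 : 0 < nu) :
  [/\ (forall q : R,
         generalized_eigenfunction nu (- (2^-1 * `|q| `^ (nu + 2)))
           (eeq nu q)) /\
      complete_system nu,
      (forall g : R -> R[i], L2 g ->
         (forall r q : R, 0 < r ->
            cintegrable [set x | `|x| < r] (transform_integrand nu g q)) /\
         (exists gt : R -> R[i], is_transform nu g gt)) /\
      (forall g h gt ht : R -> R[i], L2 g -> L2 h ->
         is_transform nu g gt -> is_transform nu h ht ->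
         [/\ cintegrable setT (fun x => conjc (g x) * h x),
             cintegrable setT (fun q => conjc (gt q) * ht q) &
             cintegral setT (fun x => conjc (g x) * h x) =
             ((4 * u_coef nu ^+ 2)^-1)%:C *
             cintegral setT (fun q => conjc (gt q) * ht q)]) &
      forall t x x' : R, 0 < t ->
        let f (q : R) := (expR (- (t / 2 * `|q| `^ (nu + 2))))%:C *
                         eeq nu q x * conjc (eeq nu q x') in
        cintegrable setT f /\
        (heat_kernel nu t x x')%:C =
          ((4 * u_coef nu ^+ 2)^-1)%:C * cintegral setT f].
Proof.
split; first by split; [exact: eeq_eigenfunction | exact: transform_complete].
  split; first exact: transform_exists.
  by move=> g h gt ht; exact: plancherel_formula.
by move=> t x y; exact: heat_kernel_transform.
Qed.
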